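(* Assume that $\dfrac{4\|\nabla\nu\|_{\infty,\Omega}^2}{\sigma_{\min}\nu_0^2}<\dfrac14$, that $\kappa_1\in(\frac12,\frac32)$ and that $\kappa_2>\frac{\nu_0}{4}$. Let $f\in L^2(\Omega)^3$, let $k\ge1$, $\ell\ge0$ be integers, and let $H_h,Z_h,Q_h$ be the finite element spaces defined in the context. Then, for each $h$, there exists a unique $((u_h,\omega_h),p_h)\in(H_h\times Z_h)\times Q_h$ such that $$A((u_h,\omega_h),(v_h,\theta_h))+B((v_h,\theta_h),p_h)=G(v_h,\theta_h)\quad\forall(v_h,\theta_h)\in H_h\times Z_h,$$ $$B((u_h,\omega_h),q_h)=0\quad\forall q_h\in Q_h.$$ Furthermore, there exist constants $\hat C_1,\hat C_2>0$, independent of $h$ and $f$, such that $$\|(u_h,\omega_h)\|_{H_0^1(\Omega)^3\times L^2(\Omega)^3}+\|p_h\|_{0,\Omega}\le\hat C_1\|f\|_{0,\Omega}$$ and $$\|(u,\omega)-(u_h,\omega_h)\|_{H_0^1(\Omega)^3\times L^2(\Omega)^3}+\|p-p_h\|_{0,\Omega}\le\hat C_2\inf_{(v_h,\theta_h,q_h)\in H_h\times Z_h\times Q_h}\left(|\!|\!|u-v_h|\!|\!|_{1,\Omega}+\|\omega-\theta_h\|_{0,\Omega}+\|p-q_h\|_{0,\Omega}\right),$$ where $((u,\omega),p)\in(H_0^1(\Omega)^3\times L^2(\Omega)^3)\times L_0^2(\Omega)$ is the unique solution of $$A((u,\omega),(v,\theta))+B((v,\theta),p)=G(v,\theta)\quad\forall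 (v,\theta)\in H_0^1(\Omega)^3\times L^2(\Omega)^3,\qquad B((u,\omega),q)=0\quad\forall q\in L_0^2(\Omega).$$
   Context: $\Omega\subset\mathbb{R}^3$ is a bounded domain with Lipschitz boundary. $\nu\in W^{1,\infty}(\Omega)$ satisfies $0<\nu_0\le\nu\le\nu_1$ in $\Omega$ for constants $\nu_0,\nu_1$. $\mathbf{K}\in L^\infty(\Omega)^{3\times3}$ is symmetric and uniformly positive definite, and $\sigma_{\min},\sigma_{\max}>0$ are constants such that $\sigma_{\min}|w|^2\le w^{t}\mathbf{K}^{-1}w\le\sigma_{\max}|w|^2$ for all $w\in\mathbb{R}^3$ (a.e. in $\Omega$). $\kappa_1,\kappa_2>0$ are real parameters. $\|\cdot\|_{0,\Omega}$ is the $L^2(\Omega)$ norm and $\|\cdot\|_{1,\Omega}$ the usual $H^1(\Omega)$ norm (scalar, vector or tensor valued); $\|\nabla\nu\|_{\infty,\Omega}$ is the essential supremum over $\Omega$ of the Euclidean norm of $\nabla\nu$; $L_0^2(\Omega)=\{q\in L^2(\Omega):\int_\Omega q=0\}$; $\varepsilon(u)=\frac12(\nabla u+(\nabla u)^t)$ is the strain rate tensor. For $(u,\omega),(v,\theta)\in H_0^1(\Omega)^3\times L^2(\Omega)^3$ and $q\in L_0^2(\Omega)$, define $$A((u,\omega),(v,\theta))=\int_\Omega\nu\mathbf{K}^{-1}u\cdot v+\int_\Omega\nu\,\omega\cdot\theta+\int_\Omega\nu\,\omega\cdot\operatorname{curl}v-\int_\Omega\nu\,\theta\cdot\operatorname{curl}u+\kappa_1\nu_0\int_\Omega\operatorname{curl}u\cdot\operatorname{curl}v+\kappa_2\int_\Omega\operatorname{div}u\,\operatorname{div}v-\kappa_1\nu_0\int_\Omega\omega\cdot\operatorname{curl}v-2\int_\Omega\varepsilon(u)\nabla\nu\cdot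 v+\int_\Omega\omega\cdot(\nabla\nu\times v),$$ $$B((v,\theta),q)=-\int_\Omega q\,\operatorname{div}v,\qquad G(v,\theta)=\int_\Omega f\cdot v.$$ Norms: $|\!|\!|v|\!|\!|_{1,\Omega}^2=\|v\|_{0,\Omega}^2+\|\operatorname{curl}v\|_{0,\Omega}^2+\|\operatorname{div}v\|_{0,\Omega}^2$ and $\|(v,\theta)\|_{H_0^1(\Omega)^3\times L^2(\Omega)^3}^2=|\!|\!|v|\!|\!|_{1,\Omega}^2+\|\theta\|_{0,\Omega}^2$. Finite element spaces: $\{\mathcal{T}_h\}_{h>0}$ is a shape-regular family of (conforming) partitions of $\bar\Omega$ into tetrahedra $T$ of diameter $h_T$, with $h=\max_{T\in\mathcal{T}_h}h_T$; $\mathbb{P}_m(T)$ is the space of polynomials of total degree at most $m$ on $T$. For integers $k\ge1$, $\ell\ge0$: $$H_h=\{v_h\in H^1(\Omega)^3: v_h|_T\in\mathbb{P}_{k+1}(T)^3\ \forall T\in\mathcal{T}_h\}\cap H_0^1(\Omega)^3,$$ $$Z_h=\{\theta_h\in L^2(\Omega)^3:\theta_h|_T\in\mathbb{P}_\ell(T)^3\ \forall T\in\mathcal{T}_h\},$$ $$Q_h=\{q_h\in H^1(\Omega): q_h|_T\in\mathbb{P}_k(T)\ \forall T\in\mathcal{T}_h\}\cap L_0^2(\Omega).$$ Standing assumption: the (generalised Hood-Taylor) pair $(H_h,Q_h)$ satisfies the discrete Stokes inf-sup condition: there is $\tilde\beta_2>0$, independent of $h$, with $\sup_{0\ne v_h\in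 H_h}\frac{\int_\Omega q_h\operatorname{div}v_h}{\|v_h\|_{1,\Omega}}\ge\tilde\beta_2\|q_h\|_{0,\Omega}$ for all $q_h\in Q_h$. *)

(* Defs.v *)
From HB Require Import structures.
From mathcomp Require Import all_boot all_order all_algebra finmap.
From mathcomp Require Import all_classical all_reals all_analysis.
From mathcomp Require mpoly.
Import (canonicals, coercions) mpoly.
Set Implicit Arguments.
Unset Strict Implicit.
Unset Printing Implicit Defensive.
Import Order.TTheory GRing.Theory Num.Theory.
Import numFieldNormedType.Exports.
Local Open Scope classical_set_scope.
Local Open Scope ring_scope.

(* Points of the domain live in R * R * R, which carries the product topology,
   sigma-algebra and measure; values of vector fields live in 'cV[R]_3.
   Indices in 'I_3 are the coordinates 0, 1, 2 and are added modulo 3. *)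
Notation pt R := (R * R * R)%type.

(* measurableTypeR R is R with its Borel sigma-algebra; the library infers the
   measure structure of nested products only from structured factors. *)
Definition leb1 (R : realType) :
    {sigma_finite_measure set (measurableTypeR R) -> \bar R} :=
  @lebesgue_measure R.

Definition leb2 (R : realType) :
    {measure set (measurableTypeR R * measurableTypeR R)%type -> \bar R} :=
  (leb1 R \x leb1 R)%E.

Definition leb3 (R : realType) :
    {measure set (measurableTypeR R * measurableTypeR R * measurableTypeR R)%type
      -> \bar R} :=
  (leb2 R \x leb1 R)%E.

Arguments leb3 {R}.

Definition vec (R : realType) (x : pt R) : 'cV[R]_3 :=
  \col_i [:: x.1.1; x.1.2; x.2]`_i.

Definition basis_pt (R : realType) (i : 'I_3) : pt R :=
  ((i == 0)%:R, (i == 1)%:R, (i == 2%:R)%:R).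

Definition dot (R : realType) (a b : 'cV[R]_3) : R := \sum_i a i 0 * b i 0.

Definition enorm (R : realType) (a : 'cV[R]_3) : R := Num.sqrt (dot a a).

Definition cross (R : realType) (a b : 'cV[R]_3) : 'cV[R]_3 :=
  \col_(i < 3) (a (i + 1) 0 * b (i + 2%:R) 0 - a (i + 2%:R) 0 * b (i + 1) 0).

(** Lipschitz domains *)

(* Near each boundary point, Omega is the region strictly above the graph of a
   Lipschitz function, in Cartesian coordinates rotated by Q. *)
Definition lipschitz_boundary (R : realType) (Omega : set (pt R)) : Prop :=
  forall x0, (closure Omega `\` Omega) x0 ->
  exists (r : R) (Q : 'M[R]_3) (phi : R * R -> R),
    [/\ 0 < r, Q^T *m Q = 1%:M, [lipschitz phi x | x in setT] &
      forall x, enorm (vec (x - x0)) < r ->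
        let y := Q *m vec (x - x0) in
        Omega x <-> phi (y 0 0, y 1 0) < y 2%:R 0].

Definition bounded_lipschitz_domain (R : realType) (Omega : set (pt R)) : Prop :=
  [/\ open Omega, connected Omega, Omega !=set0, bounded_set Omega &
      lipschitz_boundary Omega].

(** Lebesgue spaces on Omega; functions are identified up to equality almost
    everywhere on Omega, and their values outside Omega are irrelevant. *)

Definition Lp (R : realType) (Omega : set (pt R)) (p : \bar R)
    : set (pt R -> R) :=
  [set f | f \_ Omega \in Lfun leb3 p].

Definition Lp_norm (R : realType) (Omega : set (pt R)) (p : \bar R)
    (f : pt R -> R) : R :=
  fine ('N[leb3]_p [EFin \o f \_ Omega]).

Notation L2 Omega := (Lp Omega 2%:E).
Notation Linfty Omega := (Lp Omega +oo%E).

Definition norm0 (R : realType) (Omega : set (pt R)) (f : pt R -> R) : R :=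
  Lp_norm Omega 2%:E f.

Definition norm0v (R : realType) (Omega : set (pt R)) (v : pt R -> 'cV[R]_3)
    : R :=
  norm0 Omega (fun x => enorm (v x)).

Definition L2v (R : realType) (Omega : set (pt R)) : set (pt R -> 'cV[R]_3) :=
  [set v | forall i, L2 Omega (fun x => v x i 0)].

Definition L20 (R : realType) (Omega : set (pt R)) : set (pt R -> R) :=
  [set q | L2 Omega q /\ \int[leb3]_(x in Omega) q x = 0].

(** Weak derivatives and Sobolev spaces *)

Definition iter_partial (R : realType) (s : seq 'I_3) (f : pt R -> R)
    : pt R -> R :=
  foldr (fun i g x => 'D_(basis_pt R i) g x) f s.

Definition smooth (R : realType) (f : pt R -> R) : Prop :=
  forall s : seq 'I_3, continuous (iter_partial s f) /\
    forall x i, derivable (iter_partial s f) x (basis_pt R i).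

Definition test_function (R : realType) (Omega : set (pt R))
    : set (pt R -> R) :=
  [set phi | [/\ smooth phi, compact (closure [set x | phi x != 0]) &
                 closure [set x | phi x != 0] `<=` Omega]].

Definition locally_L1 (R : realType) (Omega : set (pt R)) (f : pt R -> R)
    : Prop :=
  forall C, compact C -> C `<=` Omega -> leb3.-integrable C (EFin \o f).

Definition is_weak_partial (R : realType) (Omega : set (pt R)) (i : 'I_3)
    (f g : pt R -> R) : Prop :=
  [/\ locally_L1 Omega f, locally_L1 Omega g &
    forall phi, test_function Omega phi ->
      \int[leb3]_(x in Omega) (f x * 'D_(basis_pt R i) phi x) =
      - \int[leb3]_(x in Omega) (g x * phi x)].

(* A representative of the i-th weak partial derivative (0 if there is none);
   it is unique up to equality almost everywhere on Omega. *)
Definition wpartial (R : realType) (Omega : set (pt R)) (i : 'I_3)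
    (f : pt R -> R) : pt R -> R :=
  xget (fun=> 0) [set g | is_weak_partial Omega i f g].

Definition W1p (R : realType) (Omega : set (pt R)) (p : \bar R)
    : set (pt R -> R) :=
  [set f | Lp Omega p f /\
    forall i, exists2 g, Lp Omega p g & is_weak_partial Omega i f g].

Notation H1 Omega := (W1p Omega 2%:E).

Definition norm1 (R : realType) (Omega : set (pt R)) (f : pt R -> R) : R :=
  Num.sqrt (norm0 Omega f ^+ 2 + \sum_i norm0 Omega (wpartial Omega i f) ^+ 2).

Definition norm1v (R : realType) (Omega : set (pt R)) (v : pt R -> 'cV[R]_3)
    : R :=
  Num.sqrt (\sum_i norm1 Omega (fun x => v x i 0) ^+ 2).

Definition H10 (R : realType) (Omega : set (pt R)) : set (pt R -> R) :=
  [set f | H1 Omega f /\ forall eps : R, 0 < eps ->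
    exists2 phi, test_function Omega phi &
      norm1 Omega (fun x => f x - phi x) < eps].

Definition H10v (R : realType) (Omega : set (pt R)) : set (pt R -> 'cV[R]_3) :=
  [set v | forall i, H10 Omega (fun x => v x i 0)].

Definition wgrad (R : realType) (Omega : set (pt R)) (f : pt R -> R) (x : pt R)
    : 'cV[R]_3 :=
  \col_j wpartial Omega j f x.

(* Row i is the gradient of the i-th component. *)
Definition wgradv (R : realType) (Omega : set (pt R)) (v : pt R -> 'cV[R]_3)
    (x : pt R) : 'M[R]_3 :=
  \matrix_(i, j) wpartial Omega j (fun y => v y i 0) x.

Definition wdiv (R : realType) (Omega : set (pt R)) (v : pt R -> 'cV[R]_3)
    (x : pt R) : R :=
  \tr (wgradv Omega v x).

Definition wcurl (R : realType) (Omega : set (pt R)) (v : pt R -> 'cV[R]_3)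
    (x : pt R) : 'cV[R]_3 :=
  \col_(i < 3) (wgradv Omega v x (i + 2%:R) (i + 1)
              - wgradv Omega v x (i + 1) (i + 2%:R)).

Definition strain (R : realType) (Omega : set (pt R)) (v : pt R -> 'cV[R]_3)
    (x : pt R) : 'M[R]_3 :=
  2^-1 *: (wgradv Omega v x + (wgradv Omega v x)^T).

Definition tnorm1 (R : realType) (Omega : set (pt R)) (v : pt R -> 'cV[R]_3)
    : R :=
  Num.sqrt (norm0v Omega v ^+ 2 + norm0v Omega (wcurl Omega v) ^+ 2
            + norm0 Omega (wdiv Omega v) ^+ 2).

Definition pair_norm (R : realType) (Omega : set (pt R))
    (v theta : pt R -> 'cV[R]_3) : R :=
  Num.sqrt (tnorm1 Omega v ^+ 2 + norm0v Omega theta ^+ 2).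

(** Coefficients and forms of the problem *)

Definition grad_sup (R : realType) (Omega : set (pt R)) (nu : pt R -> R) : R :=
  Lp_norm Omega +oo%E (fun x => enorm (wgrad Omega nu x)).

Definition viscosity (R : realType) (Omega : set (pt R)) (nu0 nu1 : R)
    (nu : pt R -> R) : Prop :=
  [/\ 0 < nu0, W1p Omega +oo%E nu &
      {ae leb3, forall x, Omega x -> nu0 <= nu x <= nu1}].

Definition permeability (R : realType) (Omega : set (pt R)) (smin smax : R)
    (K : pt R -> 'M[R]_3) : Prop :=
  [/\ forall i j, Linfty Omega (fun x => K x i j),
      {ae leb3, forall x, Omega x -> (K x)^T = K x},
      exists2 c : R, 0 < c &
        {ae leb3, forall x, Omega x ->
          forall w : 'cV[R]_3, c * enorm w ^+ 2 <= dot w (K x *m w)},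
      0 < smin /\ 0 < smax &
      {ae leb3, forall x, Omega x -> forall w : 'cV[R]_3,
          smin * enorm w ^+ 2 <= dot w (invmx (K x) *m w)
                              <= smax * enorm w ^+ 2}].

Definition formA (R : realType) (Omega : set (pt R)) (nu : pt R -> R) (nu0 : R)
    (K : pt R -> 'M[R]_3) (kappa1 kappa2 : R)
    (u omega v theta : pt R -> 'cV[R]_3) : R :=
  \int[leb3]_(x in Omega) (nu x * dot (invmx (K x) *m u x) (v x))
  + \int[leb3]_(x in Omega) (nu x * dot (omega x) (theta x))
  + \int[leb3]_(x in Omega) (nu x * dot (omega x) (wcurl Omega v x))
  - \int[leb3]_(x in Omega) (nu x * dot (theta x) (wcurl Omega u x))
  + kappa1 * nu0
    * \int[leb3]_(x in Omega) dot (wcurl Omega u x) (wcurl Omega v x)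
  + kappa2 * \int[leb3]_(x in Omega) (wdiv Omega u x * wdiv Omega v x)
  - kappa1 * nu0 * \int[leb3]_(x in Omega) dot (omega x) (wcurl Omega v x)
  - 2 * \int[leb3]_(x in Omega)
          dot (strain Omega u x *m wgrad Omega nu x) (v x)
  + \int[leb3]_(x in Omega) dot (omega x) (cross (wgrad Omega nu x) (v x)).

Definition formB (R : realType) (Omega : set (pt R)) (v : pt R -> 'cV[R]_3)
    (q : pt R -> R) : R :=
  - \int[leb3]_(x in Omega) (q x * wdiv Omega v x).

Definition formG (R : realType) (Omega : set (pt R))
    (f v : pt R -> 'cV[R]_3) : R :=
  \int[leb3]_(x in Omega) dot (f x) (v x).

(* Both the continuous and the discrete problems, according to the choice of
   the spaces V, W, Q of velocities, vorticities and pressures. *)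
Definition solves (R : realType) (Omega : set (pt R)) (nu : pt R -> R) (nu0 : R)
    (K : pt R -> 'M[R]_3) (kappa1 kappa2 : R) (f : pt R -> 'cV[R]_3)
    (V W : set (pt R -> 'cV[R]_3)) (Q : set (pt R -> R))
    (u omega : pt R -> 'cV[R]_3) (p : pt R -> R) : Prop :=
  [/\ V u, W omega, Q p,
      forall v theta, V v -> W theta ->
        formA Omega nu nu0 K kappa1 kappa2 u omega v theta + formB Omega v p
        = formG Omega f v &
      forall q, Q q -> formB Omega u q = 0].

(** Tetrahedral meshes: a tetrahedron is given by its set of vertices. *)

Definition hull (R : realType) (T : {fset pt R}) : set (pt R) :=
  [set x | exists c : pt R -> R,
    [/\ forall a, a \in T -> 0 <= c a, \sum_(a <- T) c a = 1 &
        x = \sum_(a <- T) c a *: a]].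

Definition affine_indep (R : realType) (T : {fset pt R}) : Prop :=
  forall c : pt R -> R, \sum_(a <- T) c a = 0 -> \sum_(a <- T) c a *: a = 0 ->
    forall a, a \in T -> c a = 0.

Definition tetrahedron (R : realType) (T : {fset pt R}) : Prop :=
  #|` T| = 4%N /\ affine_indep T.

(* Two tetrahedra of a conforming partition meet exactly in the face spanned by
   their common vertices (the empty set if they have none). *)
Definition conforming_mesh (R : realType) (Omega : set (pt R))
    (M : {fset {fset pt R}}) : Prop :=
  [/\ forall T, T \in M -> tetrahedron T,
      \bigcup_(T in [set` M]) hull T = closure Omega &
      forall T T', T \in M -> T' \in M ->
        hull T `&` hull T' = hull (T `&` T')%fset].

Definition diameter (R : realType) (A : set (pt R)) : R :=
  sup [set enorm (vec (x - y)) | x in A & y in A].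

Definition ball_diameter (R : realType) (A : set (pt R)) : R :=
  sup [set 2 * r | r in [set r : R | 0 <= r /\
    exists c, [set x | enorm (vec (x - c)) <= r] `<=` A]].

Definition mesh_size (R : realType) (M : {fset {fset pt R}}) : R :=
  \big[Order.max/0]_(T <- M) diameter (hull T).

(* hs is the set of mesh sizes h occurring in the family (mesh h)_h. *)
Definition shape_regular_family (R : realType) (Omega : set (pt R))
    (hs : set R) (mesh : R -> {fset {fset pt R}}) : Prop :=
  (forall h, hs h ->
     [/\ 0 < h, conforming_mesh Omega (mesh h) & h = mesh_size (mesh h)]) /\
  exists2 c : R, 0 < c & forall h T, hs h -> T \in mesh h ->
     diameter (hull T) <= c * ball_diameter (hull T).

(** Finite element spaces *)

Definition piecewise_poly (R : realType) (M : {fset {fset pt R}}) (m : nat)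
    : set (pt R -> R) :=
  [set v | forall T, T \in M ->
    exists2 P : mpoly.mpoly 3 R, (mpoly.msize P <= m.+1)%N &
      {ae leb3, forall x, hull T x ->
         v x = mpoly.meval (fun i => vec x i 0) P}].

Definition Hh (R : realType) (Omega : set (pt R)) (M : {fset {fset pt R}})
    (k : nat) : set (pt R -> 'cV[R]_3) :=
  [set v : pt R -> 'cV[R]_3 | (forall i, H1 Omega (fun x => v x i 0)) /\
           (forall i, piecewise_poly M k.+1 (fun x => v x i 0))] `&`
  H10v Omega.

Definition Zh (R : realType) (Omega : set (pt R)) (M : {fset {fset pt R}})
    (l : nat) : set (pt R -> 'cV[R]_3) :=
  [set t | L2v Omega t /\ forall i, piecewise_poly M l (fun x => t x i 0)].

Definition Qh (R : realType) (Omega : set (pt R)) (M : {fset {fset pt R}})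
    (k : nat) : set (pt R -> R) :=
  [set q : pt R -> R | H1 Omega q /\ piecewise_poly M k q] `&` L20 Omega.

(* The supremum is taken in the extended reals, so that it is never a junk
   value; v is nonzero as an element of L2, i.e. up to null sets. *)
Definition discrete_inf_sup (R : realType) (Omega : set (pt R))
    (V : set (pt R -> 'cV[R]_3)) (Q : set (pt R -> R)) (beta : R) : Prop :=
  forall q, Q q ->
    ((beta * norm0 Omega q)%:E <=
      ereal_sup [set ((\int[leb3]_(x in Omega) (q x * wdiv Omega v x))
                      / norm1v Omega v)%:E
                | v in V `&` [set v : pt R -> 'cV[R]_3 | ~ ae_eq leb3 Omega v (cst 0%R)]])%E.

Definition best_approx (R : realType) (Omega : set (pt R))
    (V W : set (pt R -> 'cV[R]_3)) (Q : set (pt R -> R))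
    (u omega : pt R -> 'cV[R]_3) (p : pt R -> R) : R :=
  inf [set d | exists v theta q, [/\ V v, W theta, Q q &
    d = tnorm1 Omega (fun x => u x - v x)
        + norm0v Omega (fun x => omega x - theta x)
        + norm0 Omega (fun x => p x - q x)]].

(* Main.v *)
Require Import Defs.
From HB Require Import structures.
From mathcomp Require Import all_boot all_order all_algebra finmap.
From mathcomp Require Import all_classical all_reals all_analysis.
From mathcomp Require Import measurable_realfun ess_sup_inf.
From mathcomp Require Import ring lra.
From mathcomp Require mpoly.
Import (canonicals, coercions) mpoly.
Import Order.TTheory GRing.Theory Num.Theory.
Import numFieldNormedType.Exports.
Set Implicit Arguments.
Unset Strict Implicit.
Unset Printing Implicit Defensive.
Local Open Scope classical_set_scope.
Local Open Scope ring_scope.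

(** The form [A] turns out to be coercive on the whole space of pairs
    (velocity in H^1_0, vorticity in L^2), not only on the kernel of the
    divergence. The discrete problem is then a saddle-point problem with a
    coercive form and an inf-sup condition, and Brezzi's argument gives
    stability, uniqueness, existence and quasi-optimality with constants that
    depend only on the bound of [A], on its coercivity constant and on the
    inf-sup constant, hence not on the mesh.

    Coercivity. In [A(X, X)] the two terms with [nu] times vorticity times curl
    cancel. The term with the inverse permeability gives
    [nu0 * smin * U ^ 2], the others give [nu0 * W ^ 2],
    [kappa1 * nu0 * c ^ 2] and [kappa2 * d ^ 2], where [U], [W], [c], [d] are
    the L^2 norms of the velocity, the vorticity, the curl and the divergence.
    Three terms have no sign: vorticity against curl, strain times gradient of
    [nu] against velocity, and vorticity against gradient of [nu] times
    velocity. Young's inequality absorbs them ([coercive_numeric]). The strain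
    is not one of the four quantities, but its norm is at most that of the
    full gradient, and for fields vanishing on the boundary the squared norm
    of the gradient is exactly [c ^ 2 + d ^ 2] ([sqr_nrm_frob]). Absorbing the
    strain term thus costs [nu0 / 4] in both [c ^ 2] and [d ^ 2], which is what
    the lower bound on [kappa2] pays for; the range of [kappa1] and the
    smallness of the gradient of [nu] pay for the rest.

    The div-curl identity rests on the symmetry
    [int d_i f d_j g = int d_j f d_i g] for [g] in H^1_0 ([wpartial_swap]):
    test functions are dense in H^1_0 and their second derivatives commute
    ([mixed_partials]). Since the weak derivative is a chosen representative,
    every such computation needs its uniqueness almost everywhere, that is,
    the fundamental lemma of the calculus of variations
    ([fundamental_lemma]), and the fact that classical derivatives of test
    functions are weak derivatives ([test_weak_partial]). The first is proved
    with smooth bumps converging to the indicator functions of boxes, the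
    second by integrating first along the direction of the derivative.

    Inf-sup. The hypothesis bounds the pressure by the supremum of
    [int q div v / |v|_1]; as the curl and the divergence are bounded by the
    H^1 norm, it holds for the energy norm up to a factor 3
    ([inf_sup_transfer]).

    Existence. A finite element function is determined almost everywhere by
    the coefficients of its polynomials on the tetrahedra, so that the discrete
    space is spanned, up to null functions, by finitely many of its elements
    ([finite_element_span]), and a square linear system is solvable as soon as
    its transpose has a trivial kernel up to null functions
    ([saddle_solvable]).

    Error. For any discrete competitor, its difference to the discrete solution
    solves the discrete problem with a load controlled by the approximation
    error ([saddle_quasi_optimal]). *)

(** * Square-integrable functions *)

Section SquareIntegrable.
Context d (T : measurableType d) (R : realType) (mu : {measure set T -> \bar R}).
Variables (D : set T) (mD : measurable D).
Implicit Types f g F : T -> R.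

(** Real-valued counterparts of integrability, square integrability and
    the L^2 norm: all the estimates below are between real numbers. *)
Definition intg f := mu.-integrable D (EFin \o f).
Definition sqi f := measurable_fun D f /\ intg (fun x => f x ^+ 2).
Definition nrm f := Num.sqrt (\int[mu]_(x in D) f x ^+ 2).

Lemma intg_meas f : intg f -> measurable_fun D f.
Proof. by move=> /integrableP[/measurable_EFinP]. Qed.

Lemma intg_le f g : measurable_fun D f -> intg g ->
  {ae mu, forall x, D x -> `|f x| <= g x} -> intg f.
Proof.
move=> mf /integrableP[mg ig] fg; apply/integrableP; split.
  exact/measurable_EFinP.
apply: le_lt_trans ig.
apply: ae_ge0_le_integral => //.
- by apply: measurableT_comp => //; exact/measurable_EFinP.
- by apply: measurableT_comp.
- move: fg; apply: filterS => x /[apply] fg /=; rewrite lee_fin.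
  by rewrite (le_trans fg) ?ler_norm.
Qed.

Lemma intgD f g : intg f -> intg g -> intg (fun x => f x + g x).
Proof. by move=> hf hg; exact: (integrableD mD hf hg). Qed.

Lemma intgZ (k : R) f : intg f -> intg (fun x => k * f x).
Proof. by move=> hf; exact: (integrableZl mD k hf). Qed.

Lemma Rint_ae f g : measurable_fun D f -> measurable_fun D g ->
  ae_eq mu D f g -> \int[mu]_(x in D) f x = \int[mu]_(x in D) g x.
Proof.
move=> mf mg fg; rewrite /Rintegral; congr fine; apply: ae_eq_integral => //.
- exact/measurable_EFinP.
- exact/measurable_EFinP.
- by move: fg; apply: filterS => x /[apply] ->.
Qed.

Lemma Rint_ge0 f : measurable_fun D f ->
  {ae mu, forall x, D x -> 0 <= f x} -> 0 <= \int[mu]_(x in D) f x.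
Proof.
move=> mf f0; rewrite (@Rint_ae _ (fun x => `|f x|)) //.
- exact: Rintegral_ge0.
- exact: measurableT_comp.
- by move: f0; apply: filterS => x /[apply] f0; rewrite ger0_norm.
Qed.

Lemma Rint_le f g : intg f -> intg g ->
  {ae mu, forall x, D x -> f x <= g x} ->
  \int[mu]_(x in D) f x <= \int[mu]_(x in D) g x.
Proof.
move=> If Ig fg; rewrite -subr_ge0 -RintegralB//; apply: Rint_ge0.
  by apply: measurable_funB; exact: intg_meas.
by move: fg; apply: filterS => x /[apply]; rewrite subr_ge0.
Qed.

(** The domination gives the integrability of the integrand. *)
Lemma norm_Rint_le f g : measurable_fun D f -> intg g ->
  {ae mu, forall x, D x -> `|f x| <= g x} ->
  `|\int[mu]_(x in D) f x| <= \int[mu]_(x in D) g x.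
Proof.
move=> mf Ig fg; have If := intg_le mf Ig fg.
apply: le_trans (le_normr_Rintegral mD If) _; apply: Rint_le => //.
exact: integrable_norm.
Qed.

Lemma sqi_mul f g : sqi f -> sqi g -> intg (fun x => f x * g x).
Proof.
move=> [mf f2] [mg g2].
apply: (@intg_le _ (fun x => f x ^+ 2 + g x ^+ 2)).
- exact: measurable_funM.
- exact: intgD.
- apply: aeW => x _; rewrite ler_norml; apply/andP; split.
    by have := sqr_ge0 (f x + g x); nra.
  by have := sqr_ge0 (f x - g x); nra.
Qed.

Lemma sqiD f g : sqi f -> sqi g -> sqi (fun x => f x + g x).
Proof.
move=> hf hg; split.
  by apply: measurable_funD; [case: hf|case: hg].
have -> : (fun x => (f x + g x) ^+ 2) =
  (fun x => (f x ^+ 2 + g x ^+ 2) + 2 * (f x * g x)).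
  by apply/funext => x; ring.
apply: intgD; first by apply: intgD; [case: hf|case: hg].
by apply: intgZ; exact: sqi_mul.
Qed.

Lemma sqiZ (k : R) f : sqi f -> sqi (fun x => k * f x).
Proof.
move=> [mf f2]; split; first exact: measurable_funM.
have -> : (fun x => (k * f x) ^+ 2) = (fun x => k ^+ 2 * (f x ^+ 2)).
  by apply/funext => x; rewrite exprMn.
exact: intgZ.
Qed.

Lemma sqi0 : sqi (fun=> 0).
Proof.
split; first exact: measurable_cst.
rewrite /intg; have -> : EFin \o (fun=> (0 : R) ^+ 2) = cst (0 : \bar R) :> (T -> _).
  by apply/funext => x /=; rewrite expr0n.
exact: integrable0.
Qed.

Lemma sqi_le f g (C : R) : measurable_fun D f -> sqi g ->
  {ae mu, forall x, D x -> `|f x| <= C * `|g x|} -> sqi f.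
Proof.
move=> mf [mg g2] fg; split=> //.
apply: (@intg_le _ (fun x => C ^+ 2 * g x ^+ 2)); last 1 first.
- move: fg; apply: filterS => x /[apply] fg.
  rewrite ger0_norm ?sqr_ge0// -exprMn -(real_normK (num_real (f x))).
  rewrite -[leRHS](real_normK (num_real _)) normrM.
  apply: lerXn2r; rewrite ?nnegrE ?mulr_ge0//.
  by apply: le_trans fg _; rewrite ler_wpM2r// ler_norm.
- by apply: measurable_funX.
- exact: intgZ.
Qed.

Lemma sqi_ae f g : measurable_fun D g -> sqi f -> ae_eq mu D f g -> sqi g.
Proof.
move=> mg hf fg; apply: (@sqi_le _ f 1) => //.
by move: fg; apply: filterS => x /[apply] ->; rewrite mul1r.
Qed.

Lemma nrm_ge0 f : 0 <= nrm f. Proof. exact: sqrtr_ge0. Qed.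
Hint Resolve nrm_ge0 : core.

Lemma sqr_nrm f : nrm f ^+ 2 = \int[mu]_(x in D) f x ^+ 2.
Proof. by rewrite sqr_sqrtr//; apply: Rintegral_ge0 => x _; exact: sqr_ge0. Qed.

Lemma nrm_ae f g : measurable_fun D f -> measurable_fun D g ->
  ae_eq mu D f g -> nrm f = nrm g.
Proof.
move=> mf mg fg; rewrite /nrm; congr Num.sqrt; apply: Rint_ae.
- exact: measurable_funX.
- exact: measurable_funX.
- by move: fg; apply: filterS => x /[apply] ->.
Qed.

Lemma nrm_le f g : measurable_fun D f -> sqi g ->
  {ae mu, forall x, D x -> `|f x| <= g x} -> nrm f <= nrm g.
Proof.
move=> mf [mg g2] fg.
have f2 : sqi f.
  apply: (@sqi_le _ g 1) => //.
  by move: fg; apply: filterS => x /[apply] h; rewrite mul1r (le_trans h)// ler_norm.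
rewrite /nrm ler_sqrt ?Rint_ge0//; last 2 first.
- exact: measurable_funX.
- by apply: aeW => x _; exact: sqr_ge0.
apply: Rint_le => //; first by case: f2.
move: fg; apply: filterS => x /[apply] h.
by rewrite -(real_normK (num_real (f x))) lerXn2r// nnegrE// (le_trans _ h).
Qed.

(** Turns estimates into uniqueness almost everywhere. *)
Lemma nrm_eq0 f : sqi f -> nrm f = 0 -> ae_eq mu D f (cst 0).
Proof.
move=> [mf f2] f0.
have : ae_eq mu D (fun x => (f x ^+ 2)%:E) (cst 0%:E).
  apply/ae_eq_integral_abs => //.
    by apply/measurable_EFinP; exact: measurable_funX.
  have fi := integrable_fin_num mD f2.
  have e : fine (\int[mu]_(x in D) (f x ^+ 2)%:E) = 0.
    by rewrite -[LHS]/(\int[mu]_(x in D) f x ^+ 2) -sqr_nrm f0 expr0n.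
  transitivity (fine (\int[mu]_(x in D) (f x ^+ 2)%:E))%:E; last by rewrite e.
  rewrite fineK//.
  by apply: eq_integral => x _; rewrite gee0_abs// lee_fin sqr_ge0.
apply: filterS => x /[apply] /= -[] /eqP; rewrite sqrf_eq0 => /eqP //.
Qed.

Lemma nrm0 : nrm (fun=> 0) = 0.
Proof.
rewrite /nrm (_ : Rintegral _ _ _ = 0) ?sqrtr0//.
rewrite (_ : (fun=> 0 ^+ 2) = cst 0 :> (T -> R)); last by apply/funext => x; rewrite expr0n.
by rewrite Rintegral_cst// mul0r.
Qed.

(** The polynomial [t |-> \int (f - t g)^2] is nonnegative; evaluate it at
    its minimum, or far away when [g] has zero norm. *)
Lemma cauchy_schwarz f g : sqi f -> sqi g ->
  `|\int[mu]_(x in D) (f x * g x)| <= nrm f * nrm g.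
Proof.
move=> hf hg.
set p := \int[mu]_(x in D) _.
have key (t : R) : 0 <= nrm f ^+ 2 - 2 * t * p + t ^+ 2 * nrm g ^+ 2.
  have : 0 <= \int[mu]_(x in D) ((f x + - t * g x) ^+ 2).
    by apply: Rintegral_ge0 => x _; exact: sqr_ge0.
  have -> : (fun x => (f x + - t * g x) ^+ 2) =
    (fun x => (f x ^+ 2 + (- 2 * t) * (f x * g x)) + t ^+ 2 * g x ^+ 2).
    by apply/funext => x; ring.
  have I1 : intg (fun x => - 2 * t * (f x * g x)).
    by apply: intgZ; apply: sqi_mul.
  have I2 : intg (fun x => t ^+ 2 * g x ^+ 2) by apply: intgZ; case: hg.
  have I3 := sqi_mul hf hg.
  rewrite RintegralD//; last by apply: intgD => //; case: hf.
  rewrite RintegralD//; last by case: hf.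
  rewrite !RintegralZl//; last by case: hg.
  by rewrite -/p -!sqr_nrm => h; lra.
have [g0|g0] := eqVneq (nrm g) 0.
  rewrite g0 mulr0.
  have [->|p0] := eqVneq p 0; first by rewrite normr0.
  (* Here the polynomial is affine, and negative at this point. *)
  have := key ((nrm f ^+ 2 + 1) / p).
  rewrite g0 expr0n /= mulr0 addr0 -mulrA divfK//.
  by have := sqr_ge0 (nrm f); nra.
have g1 : 0 < nrm g by rewrite lt_def g0 nrm_ge0.
have := key (p / nrm g ^+ 2).
have -> : nrm f ^+ 2 - 2 * (p / nrm g ^+ 2) * p + (p / nrm g ^+ 2) ^+ 2 * nrm g ^+ 2
  = (nrm f ^+ 2 * nrm g ^+ 2 - p ^+ 2) / nrm g ^+ 2 by field.
rewrite pmulr_lge0 ?invr_gt0 ?exprn_gt0// subr_ge0 -exprMn => h.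
rewrite -(@ler_pXn2r _ 2)// ?nnegrE//; last by rewrite mulr_ge0.
by rewrite real_normK ?num_real.
Qed.

Lemma nrmD f g : sqi f -> sqi g -> nrm (fun x => f x + g x) <= nrm f + nrm g.
Proof.
move=> hf hg.
rewrite -(@ler_pXn2r _ 2)// ?nnegrE// ?addr_ge0//.
rewrite sqr_nrm.
have -> : (fun x => (f x + g x) ^+ 2) =
  (fun x => (f x ^+ 2 + g x ^+ 2) + 2 * (f x * g x)).
  by apply/funext => x; ring.
have I3 := sqi_mul hf hg.
rewrite RintegralD//; last 2 first.
  by apply: intgD; [case: hf|case: hg].
  exact: intgZ.
rewrite RintegralD//; [|by case: hf|by case: hg].
rewrite RintegralZl// -!sqr_nrm.
have := cauchy_schwarz hf hg; rewrite ler_norml => /andP[_]; nra.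
Qed.

Lemma nrmZ (k : R) f : sqi f -> nrm (fun x => k * f x) = `|k| * nrm f.
Proof.
move=> [mf f2]; rewrite /nrm.
have -> : (fun x => (k * f x) ^+ 2) = (fun x => k ^+ 2 * (f x ^+ 2)).
  by apply/funext => x; rewrite exprMn.
by rewrite RintegralZl// sqrtrM ?sqr_ge0// sqrtr_sqr.
Qed.

(** Every integral in the bilinear forms below is estimated this way: a
    pointwise bound of the integrand, then Cauchy-Schwarz. *)
Lemma int_dominated F f g (C : R) : measurable_fun D F -> sqi f -> sqi g ->
  {ae mu, forall x, D x -> `|F x| <= C * (f x * g x)} ->
  intg F /\ `|\int[mu]_(x in D) F x| <= `|C| * (nrm f * nrm g).
Proof.
move=> mF hf hg Fle.
have I3 := sqi_mul hf hg.
split; first by apply: (intg_le mF) Fle; apply: intgZ.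
apply: le_trans (norm_Rint_le mF (intgZ C I3) Fle) _.
rewrite RintegralZl//; apply: le_trans (ler_norm _) _.
by rewrite normrM ler_wpM2l//; exact: cauchy_schwarz.
Qed.

End SquareIntegrable.

(** The same space as [pt R], written so that its product sigma-algebra is
    inferred. *)
Notation mpt R :=
  (measurableTypeR R * measurableTypeR R * measurableTypeR R)%type.

Section Boxes.
Variable R : realType.

Implicit Types (x y : pt R) (a b : 'I_3 -> R).

Definition co x (i : 'I_3) : R := vec x i 0.
Definition box a b : set (pt R) := [set x | forall i, a i < co x i < b i].
Definition cbox a b : set (pt R) := [set x | forall i, a i <= co x i <= b i].

Lemma forall3 (P : 'I_3 -> Prop) :
  (forall i, P i) <-> [/\ P 0, P 1 & P 2%:R].
Proof.
split=> [h//|[P0 P1 P2] i].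
have : [|| i == 0, i == 1 | i == 2%:R] by case: i => -[|[|[|]]].
by move=> /or3P[] /eqP ->.
Qed.

Lemma co0 x : co x 0 = x.1.1. Proof. by rewrite /co mxE. Qed.
Lemma co1 x : co x 1 = x.1.2. Proof. by rewrite /co mxE. Qed.
Lemma co2 x : co x 2%:R = x.2. Proof. by rewrite /co mxE. Qed.
Definition coE := (co0, co1, co2).

Lemma co_inj x y : (forall i, co x i = co y i) -> x = y.
Proof.
case: x y => [[x0 x1] x2] [[y0 y1] y2] /forall3.
by rewrite !coE /= => -[-> -> ->].
Qed.

Lemma coD x y i : co (x + y) i = co x i + co y i.
Proof. by move: i; apply/forall3; rewrite !coE. Qed.

Lemma coZ (k : R) x i : co (k *: x) i = k * co x i.
Proof. by move: i; apply/forall3; rewrite !coE. Qed.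

Lemma co_basis i j : co (basis_pt R j) i = (i == j)%:R.
Proof. by move: i; apply/forall3; rewrite !coE /= ![_ == j]eq_sym. Qed.

Lemma ball_co x (e : R) y : ball x e y <-> forall i, `|co x i - co y i| < e.
Proof.
rewrite forall3 !coE; split; first by case=> -[].
by case=> h0 h1 h2; split => //; split.
Qed.

Lemma co_cont i : continuous (co ^~ i).
Proof.
move: i; apply/forall3; split.
- have -> : co ^~ 0 = (fst \o fst) by apply/funext => x; rewrite coE.
  move=> x; apply: continuous_comp; exact: cvg_fst.
- have -> : co ^~ 1 = (snd \o fst) by apply/funext => x; rewrite coE.
  move=> x; apply: continuous_comp; [exact: cvg_fst|exact: cvg_snd].
- have -> : co ^~ 2%:R = snd by apply/funext => x; rewrite coE.
  move=> x; exact: cvg_snd.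
Qed.

Lemma boxE a b : box a b =
  (`]a 0, b 0[ `*` `]a 1, b 1[) `*` `]a 2%:R, b 2%:R[.
Proof.
apply/seteqP; split=> x; rewrite /box /= !in_itv /=.
  by move=> /forall3; rewrite !coE => -[].
by move=> [[? ?] ?]; apply/forall3; rewrite !coE.
Qed.

Lemma cboxE a b : cbox a b =
  (`[a 0, b 0] `*` `[a 1, b 1]) `*` `[a 2%:R, b 2%:R].
Proof.
apply/seteqP; split=> x; rewrite /cbox /= !in_itv /=.
  by move=> /forall3; rewrite !coE => -[].
by move=> [[? ?] ?]; apply/forall3; rewrite !coE.
Qed.

Lemma meas_box a b : measurable (box a b : set (mpt R)).
Proof.
rewrite boxE; apply: measurableX; last exact: measurable_itv.
by apply: measurableX; exact: measurable_itv.
Qed.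

Lemma meas_cbox a b : measurable (cbox a b : set (mpt R)).
Proof.
rewrite cboxE; apply: measurableX; last exact: measurable_itv.
by apply: measurableX; exact: measurable_itv.
Qed.

Lemma cbox_compact a b : compact (cbox a b).
Proof.
rewrite cboxE; apply: compact_setX; last exact: segment_compact.
by apply: compact_setX; exact: segment_compact.
Qed.

Lemma cbox_fin a b : (leb3 (cbox a b : set (mpt R)) < +oo)%E.
Proof.
have fin1 (s t : R) : (leb1 R (`[s, t]%classic : set (measurableTypeR R)) < +oo)%E.
  by rewrite /leb1 /= lebesgue_measure_itv /=; case: ifPn => // _; rewrite -EFinB ltry.
rewrite cboxE.
have mI i : measurable (`[a i, b i]%classic : set (measurableTypeR R)).
  exact: measurable_itv.
have m2 := measurableX (mI 0) (mI 1).
rewrite (_ : leb3 _ = leb2 R (`[a 0%R, b 0%R] `*` `[a 1%R, b 1%R])%classic *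
  leb1 R (`[a 2%:R%R, b 2%:R%R]%classic))%E; last exact: product_measure1E.
rewrite (_ : leb2 R _ = leb1 R (`[a 0%R, b 0%R]%classic) *
  leb1 R (`[a 1%R, b 1%R]%classic))%E; last exact: product_measure1E.
have h i := fin1 (a i) (b i).
rewrite lte_mul_pinfty ?mule_ge0 ?ge0_fin_numE ?mule_ge0//.
by rewrite lte_mul_pinfty ?ge0_fin_numE.
Qed.

Lemma box_sub_cbox a b : box a b `<=` cbox a b.
Proof. by move=> x h i; have /andP[/ltW -> /ltW ->] := h i. Qed.

(** Boxes with rational corners: countably many of them suffice to exhaust
    an open set, which gives measurability of open sets and, later, lets a
    property that holds almost everywhere on each box hold almost
    everywhere on the open set. *)
Definition rbox (q : {ffun 'I_3 -> rat} * {ffun 'I_3 -> rat}) : set (pt R) :=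
  box (fun i => ratr (q.1 i)) (fun i => ratr (q.2 i)).
Definition crbox (q : {ffun 'I_3 -> rat} * {ffun 'I_3 -> rat}) : set (pt R) :=
  cbox (fun i => ratr (q.1 i)) (fun i => ratr (q.2 i)).

Lemma open_rbox (U : set (pt R)) x : open U -> U x ->
  exists q, rbox q x /\ crbox q `<=` U.
Proof.
rewrite openE => /[apply] /nbhs_ballP[e /= e0 eU].
have h i : exists p : rat * rat, [/\ co x i - e < ratr p.1, ratr p.1 < co x i,
   co x i < ratr p.2 & ratr p.2 < co x i + e].
  have [|p] := @rat_in_itvoo R (co x i - e) (co x i); first by rewrite ltrBlDr ltrDl.
  have [|p'] := @rat_in_itvoo R (co x i) (co x i + e); first by rewrite ltrDl.
  rewrite !in_itv /= => /andP[? ?] /andP[? ?].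
  by exists (p, p').
have [p hp] := choice h.
exists ([ffun i => (p i).1], [ffun i => (p i).2]); split.
  by move=> i /=; rewrite !ffunE; have [_ -> -> _] := hp i.
move=> y hy; apply: eU; apply/ball_co => i.
have := hy i; rewrite /= !ffunE; have [h1 h2 h3 h4] := hp i.
move=> /andP[h5 h6]; rewrite ltr_norml; lra.
Qed.

Lemma open_bigcup_rbox (U : set (pt R)) : open U ->
  U = \bigcup_(q in [set q | crbox q `<=` U]) rbox q.
Proof.
move=> oU; apply/seteqP; split=> x.
  by move=> Ux; have [q [qx qU]] := open_rbox oU Ux; exists q.
by move=> [q /= qU qx]; apply: qU; exact: box_sub_cbox.
Qed.

Lemma meas_open (U : set (pt R)) : open U -> measurable (U : set (mpt R)).
Proof.
move=> /open_bigcup_rbox ->.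
rewrite bigcup_mkcond; apply: countable_bigcupT_measurable.
  exact: countableP.
by move=> q; case: ifPn => _ //; exact: meas_box.
Qed.

Lemma meas_closed (A : set (pt R)) : closed A -> measurable (A : set (mpt R)).
Proof.
move=> /closed_openC oA; rewrite -[A]setCK.
by apply: measurableC; exact: meas_open.
Qed.

Lemma meas_compact (A : set (pt R)) : compact A -> measurable (A : set (mpt R)).
Proof.
by move=> cA; apply: meas_closed; apply: compact_closed => //; exact: norm_hausdorff.
Qed.

Lemma bounded_sub_cbox (A : set (pt R)) : bounded_set A ->
  exists M : R, 0 < M /\ A `<=` box (fun=> - M) (fun=> M).
Proof.
move=> [M [_ AM]]; exists (`|M| + 2); split; first by rewrite ltr_wpDl.
move=> x Ax i.
have xM : `|x| <= `|M| + 1 by apply: AM Ax; rewrite ltr_pwDr// ler_norm.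
have : ball 0 (`|M| + 2) x.
  rewrite -ball_normE /ball_ /= sub0r normrN.
  by apply: le_lt_trans xM _; rewrite ltrD2l ltr1n.
move=> /ball_co /(_ i); have -> : co 0 i = 0 by move: i; apply/forall3; rewrite !coE.
by rewrite sub0r normrN ltr_norml.
Qed.

Lemma bounded_fin (A : set (pt R)) : measurable (A : set (mpt R)) ->
  bounded_set A -> (leb3 (A : set (mpt R)) < +oo)%E.
Proof.
move=> mA /bounded_sub_cbox[M [_ AM]].
apply: le_lt_trans (cbox_fin (fun=> - M) (fun=> M)).
apply: le_measure; rewrite ?inE//; first exact: meas_cbox.
by apply: subset_trans AM _; exact: box_sub_cbox.
Qed.

Lemma cont_meas (A : set (pt R)) (f : pt R -> R) :
  measurable (A : set (mpt R)) -> continuous f ->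
  measurable_fun (A : set (mpt R)) f.
Proof.
move=> mA cf.
have : measurable_fun (setT : set (mpt R)) (f : mpt R -> measurableTypeR R).
  apply: (@measurability _ _ _ (measurableTypeR R) _ _ (@RGenOpens.G R)); first exact: RGenOpens.measurableE.
  move=> _ [_ [s [t ->]] <-]; rewrite setTI; apply: meas_open.
  by apply: open_comp => [x _|]; [exact: cf|exact: interval_open].
exact: measurable_funTS.
Qed.

(** The open boxes form a pi-system generating the Borel sets. *)
Definition boxes : set (set (pt R)) := [set A | exists a b, A = box a b].

Lemma setI_box a b a' b' : box a b `&` box a' b' =
  box (fun i => Num.max (a i) (a' i)) (fun i => Num.min (b i) (b' i)).
Proof.
apply/seteqP; split => x; rewrite /box /=.
  move=> [h h'] i; rewrite gt_max lt_min.
  by have /andP[-> ->] := h i; have /andP[-> ->] := h' i.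
move=> h; split=> i; have := h i; rewrite gt_max lt_min;
by move=> /andP[/andP[? ?] /andP[? ?]]; apply/andP.
Qed.

Lemma setI_closed_boxes : setI_closed boxes.
Proof.
by move=> _ _ [a [b ->]] [a' [b' ->]]; rewrite setI_box; eexists; eexists.
Qed.

(** The coordinates are measurable for the sigma-algebra generated by the
    boxes, because the preimage of an interval is a countable union of
    boxes. *)
Lemma boxes_generate (A : set (mpt R)) : measurable A -> <<s boxes >> A.
Proof.
pose T' := g_sigma_algebraType boxes.
have mco (i : 'I_3) : measurable_fun (setT : set T') (fun x : T' => (co x i : measurableTypeR R)).
  apply: (@measurability _ _ _ (measurableTypeR R) _ _ (@RGenOpens.G R)); first exact: RGenOpens.measurableE.
  move=> _ [_ [s [t ->]] <-]; rewrite setTI.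
  have -> : (fun x : T' => co x i) @^-1` `]s, t[ =
    \bigcup_n box (fun j => if j == i then s else - n%:R)
                  (fun j => if j == i then t else n%:R).
    apply/seteqP; split => x /=; rewrite in_itv /=; last first.
      by move=> [n _ /(_ i)]; rewrite eqxx.
    move=> h; have [n hn] : exists n : nat, forall j, `|co x j| < n%:R.
      exists (\max_j Num.bound `|co x j|)%N => j.
      apply: lt_le_trans (archi_boundP (normr_ge0 _)) _.
      by rewrite ler_nat (leq_bigmax j).
    exists n => // j; case: eqP => [->//|_].
    by rewrite -ltr_norml.
  apply: (@bigcupT_measurable _ T') => n.
  by apply: sub_sigma_algebra; eexists; eexists.
have mid : measurable_fun (setT : set T') (fun x : T' => (x : mpt R)).
  have -> : (fun x : T' => (x : mpt R)) = (fun x : T' => ((co x 0, co x 1), co x 2%:R)).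
    by apply/funext => -[[x0 x1] x2]; rewrite !coE.
  by apply: measurable_fun_pair => //; apply: measurable_fun_pair.
move=> mA; have := mid measurableT A mA.
by rewrite setTI.
Qed.

(** Together with stability of boxes under intersection, this reduces the
    vanishing of integrals over all Borel sets to the vanishing over
    boxes. *)
Lemma dynkin_int0 (B : set (pt R)) (h : pt R -> R) :
  measurable (B : set (mpt R)) -> intg leb3 B h ->
  (\int[leb3]_(x in B) h x = 0)%R ->
  dynkin [set A | measurable (A : set (mpt R)) /\
     (\int[leb3]_(x in (A `&` B : set (mpt R))) (h x)%:E = 0)%E].
Proof.
move=> mB Ih h0.
have IB0 : (\int[leb3]_(x in (B : set (mpt R))) (h x)%:E = 0)%E.
  rewrite -[LHS]fineK; last exact: (integrable_fin_num mB Ih).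
  by rewrite -[fine _]/(\int[leb3]_(x in B) h x) h0.
split.
- by split; rewrite ?setTI//; exact: measurableT.
- move=> A [mA A0]; split; first exact: measurableC.
  have : (\int[leb3]_(x in ((A `&` B) `|` (~` A `&` B) : set (mpt R))) (h x)%:E = 0)%E.
    by rewrite -setIUl setUv setTI.
  rewrite integral_setU_EFin ?A0 ?add0e//.
  + by apply: measurableI => //.
  + by apply: measurableI => //; exact: measurableC.
  + rewrite -setIUl setUv setTI; exact: intg_meas Ih.
  + apply/disj_setPS => x [[? _] [? _]] //.
- move=> F tF mF; split; first by apply: bigcupT_measurable => n; case: (mF n).
  rewrite setI_bigcupl integral_bigcup //.
  + by rewrite eseries0// => n _ _; case: (mF n).
  + exact: trivIset_setIr.
  + by move=> n; apply: measurableI => //; case: (mF n).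
  + apply: (@integrableS _ _ _ leb3 B) Ih => //.
      by apply: bigcupT_measurable => n;  apply: measurableI => //; case: (mF n).
    by move=> x [n _ []].
Qed.

(** By the pi-lambda theorem the integral vanishes on every Borel set, in
    particular where the function is positive and where it is negative. *)
Lemma int_boxes_eq0 a b (h : pt R -> R) : intg leb3 (box a b) h ->
  (forall a' b', (forall i, a i <= a' i) -> (forall i, b' i <= b i) ->
    \int[leb3]_(x in box a' b') h x = 0) ->
  ae_eq leb3 (box a b) h (cst 0).
Proof.
move=> Ih h0; set B := box a b; have mB : measurable (B : set (mpt R)) := meas_box a b.
have all0 (A : set (mpt R)) : measurable A ->
    (\int[leb3]_(x in A `&` B) (h x)%:E = 0)%E.
  move=> mA; suff [] : measurable A /\ (\int[leb3]_(x in A `&` B) (h x)%:E = 0)%E by [].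
  move: A mA; apply: subset_trans boxes_generate _.
  rewrite -setI_closed_g_dynkin_g_sigma_algebra; last exact: setI_closed_boxes.
  apply: smallest_sub; first by apply: dynkin_int0 => //; apply: h0.
  move=> _ [a' [b' ->]]; split; first exact: meas_box.
  have cdB : box a' b' `&` B `<=` B by exact: subIsetr.
  rewrite /B setI_box in cdB *; set c := fun i => _; set d := fun i => _.
  rewrite -[LHS]fineK; last first.
    apply: (integrable_fin_num (meas_box c d)).
    by apply: (@integrableS _ _ _ leb3 B) Ih => //; exact: meas_box.
  by rewrite -[fine _]/(\int[leb3]_(x in box c d) h x) h0 // => i;
    rewrite /c /d ?le_max ?ge_min lexx orbT.
have mh : measurable_fun (B : set (mpt R)) h := intg_meas Ih.
suff : ae_eq leb3 B (fun x => (h x)%:E) (cst 0%:E).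
  by apply: filterS => x /[apply] -[].
apply/ae_eq_integral_abs => //; first exact/measurable_EFinP.
have mP : measurable (B `&` h @^-1` `[0, +oo[ : set (mpt R)).
  by apply: mh => //; exact: measurable_itv.
have mN : measurable (B `&` h @^-1` `]-oo, 0[ : set (mpt R)).
  by apply: mh => //; exact: measurable_itv.
have BE : B = (B `&` h @^-1` `[0, +oo[) `|` (B `&` h @^-1` `]-oo, 0[).
  rewrite -setIUr; apply/seteqP; split => x; last by case.
  move=> Bx; split => //=; rewrite !in_itv /= andbT.
  by case: (lerP 0 (h x)) => ?; [left|right].
rewrite {1}BE ge0_integral_setU//=.
- rewrite (_ : integral _ _ _ = \int[leb3]_(x in (B `&` h @^-1` `[0%R, +oo[) `&` B) (h x)%:E)%E; last first.
    rewrite -setIA (setIC _ B) setIA setIid; apply: eq_integral => x.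
    rewrite inE /= in_itv /= andbT => -[_ h1].
    by rewrite ger0_norm.
  rewrite all0// add0e.
  rewrite (_ : integral _ _ _ =
    \int[leb3]_(x in (B `&` h @^-1` `]-oo, 0%R[) `&` B) ((-1)%:E * (h x)%:E))%E; last first.
    rewrite -setIA (setIC _ B) setIA setIid; apply: eq_integral => x.
    rewrite inE /= in_itv /= => -[_ h1].
    by rewrite ltr0_norm// -EFinM mulN1r.
  rewrite integralZl ?all0 ?mule0//; first exact: measurableI.
  by apply: (@integrableS _ _ _ leb3 B) Ih => //; exact: measurableI.
- by rewrite -BE; do 2 apply: measurableT_comp => //.
- apply/disj_setPS => x [[_ h1] [_ h2]]; move: h1 h2.
  by rewrite /= !in_itv /= andbT => h1 h2; move: (lt_le_trans h2 h1); rewrite ltxx.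
Qed.
End Boxes.

(** * Smooth bumps filling a box *)

Section BumpFunctions.
Variable R : realType.

(** Makes [p(1/t) exp(-1/t)] tend to zero at the origin, faster than any
    power of [t]. *)
Lemma poly_le_expR (p : {poly R}) :
  exists2 C : R, 0 <= C & forall s, 0 <= s -> `|p.[s]| <= C * expR s.
Proof.
exists (\sum_(i < size p) `|p`_i| * i`!%:R).
  by apply: sumr_ge0 => i _; rewrite mulr_ge0.
move=> s s0; rewrite horner_coef mulr_suml.
apply: le_trans (ler_norm_sum _ _ _) _; apply: ler_sum => i _.
rewrite normrM -mulrA ler_wpM2l// normrX ger0_norm//.
case: (i : nat) => [|n]; first by rewrite expr0 fact0 mul1r -{1}expR0 ler_expR.
rewrite mulrC -ler_pdivrMr ?ltr0n ?fact_gt0//.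
by apply: le_trans (expR_ge1Dxn n s0); rewrite lerDr.
Qed.

(** The functions [p(1/t) exp(-1/t)] extended by zero to [t <= 0]. Keeping
    an arbitrary polynomial factor makes the family stable under
    derivation. *)
Definition flat (p : {poly R}) (t : R) : R :=
  if 0 < t then p.[t^-1] * expR (- t^-1) else 0.

Lemma flat_le (p : {poly R}) :
  exists2 C : R, 0 <= C & forall t, `|flat p t| <= C * `|t|.
Proof.
have [C C0 pC] := poly_le_expR ('X * p); exists C => // t.
rewrite /flat; case: ltrP => t0; last by rewrite normr0 mulr_ge0.
rewrite (gtr0_norm t0) normrM (ger0_norm (expR_ge0 _)) expRN.
have ti : 0 <= t^-1 by rewrite invr_ge0 ltW.
have := pC _ ti; rewrite hornerM hornerX normrM (ger0_norm ti).
move=> h; rewrite ler_pdivrMr ?expR_gt0//.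
have : t * (t^-1 * `|p.[t^-1]|) <= t * (C * expR t^-1) by rewrite ler_wpM2l// ltW.
rewrite mulVKf ?gt_eqF// => /le_trans; apply.
by rewrite mulrCA mulrA.
Qed.

(** Away from the origin this is calculus; at the origin the difference
    quotient is again a flat function, of polynomial ['X * p], and is thus
    at most linear. *)
Lemma flat_deriv (p : {poly R}) (t : R) :
  is_derive t 1 (flat p) (flat ('X^2 * (p - p^`())) t).
Proof.
have [t0|t0|->] := ltgtP t 0.
- have -> : flat ('X^2 * (p - p^`())) t = 0 by rewrite /flat ltNge ltW.
  apply: (@near_eq_is_derive _ _ _ (cst 0)).
  near=> s; rewrite /flat ltNge ltW//; near: s; exact: lt_nbhsl.
- pose f1 : R -> R := fun t => p.[t^-1] * expR (- t^-1).
  apply: (@near_eq_is_derive _ _ _ f1).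
    near=> s; rewrite /f1 /flat ifT//; near: s; exact: lt_nbhsr.
  have t1 : t != 0 by rewrite gt_eqF.
  have dV : is_derive t 1 (fun t : R => t^-1) (- t ^- 2 *: 1).
    exact: (@is_deriveV _ id).
  have dp : is_derive t 1 (horner p \o (fun t : R => t^-1)) (p^`().[t^-1] * (- t ^- 2 *: 1)).
    exact: is_derive1_comp.
  have dN : is_derive t 1 (fun t : R => - t^-1) (- (- t ^- 2 *: 1)).
    exact: is_deriveN.
  have de : is_derive t 1 (expR \o (fun t : R => - t^-1)) (expR (- t^-1) * (- (- t ^- 2 *: 1))).
    exact: is_derive1_comp.
  have dd : is_derive t 1 f1 _ := is_deriveM dp de.
  apply: is_derive_eq dd _.
  rewrite /flat t0 !hornerE /= !scaler1 /GRing.scale /= !exprVn.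
  by ring.
- have -> : flat ('X^2 * (p - p^`())) 0 = 0 by rewrite /flat ltxx.
  have f0 : flat p 0 = 0 by rewrite /flat ltxx.
  have [C C0 pC] := flat_le ('X * p).
  suff h : h^-1 *: (flat p (h *: 1 + 0) - flat p 0) @[h --> 0^'] --> (0 : R).
    split; first by apply/cvg_ex; exists 0.
    exact: cvg_lim.
  apply/cvgr0Pnorm_le => e e0.
  near=> h.
  have h0 : h != 0 by near: h; exact: nbhs_dnbhs_neq.
  rewrite addr0 f0 subr0 /GRing.scale /= mulr1.
  have -> : h^-1 * flat p h = flat ('X * p) h.
    by rewrite /flat; case: ltrP; rewrite ?mulr0// hornerM hornerX mulrA.
  apply: le_trans (pC h) _.
  apply: (@le_trans _ _ ((C + 1) * `|h|)); first by rewrite ler_wpM2r// lerDl.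
  rewrite mulrC -ler_pdivlMr ?ltr_wpDl//.
  near: h; apply: dnbhs0_le; by rewrite divr_gt0// ltr_wpDl.
Unshelve. all: by end_near. Qed.

(** A partial derivative is the derivative at 0 of the restriction to a
    line, which gives access to one-variable calculus. *)
Lemma is_derive_line (f : pt R -> R) (x v : pt R) (l : R) :
  is_derive x v f l <-> is_derive (0 : R) 1 (fun t : R => f (t *: v + x)) l.
Proof.
have E : (fun h : R => h^-1 *: ((f \o shift x) (h *: v) - f x)) =
  (fun h : R => h^-1 *: (((fun t : R => f (t *: v + x)) \o shift 0) (h *: 1)
                   - (f (0 *: v + x)))).
  apply/funext => h /=.
  by rewrite scale0r add0r addr0 /GRing.scale /= mulr1.
by split=> -[d1 d2]; split; rewrite /derivable /derive ?E// -?E//;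
   move: d2; rewrite /derive ?E// -?E.
Qed.

Lemma cont_deriv (f g : R -> R) : (forall t : R, is_derive t 1 f (g t)) -> continuous f.
Proof.
move=> h t; apply: differentiable_continuous; apply/derivable1_diffP.
by have [] := h t.
Qed.

(** Smoothness asks for all iterated derivatives at once; it suffices to
    find a class of continuous functions whose partial derivatives stay in
    the class. *)
Lemma smooth_class (P : set (pt R -> R)) :
  (forall f, P f -> continuous f) ->
  (forall f i, P f -> exists2 g, P g & forall x, is_derive x (basis_pt R i) f (g x)) ->
  forall f, P f -> smooth f.
Proof.
move=> Pc Pd f Pf s.
have Ps : P (iter_partial s f).
  elim: s => [//|i s IH] /=.
  have [g Pg gd] := Pd _ i IH.
  rewrite (_ : (fun x => 'D_(basis_pt R i) (iter_partial s f) x) = g)//.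
  by apply/funext => x; have [] := gd x.
split; first exact: Pc.
by move=> x i; have [g _ /(_ x)[]] := Pd _ i Ps.
Qed.

Lemma smooth_is_derive (f : pt R -> R) i x : smooth f ->
  is_derive x (basis_pt R i) f ('D_(basis_pt R i) f x).
Proof. by move=> sf; apply/derivableP; have [_] := sf [::]; apply. Qed.

Lemma smooth_deriv (f : pt R -> R) i : smooth f ->
  smooth (fun x => 'D_(basis_pt R i) f x).
Proof. by move=> sf s; have := sf (rcons s i); rewrite /iter_partial -cats1 foldr_cat. Qed.

(** The algebra generated by flat functions of affine functions of one
    coordinate: it contains the bumps and is closed under partial
    derivatives. *)
Inductive flat_algebra : (pt R -> R) -> Prop :=
| Flat_coord p (c d : R) (i : 'I_3) :
    flat_algebra (fun x => flat p (c * co x i + d))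
| Flat_cst (c : R) : flat_algebra (fun=> c)
| Flat_add f g : flat_algebra f -> flat_algebra g -> flat_algebra (f \+ g)
| Flat_mul f g : flat_algebra f -> flat_algebra g -> flat_algebra (f \* g).

Lemma flat_algebra_cont f : flat_algebra f -> continuous f.
Proof.
elim=> [p c d i|c|{}f g _ cf _ cg|{}f g _ cf _ cg] x.
- apply: (@continuous_comp _ _ _ (fun x => c * co x i + d) (flat p)).
    apply: cvgD; last exact: cvg_cst.
    by apply: cvgMr; exact: co_cont.
  exact: (cont_deriv (flat_deriv p)).
- exact: cvg_cst.
- exact: cvgD (cf x) (cg x).
- exact: cvgM (cf x) (cg x).
Qed.

Lemma flat_algebra_deriv f j : flat_algebra f ->
  exists2 g, flat_algebra g & forall x, is_derive x (basis_pt R j) f (g x).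
Proof.
elim=> [p c d i|c|{}f g Pf [f' Pf' df] Pg [g' Pg' dg]|{}f g Pf [f' Pf' df] Pg [g' Pg' dg]].
- exists (fun x => (c * (i == j)%:R) * flat ('X^2 * (p - p^`())) (c * co x i + d)).
    exact: Flat_mul (Flat_cst _) (Flat_coord _ _ _ _).
  move=> x; apply/is_derive_line.
  have -> : (fun t : R => flat p (c * co (t *: basis_pt R j + x) i + d)) =
    flat p \o (fun t : R => (c * (i == j)%:R) * t + (c * co x i + d)).
    apply/funext => t /=; rewrite coD coZ co_basis; congr flat; ring.
  have d1 : is_derive (0 : R) 1 (fun t : R => (c * (i == j)%:R) * t + (c * co x i + d))
     ((c * (i == j)%:R)).
    have h : is_derive (0 : R) 1 (fun t : R => (c * (i == j)%:R) *: t + (c * co x i + d))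
       ((c * (i == j)%:R) *: 1 + 0).
      apply: is_deriveD.
    by move: h; rewrite addr0 scaler1.
  have := @is_derive1_comp _ (flat p) _ 0 _ _ (flat_deriv p _) d1.
  by rewrite /= mulr0 add0r => h; rewrite [X in is_derive _ _ _ X]mulrC.
- exists (fun=> 0); first exact: Flat_cst.
  by move=> x; exact: is_derive_cst.
- exists (f' \+ g'); first exact: Flat_add.
  by move=> x; exact: is_deriveD.
- exists ((f \* g') \+ (g \* f')); first by apply: Flat_add; exact: Flat_mul.
  by move=> x; exact: is_deriveM.
Qed.

Lemma flat_algebra_smooth f : flat_algebra f -> smooth f.
Proof.
apply: smooth_class; first exact: flat_algebra_cont.
by move=> g i; exact: flat_algebra_deriv.
Qed.

(** Zero outside the interval from [s] to [t], and tending to 1 inside it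
    as [n] grows, since both arguments then tend to infinity. *)
Definition bump1 (n : nat) (s t u : R) : R :=
  flat 1 (n%:R * u + - (n%:R * s)) * flat 1 (- n%:R * u + n%:R * t).

Definition boxbump (n : nat) a b (x : pt R) : R := \prod_i bump1 n (a i) (b i) (co x i).

Lemma bump_smooth n a b : smooth (boxbump n a b).
Proof.
apply: flat_algebra_smooth.
rewrite (_ : boxbump n a b = (fun x => bump1 n (a 0) (b 0) (co x 0)) \*
  ((fun x => bump1 n (a 1) (b 1) (co x 1)) \* (fun x => bump1 n (a 2%:R) (b 2%:R) (co x 2%:R)))).
  apply: Flat_mul; last apply: Flat_mul; apply: Flat_mul; exact: Flat_coord.
apply/funext => x; rewrite /boxbump !big_ord_recl big_ord0 mulr1 /=.
by congr (_ * (_ * _)); congr bump1; f_equal; apply/val_inj.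
Qed.

Lemma flat1_ge0_le1 t : 0 <= flat 1 t <= 1.
Proof.
rewrite /flat; case: ifPn => [t0|_]; last by rewrite lexx ler01.
by rewrite hornerC mul1r expR_ge0 -expR0 ler_expR oppr_le0 invr_ge0 ltW.
Qed.

Lemma bump1_eq0 n s t u : ~~ (s < u < t) -> bump1 n s t u = 0.
Proof.
rewrite /bump1 /flat => h.
have n0 : 0 <= n%:R :> R by [].
case: ifPn => h1; last by rewrite mul0r.
case: ifPn => h2; last by rewrite mulr0.
by move/negP: h; case; apply/andP; split; nra.
Qed.

Lemma bump_eq0 n a b x : ~ box a b x -> boxbump n a b x = 0.
Proof.
move=> h; have [i hi] : exists i, ~~ (a i < co x i < b i).
  by apply: contrapT => H; apply: h => i; apply: contrapT => /negP H1; apply: H; exists i.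
by rewrite /boxbump (bigD1 i)//= bump1_eq0// mul0r.
Qed.

Lemma bump_ge0_le1 n a b x : 0 <= boxbump n a b x <= 1.
Proof.
rewrite /boxbump; apply: (big_ind (fun y : R => 0 <= y <= 1)).
- by rewrite ler01 lexx.
- by move=> y z /andP[? ?] /andP[? ?]; rewrite mulr_ge0// mulr_ile1.
- move=> i _; rewrite /bump1.
  set y := flat _ _; set z := flat _ _.
  have /andP[? ?] : 0 <= y <= 1 := flat1_ge0_le1 _.
  have /andP[? ?] : 0 <= z <= 1 := flat1_ge0_le1 _.
  by rewrite mulr_ge0// mulr_ile1.
Qed.

Lemma flat1_cvg (c : R) : 0 < c -> flat 1 (n%:R * c) @[n --> \oo] --> (1 : R).
Proof.
move=> c0.
have pos : \forall n \near \oo, 0 < (n%:R : R).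
  by near=> n; rewrite ltr0n; near: n; exact: nbhs_infty_gt.
have [_ H] := gtr0_cvgV0 pos.
have e0 : (- ((n%:R : R)^-1 * c^-1)) @[n --> \oo] --> - (0 * c^-1).
  by apply: cvgN; apply: cvgMl; exact: H cvgr_idn.
rewrite mul0r oppr0 in e0.
have e : expR (- ((n%:R : R)^-1 * c^-1)) @[n --> \oo] --> (1 : R).
  have := continuous_cvg _ (@continuous_expR R 0) e0.
  by rewrite expR0; apply.
apply: cvg_trans e; apply: near_eq_cvg; near=> n.
rewrite /flat hornerC mul1r invfM ifT// mulr_gt0// ltr0n.
by near: n; exact: nbhs_infty_gt.
Unshelve. all: by end_near. Qed.

Lemma bump_cvg a b x : box a b x -> boxbump n a b x @[n --> \oo] --> (1 : R).
Proof.
move=> h.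
have h1 i : bump1 n (a i) (b i) (co x i) @[n --> \oo] --> (1 : R).
  have /andP[h1 h2] := h i; rewrite -(mulr1 1); apply: cvgM.
    under eq_fun do rewrite -mulrN -mulrDr.
    by apply: flat1_cvg; rewrite subr_gt0.
  under eq_fun do rewrite mulNr addrC -mulrN -mulrDr.
  by apply: flat1_cvg; rewrite subr_gt0.
rewrite /boxbump.
suff : (\prod_i bump1 n (a i) (b i) (co x i)) @[n --> \oo] --> (\prod_(i < 3) 1 : R).
  by rewrite big1.
apply: cvg_big => [|i _]; last exact: h1.
exact: mul_continuous.
Qed.

Lemma bump_test (Omega : set (pt R)) n a b : cbox a b `<=` Omega ->
  test_function Omega (boxbump n a b).
Proof.
move=> abO.
have S : closure [set x | boxbump n a b x != 0] `<=` cbox a b.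
  have clc : closed (cbox a b).
    by apply: compact_closed; [exact: norm_hausdorff|exact: cbox_compact].
  rewrite [X in _ `<=` X](iffLR (closure_id _) clc).
  apply: closureS => x /eqP bx.
  apply: box_sub_cbox; apply: contrapT => nb; apply: bx; exact: bump_eq0.
split; [exact: bump_smooth| |exact: subset_trans S abO].
by apply: subclosed_compact S; [exact: closed_closure|exact: cbox_compact].
Qed.
End BumpFunctions.

(** * The fundamental lemma and uniqueness of weak derivatives *)

Section FundamentalLemma.
Variable R : realType.

(** The bumps of the box are test functions bounded by 1 and converging to
    its indicator function: dominated convergence. *)
Lemma box_fundamental (Omega : set (pt R)) (h : pt R -> R) a b :
  open Omega -> locally_L1 Omega h ->
  (forall phi, test_function Omega phi ->
     \int[leb3]_(x in Omega) (h x * phi x) = 0) ->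
  cbox a b `<=` Omega -> \int[leb3]_(x in box a b) h x = 0.
Proof.
move=> oO hL h0 abO.
have mB := @meas_box R a b; have mO := meas_open oO.
have Ih : intg leb3 (box a b) h.
  apply: (@integrableS _ _ _ leb3 (cbox a b)) => //; first exact: meas_cbox.
    exact: box_sub_cbox.
  by apply: hL => //; exact: cbox_compact.
have mh := intg_meas Ih.
have n0 n : (\int[leb3]_(x in box a b) (h x * boxbump n a b x)%:E = 0)%E.
  have mhb : measurable_fun (box a b : set (mpt R)) (fun x => h x * boxbump n a b x).
    apply: measurable_funM => //; apply: cont_meas => //.
    by have [/(_ [::]) []] := bump_test n abO.
  have Ihb : intg leb3 (box a b) (fun x => h x * boxbump n a b x).
    apply: (@intg_le _ _ _ _ _ mB _ (fun x => `|h x|)) => //.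
      exact: integrable_norm.
    apply: aeW => x _; rewrite normrM ler_piMr//.
    by have /andP[? ?] := bump_ge0_le1 n a b x; rewrite ger0_norm.
  have := h0 _ (bump_test n abO).
  rewrite (_ : Rintegral _ _ _ = \int[leb3]_(x in box a b) (h x * boxbump n a b x)).
    by move=> E; rewrite -[LHS]fineK ?(integrable_fin_num mB Ihb)//; congr EFin.
  rewrite Rintegral_mkcond [RHS]Rintegral_mkcond; congr Rintegral.
  apply/funext => x; rewrite !patchE; case: ifPn => [xO|/negP xO].
    case: ifPn => // /negP xB; rewrite bump_eq0 ?mulr0// => xab.
    by apply: xB; rewrite inE.
  case: ifPn => //; rewrite inE => xB; case: xO; rewrite inE.
  by apply: abO; exact: box_sub_cbox.
have H : [sequence (\int[leb3]_(x in box a b) (h x * boxbump n a b x)%:E)%E]_n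
   @ \oo --> (\int[leb3]_(x in box a b) (h x)%:E)%E.
  have [] := @dominated_convergence _ _ _ leb3 (box a b) mB
    (fun n x => (h x * boxbump n a b x)%:E) (fun x => (h x)%:E) (fun x => `|h x|%:E);
    last by [].
  - move=> n; apply/measurable_EFinP; apply: measurable_funM => //; apply: cont_meas => //.
    by have [/(_ [::]) []] := bump_test n abO.
  - exact/measurable_EFinP.
  - apply: aeW => x xB; apply: cvg_EFin; first exact: nearW.
    rewrite -[X in _ --> X]mulr1; apply: cvgM; first exact: cvg_cst.
    exact: bump_cvg.
  - exact: integrable_norm.
  - apply: aeW => x n _; rewrite /= lee_fin normrM ler_piMr//.
    by have /andP[? ?] := bump_ge0_le1 n a b x; rewrite ger0_norm.
have H2 : [sequence (\int[leb3]_(x in box a b) (h x * boxbump n a b x)%:E)%E]_n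
   @ \oo --> (0 : \bar R)%E.
  by rewrite (_ : [sequence _]_n = cst 0%E); [exact: cvg_cst|exact/funext].
by rewrite /Rintegral (cvg_unique _ H H2).
Qed.

(** Integrals over all boxes vanish, so that the function vanishes almost
    everywhere on each of the countably many rational boxes that exhaust
    the open set. *)
Lemma fundamental_lemma (Omega : set (pt R)) (h : pt R -> R) :
  open Omega -> locally_L1 Omega h ->
  (forall phi, test_function Omega phi ->
     \int[leb3]_(x in Omega) (h x * phi x) = 0) ->
  ae_eq leb3 Omega h (cst 0).
Proof.
move=> oO hL h0.
have hq q : crbox q `<=` Omega -> ae_eq leb3 (rbox q : set (mpt R)) h (cst 0).
  move=> qO; apply: int_boxes_eq0.
    apply: (@integrableS _ _ _ leb3 (crbox q)); rewrite /rbox.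
    - exact: meas_cbox.
    - exact: meas_box.
    - exact: box_sub_cbox.
    - by apply: hL => //; exact: cbox_compact.
  move=> a' b' aa bb; apply: (box_fundamental oO hL h0).
  apply: subset_trans qO => x xab i; have /andP[h1 h2] := xab i.
  by rewrite (le_trans (aa i) h1) (le_trans h2 (bb i)).
(* The rational boxes are enumerated, to apply countable subadditivity. *)
pose F (n : nat) (x : mpt R) : Prop :=
  if @choice.unpickle ({ffun 'I_3 -> rat} * {ffun 'I_3 -> rat})%type n is Some q then crbox q `<=` Omega -> rbox q x -> h x = 0 else True.
have aF : {ae leb3, forall x, forall n, F n x}.
  apply/ae_foralln => n; rewrite /F; case: choice.unpickle => [q|]; last exact: aeW.
  have [qO|nq] := pselect (crbox q `<=` Omega); last by apply: aeW => x /nq.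
  by apply: filterS (hq q qO) => x + _.
apply: filterS aF => x xF xO.
have [q [qx qO]] := open_rbox oO xO.
by have := xF (choice.pickle q); rewrite /F choice.pickleK => /(_ qO qx) ->.
Qed.

Lemma patch_out (V : zmodType) (D C : set (pt R)) (f : pt R -> V) :
  C `<=` D -> (forall x, ~ C x -> f x = 0) -> f \_ D = f.
Proof.
move=> CD f0; apply/funext => x; rewrite patchE; case: ifPn => // xD.
by rewrite f0// => /CD; rewrite -inE; exact/negP.
Qed.

Lemma intg_out (D C : set (pt R)) (f : pt R -> R) :
  measurable (D : set (mpt R)) -> measurable (C : set (mpt R)) ->
  C `<=` D -> (forall x, ~ C x -> f x = 0) ->
  intg leb3 C f -> intg leb3 D f.
Proof.
move=> mD mC CD f0; move=> h; rewrite /intg; apply/(@integrable_mkcond _ _ _ leb3 D (EFin \o f) mD).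
move/(@integrable_mkcond _ _ _ leb3 C (EFin \o f) mC) : h.
have g0 x : ~ C x -> (EFin \o f) x = 0%E by move=> /f0 /= ->.
have -> : (EFin \o f) \_ D = (EFin \o f) \_ C; last by [].
apply/funext => x; rewrite !patchE.
have [xC|/g0 ->] := pselect (C x); last by rewrite !if_same.
by rewrite !mem_set//; exact: CD.
Qed.

Lemma Rint_out (D C : set (pt R)) (f : pt R -> R) :
  C `<=` D -> (forall x, ~ C x -> f x = 0) ->
  \int[leb3]_(x in D) f x = \int[leb3]_(x in C) f x.
Proof.
move=> CD f0; rewrite Rintegral_mkcond [RHS]Rintegral_mkcond.
by rewrite (patch_out CD f0) (patch_out _ f0).
Qed.

Definition tsupp (phi : pt R -> R) : set (pt R) := closure [set x | phi x != 0].

Lemma tsupp_out phi x : ~ tsupp phi x -> phi x = 0.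
Proof.
by move=> h; apply: contrapT => /eqP h1; apply: h; exact: subset_closure.
Qed.

Lemma tsupp_deriv phi i x : ~ tsupp phi x -> 'D_(basis_pt R i) phi x = 0.
Proof.
move=> nx; have nbx : \forall y \near x, phi y = cst 0 y.
  have : open (~` tsupp phi) by exact/closed_openC/closed_closure.
  rewrite openE => /(_ x nx); apply: filterS => y; exact: tsupp_out.
by rewrite (near_eq_derive _ nbx) derive_cst.
Qed.

Section TestFunctions.
Variable Omega : set (pt R).
Hypothesis oO : open Omega.

Let mO : measurable (Omega : set (mpt R)) := meas_open oO.

Lemma test_cont phi : test_function Omega phi -> continuous phi.
Proof. by case=> /(_ [::]) []. Qed.

Lemma test_bounded phi : test_function Omega phi ->
  exists M : R, forall x, `|phi x| <= M.
Proof.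
move=> tp; have [sp cp _] := tp.
have : compact (phi @` tsupp phi).
  apply: continuous_compact => //; apply: continuous_subspaceT; exact: test_cont.
move=> /compact_bounded [M [_ /(_ (`|M| + 1)) hM]].
exists (`|M| + 1) => x.
have [xs|/tsupp_out ->] := pselect (tsupp phi x); last by rewrite normr0 addr_ge0.
by apply: hM; [rewrite ltr_pwDr// ler_norm|exists x].
Qed.

Lemma intg_test f phi : locally_L1 Omega f -> test_function Omega phi ->
  intg leb3 Omega (fun x => f x * phi x).
Proof.
move=> fL tp; have [sp cp pO] := tp; have [M hM] := test_bounded tp.
have mC := meas_compact cp.
apply: (@intg_out _ (tsupp phi)) => //.
  by move=> x /tsupp_out ->; rewrite mulr0.
have If := fL _ cp pO.
apply: (@intg_le _ _ _ _ _ mC _ (fun x => M * `|f x|)).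
- apply: measurable_funM; first exact: intg_meas If.
  by apply: cont_meas => //; exact: test_cont.
- by apply: intgZ => //; exact: integrable_norm.
- by apply: aeW => x _; rewrite normrM mulrC ler_wpM2r.
Qed.

Lemma test_deriv phi i : test_function Omega phi ->
  test_function Omega (fun x => 'D_(basis_pt R i) phi x).
Proof.
move=> [sp cp pO].
have S : tsupp (fun x => 'D_(basis_pt R i) phi x) `<=` tsupp phi.
  rewrite [X in _ `<=` X](iffLR (closure_id _) (@closed_closure _ _)).
  apply: closureS => x /eqP dx; apply: contrapT => nx; apply: dx.
  exact: tsupp_deriv.
split; last exact: subset_trans S pO.
- exact: smooth_deriv.
- by apply: subclosed_compact S => //; exact: closed_closure.
Qed.

Lemma locally_L1_lin f g (k : R) : locally_L1 Omega f -> locally_L1 Omega g ->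
  locally_L1 Omega (fun x => k * f x + g x).
Proof.
move=> hf hg C cC CO; have mC := meas_compact cC.
by apply: (intgD mC); [apply: (intgZ mC); exact: hf|exact: hg].
Qed.

Lemma weak_partial_lin i f g f' g' (k : R) :
  is_weak_partial Omega i f f' -> is_weak_partial Omega i g g' ->
  is_weak_partial Omega i (fun x => k * f x + g x) (fun x => k * f' x + g' x).
Proof.
move=> [f1 f2 f3] [g1 g2 g3]; split; [exact: locally_L1_lin..|].
move=> phi tp; have tdp := test_deriv i tp.
under eq_Rintegral do rewrite mulrDl -mulrA.
under [in RHS]eq_Rintegral do rewrite mulrDl -mulrA.
rewrite !RintegralD//; try exact: intg_test; try (apply: intgZ => //; exact: intg_test).
by rewrite !RintegralZl//; try exact: intg_test; rewrite f3// g3// mulrN opprD.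
Qed.

(** The difference of two weak derivatives is orthogonal to all test
    functions. *)
Lemma weak_partial_unique i f g h :
  is_weak_partial Omega i f g -> is_weak_partial Omega i f h ->
  ae_eq leb3 Omega g h.
Proof.
move=> fg fh.
have [_ gL g0] := fg; have [_ hL h0] := fh.
suff : ae_eq leb3 Omega (fun x => -1 * g x + h x) (cst 0).
  by apply: filterS => x /[apply] /= h1; lra.
apply: fundamental_lemma => //; first exact: locally_L1_lin.
move=> phi tp; under eq_Rintegral do rewrite mulrDl -mulrA.
rewrite RintegralD//; [|by apply: intgZ => //; exact: intg_test|exact: intg_test].
rewrite RintegralZl; [|by []|exact: intg_test].
by rewrite mulN1r -g0// h0// addNr.
Qed.

Lemma wpartialP i f g : is_weak_partial Omega i f g ->
  is_weak_partial Omega i f (wpartial Omega i f).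
Proof. by move=> h; rewrite /wpartial; case: xgetP => [g' -> //|/(_ g)]. Qed.

(** Lets any explicit weak derivative replace the chosen representative. *)
Lemma wpartial_ae i f g : is_weak_partial Omega i f g ->
  ae_eq leb3 Omega (wpartial Omega i f) g.
Proof. by move=> h; apply: weak_partial_unique (wpartialP h) h. Qed.
End TestFunctions.
End FundamentalLemma.

(** * Integration by parts for test functions; the square-integrable norm *)

Section ClassicalDerivatives.
Variable R : realType.

Lemma is_derive_along (f : pt R -> R) (x v : pt R) (t l : R) :
  is_derive (t *: v + x) v f l -> is_derive t 1 (fun s : R => f (s *: v + x)) l.
Proof.
have E : (fun h : R => h^-1 *: ((f \o shift (t *: v + x)) (h *: v) - f (t *: v + x))) =
  (fun h : R => h^-1 *: (((fun t : R => f (t *: v + x)) \o shift t) (h *: 1)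
                   - (f (t *: v + x)))).
  by apply/funext => h /=; rewrite [h *: 1]mulr1 scalerDl addrA.
move=> -[d1 d2]; split; first by rewrite /derivable -E.
by move: d2; rewrite /derive E.
Qed.

Lemma is_derive_shift (f : pt R -> R) (x v a : pt R) (l : R) :
  is_derive (a + x) v f l -> is_derive x v (fun y => f (a + y)) l.
Proof.
have E : (fun h : R => h^-1 *: ((f \o shift (a + x)) (h *: v) - f (a + x))) =
  (fun h : R => h^-1 *: (((fun y => f (a + y)) \o shift x) (h *: v) - f (a + x))).
  by apply/funext => h /=; rewrite addrCA.
move=> -[d1 d2]; split; first by rewrite /derivable -E.
by move: d2; rewrite /derive E.
Qed.

Lemma line_cont (x v : pt R) : continuous (fun t : R => t *: v + x).
Proof.
move=> t; apply: cvgD; last exact: cvg_cst.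
by apply: cvgZr_tmp; exact: cvg_id.
Qed.

Lemma MVT_along (f f' : pt R -> R) (v x : pt R) (h : R) : 0 < h ->
  (forall y, is_derive y v f (f' y)) ->
  exists2 c, 0 < c < h & f (h *: v + x) - f x = h * f' (c *: v + x).
Proof.
move=> h0 df; pose g (t : R) := f (t *: v + x).
have dg (t : R) : is_derive t 1 g (f' (t *: v + x)) by apply: is_derive_along.
have [c ch E] := MVT h0 (fun t _ => dg t) (continuous_subspaceT (cont_deriv dg)).
exists c; first by rewrite in_itv /= in ch.
by move: E; rewrite /g scale0r add0r subr0 mulrC.
Qed.

Lemma dist_mid (a a' b c e : R) : a = a' -> `|a - c| < e / 2 ->
  `|a' - b| < e / 2 -> `|c - b| <= e.
Proof. by move=> <-; rewrite !ltr_norml => ? ?; rewrite ler_norml; lra. Qed.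

Lemma second_difference (h a b p q r z : R) : h != 0 ->
  z - p - q + r = h * (h * a) -> z - q - p + r = h * (h * b) -> a = b.
Proof.
move=> h0 ha hb; apply: (mulfI h0); apply: (mulfI h0); rewrite -ha -hb; ring.
Qed.

(** Both mixed derivatives are limits of the same second difference of the
    function, by two applications of the mean value theorem in either
    order. *)
Lemma mixed_partials (phi : pt R -> R) i j x : smooth phi ->
  'D_(basis_pt R i) (fun y => 'D_(basis_pt R j) phi y) x =
  'D_(basis_pt R j) (fun y => 'D_(basis_pt R i) phi y) x.
Proof.
move=> sp.
set ei := basis_pt R i; set ej := basis_pt R j.
have d1 k y := smooth_is_derive k y sp.
have d2 k m y := smooth_is_derive m y (smooth_deriv k sp).
have c2 k m : continuous (fun y => 'D_(basis_pt R m) (fun y => 'D_(basis_pt R k) phi y) y).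
  by have [+ _] := sp [:: m; k].
have key (k m : 'I_3) (h : R) : 0 < h -> exists s t, [/\ 0 < s < h, 0 < t < h &
    phi (h *: basis_pt R k + (h *: basis_pt R m + x)) - phi (h *: basis_pt R k + x)
     - phi (h *: basis_pt R m + x) + phi x =
    h * (h * 'D_(basis_pt R m) (fun y => 'D_(basis_pt R k) phi y)
      (t *: basis_pt R m + (s *: basis_pt R k + x)))].
  move=> h0; set ek := basis_pt R k; set em := basis_pt R m.
  pose A y := phi (h *: em + y) - phi y.
  have dA y : is_derive y ek A ('D_ek phi (h *: em + y) - 'D_ek phi y).
    apply: is_deriveB.
    exact: is_derive_shift.
  have [s sh E] := MVT_along x h0 dA.
  have [t th E'] := MVT_along (s *: ek + x) h0 (d2 k m).
  exists s, t; split => //; rewrite -E' -E /A.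
  by rewrite (addrCA (h *: em)); ring.
have ball_near (k m : 'I_3) (e : R) : 0 < e -> exists2 d : R, 0 < d & forall s t,
    0 < s < d -> 0 < t < d ->
    `|'D_(basis_pt R m) (fun y => 'D_(basis_pt R k) phi y)
       (t *: basis_pt R m + (s *: basis_pt R k + x)) -
      'D_(basis_pt R m) (fun y => 'D_(basis_pt R k) phi y) x| < e.
  move=> e0; have /cvgrPdist_lt /(_ e e0) := c2 k m x.
  move=> /nbhs_ballP [d /= d0 hd]; exists (d / 2); first by rewrite divr_gt0.
  move=> s t /andP[s0 sd] /andP[t0 td]; rewrite distrC; apply: hd.
  apply/ball_co => n; rewrite !coD !coZ !co_basis.
  rewrite addrA opprD addrCA subrr addr0 normrN.
  have b01 p : 0 <= ((n == p)%:R : R) <= 1 by case: eqP => _ /=; rewrite ?lexx ler01.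
  have /andP[? ?] := b01 m; have /andP[? ?] := b01 k.
  by rewrite ltr_norml; apply/andP; split; nra.
apply/eqP; rewrite -subr_eq0 -normr_eq0; apply/eqP/le_anti; rewrite normr_ge0 andbT.
apply/ler_addgt0Pr => e e0; rewrite add0r.
have e2 : 0 < e / 2 by rewrite divr_gt0.
have [a a0 ha] := ball_near j i _ e2; have [b b0 hb] := ball_near i j _ e2.
(* One step h for both orders, so that both give the same difference. *)
pose h := Num.min a b.
have h0 : 0 < h by rewrite lt_min a0.
have [s [t [/andP[s0 sh] /andP[t0 th] E]]] := key j i h h0.
have [s' [t' [/andP[s0' sh'] /andP[t0' th'] E']]] := key i j h h0.
have hn : h != 0 by rewrite gt_eqF.
rewrite [h *: basis_pt R i + _]addrCA in E'.
have Eq := second_difference hn E E'.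
have ha1 : h <= a by rewrite ge_min lexx.
have hb1 : h <= b by rewrite ge_min lexx orbT.
have h1 := ha s t; rewrite s0 t0 (lt_le_trans sh ha1) (lt_le_trans th ha1) in h1.
have h2 := hb s' t'; rewrite s0' t0' (lt_le_trans sh' hb1) (lt_le_trans th' hb1) in h2.
exact: (dist_mid Eq (h1 isT isT) (h2 isT isT)).
Qed.

Section Fubini0.
Context d1 d2 (T1 : measurableType d1) (T2 : measurableType d2).
Variable m1 : {sigma_finite_measure set T1 -> \bar R}.
Variable m2 : {sigma_finite_measure set T2 -> \bar R}.
Variable f : T1 * T2 -> \bar R.
Hypothesis If : (m1 \x m2)%E.-integrable setT f.

(** Stated for arbitrary sigma-finite factors, to be used both on the
    plane and on the plane times the line. *)
Lemma fubini0l : (forall x, \int[m2]_y f (x, y) = 0)%E ->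
  (\int[(m1 \x m2)%E]_z f z = 0)%E.
Proof.
move=> f0; rewrite -(integral12_prod_meas1 If) /fubini_F.
by under eq_integral do rewrite f0; exact: integral0.
Qed.

Lemma fubini0r : (forall y, \int[m1]_x f (x, y) = 0)%E ->
  (\int[(m1 \x m2)%E]_z f z = 0)%E.
Proof.
move=> f0; rewrite -(integral21_prod_meas1 If) /fubini_G.
by under eq_integral do rewrite f0; exact: integral0.
Qed.
End Fubini0.

Lemma int_line0 (f g : R -> R) (M : R) : 0 < M ->
  (forall t : R, is_derive t 1 f (g t)) -> continuous g ->
  (forall t, ~~ (- M < t < M) -> f t = 0) ->
  (forall t, ~~ (- M < t < M) -> g t = 0) ->
  (\int[leb1 R]_t (g t)%:E = 0)%E.
Proof.
move=> M0 df cg f0 g0.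
have cf := cont_deriv df.
have E : (\int[lebesgue_measure]_(t in `[(- M)%R, M]) (g t)%:E = (f M)%:E - (f (- M)%R)%:E)%E.
  apply: continuous_FTC2.
  - by rewrite gtrN.
  - exact: continuous_subspaceT.
  - split.
    + by move=> t _; have [] := df t.
    + by apply: cvg_at_right_filter; exact: cf.
    + by apply: cvg_at_left_filter; exact: cf.
  - by move=> t _; rewrite derive1E; have [] := df t.
rewrite !f0 ?ltxx ?andbF// subee// in E.
rewrite -[RHS]E [RHS]integral_mkcond; congr integral.
apply/funext => t; rewrite patchE; case: ifPn => // /negP nt.
rewrite g0//; apply/negP => /andP[h1 h2]; apply: nt.
by rewrite inE /= in_itv /= !ltW.
Qed.

Lemma intg_cont_compact (G : pt R -> R) (M : R) : continuous G ->
  (forall x, ~ box (fun=> - M) (fun=> M) x -> G x = 0) -> intg leb3 setT G.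
Proof.
move=> cG G0.
have mC := @meas_cbox R (fun=> - M) (fun=> M).
apply: (@intg_out _ _ (cbox (fun=> - M) (fun=> M))) => //.
  by move=> x xC; apply: G0 => /box_sub_cbox.
apply: measurable_bounded_integrable => //; first exact: cbox_fin.
  exact: cont_meas.
have : compact (G @` cbox (fun=> - M) (fun=> M)).
  by apply: continuous_compact; [exact: continuous_subspaceT|exact: cbox_compact].
by move=> /compact_bounded [N [Nr hN]]; exists N; split => // y yN x xC; apply: hN => //; exists x.
Qed.

Local Notation mpt2 := (measurableTypeR R * measurableTypeR R)%type.

Lemma intg_slice (G : pt R -> R) (M z : R) : continuous G ->
  (forall x, ~ box (fun=> - M) (fun=> M) x -> G x = 0) ->
  (leb1 R \x leb1 R)%E.-integrable setT (fun y : mpt2 => (G (y, z))%:E).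
Proof.
move=> cG G0.
have mG : measurable_fun (setT : set mpt2) (fun y => G (y, z)).
  have := cont_meas (measurableT : measurable (setT : set (mpt R))) cG.
  exact: measurable_fun_pair1.
pose C : set mpt2 := `[- M, M] `*` `[- M, M].
have mI : measurable (`[- M, M]%classic : set (measurableTypeR R)).
  exact: measurable_itv.
have mC : measurable C by exact: measurableX.
have finC : ((leb1 R \x leb1 R)%E C < +oo)%E.
  rewrite (_ : (leb1 R \x leb1 R)%E C = leb1 R (`[(- M)%R, M]%classic) *
     leb1 R (`[(- M)%R, M]%classic))%E; last exact: product_measure1E.
  have fin1 : (leb1 R (`[(- M)%R, M]%classic : set (measurableTypeR R)) < +oo)%E.
    by rewrite /leb1 /= lebesgue_measure_itv /=; case: ifPn => // _; rewrite -EFinB ltry.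
  by rewrite lte_mul_pinfty ?ge0_fin_numE.
have IC : (leb1 R \x leb1 R)%E.-integrable C (EFin \o (fun y : mpt2 => G (y, z))).
  apply: measurable_bounded_integrable => //; first exact: measurable_funTS.
  have : compact (G @` cbox (fun=> - M) (fun=> M)).
    by apply: continuous_compact; [exact: continuous_subspaceT|exact: cbox_compact].
  move=> /compact_bounded [N [Nr hN]]; exists `|N|; split => // y yN x xC.
  have [xB|xB] := pselect (box (fun=> - M) (fun=> M) (x, z)).
    apply: hN; first exact: le_lt_trans (ler_norm _) yN.
    by exists (x, z) => //; exact: box_sub_cbox.
  by rewrite /= G0// normr0 (le_trans _ (ltW yN)).

have {}IC := iffLR (@integrable_mkcond _ _ _ (leb1 R \x leb1 R)%E C _ mC) IC.
rewrite (_ : (fun y : mpt2 => (G (y, z))%:E) = (EFin \o (fun y : mpt2 => G (y, z))) \_ C)//.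
apply/funext => y; rewrite patchE; case: ifPn => // /negP yC.
rewrite G0// => /box_sub_cbox; rewrite cboxE => -[/= h _]; apply: yC.
by rewrite inE.
Qed.

Lemma leb2_sigma_finite : sigma_finite setT (leb2 R).
Proof.
have /sigma_finiteP[F [TF ndF Foo]] := sigma_finiteT (leb1 R).
exists (fun n => F n `*` F n).
  apply/esym; rewrite -subTset => -[x y] _.
  have [n _ nx] : (\bigcup_n F n) x by rewrite -TF.
  have [m _ my] : (\bigcup_n F n) y by rewrite -TF.
  exists (maxn n m) => //; split => /=.
    by move: x nx; apply/subsetPset/ndF; exact: leq_maxl.
  by move: y my; apply/subsetPset/ndF; exact: leq_maxr.
move=> n; have [mF fF] := Foo n; split; first exact: measurableX.
rewrite (_ : leb2 R _ = leb1 R (F n) * leb1 R (F n))%E; last exact: product_measure1E.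
by rewrite lte_mul_pinfty ?ge0_fin_numE.
Qed.

(** The planar measure is declared as a mere measure, while Fubini's
    theorem on the space needs its sigma-finiteness; this copy carries
    both structures. *)
Definition sleb2 : set mpt2 -> \bar R := leb2 R.
HB.instance Definition _ := Measure.copy sleb2 (leb2 R).
HB.instance Definition _ :=
  Measure_isSigmaFinite.Build _ _ _ sleb2 leb2_sigma_finite.

(** Integrating a compactly supported partial derivative first along its
    own coordinate gives zero, by the fundamental theorem of calculus; the
    other two integrations then have nothing to add. *)
Lemma int_partial_eq0 (F G : pt R -> R) (i : 'I_3) (M : R) : 0 < M ->
  continuous G -> (forall x, is_derive x (basis_pt R i) F (G x)) ->
  (forall x, ~ box (fun=> - M) (fun=> M) x -> F x = 0) ->
  (forall x, ~ box (fun=> - M) (fun=> M) x -> G x = 0) ->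
  \int[leb3]_x G x = 0.
Proof.
move=> M0 cG dF F0 G0.
have IG := intg_cont_compact cG G0.
have line (x : pt R) : co x i = 0 ->
    (\int[leb1 R]_t (G (t *: basis_pt R i + x))%:E = 0)%E.
  move=> x0; apply: (@int_line0 (fun t => F (t *: basis_pt R i + x)) _ M) => //.
  - by move=> t; apply: is_derive_along.
  - by move=> t; apply: continuous_comp; [exact: line_cont|exact: cG].
  - move=> t /negP ht; apply: F0 => /(_ i).
    by rewrite coD coZ co_basis eqxx mulr1 x0 addr0.
  - move=> t /negP ht; apply: G0 => /(_ i).
    by rewrite coD coZ co_basis eqxx mulr1 x0 addr0.
suff : (\int[leb3]_x (G x)%:E = 0)%E by rewrite /Rintegral => ->.
pose l2 : {sigma_finite_measure set mpt2 -> \bar R} := sleb2.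
have fubl : (forall y, \int[leb1 R]_z (G (y, z))%:E = 0)%E ->
    (\int[leb3]_x (G x)%:E = 0)%E.
  exact: (@fubini0l _ _ mpt2 (measurableTypeR R) l2 (leb1 R) (EFin \o G) IG).
have fubr : (forall z, \int[l2]_y (G (y, z))%:E = 0)%E ->
    (\int[leb3]_x (G x)%:E = 0)%E.
  exact: (@fubini0r _ _ mpt2 (measurableTypeR R) l2 (leb1 R) (EFin \o G) IG).
move: i dF line; apply/forall3; split.
- move=> dF line; apply: fubr => z.
  apply: (fubini0r (intg_slice z cG G0)) => y /=.
  rewrite -[RHS](line (0, y, z)); last by rewrite coE.
  apply: eq_integral => t _; congr (G _)%:E; apply: co_inj; apply/forall3.
  by rewrite !coD !coZ !co_basis !coE /=; split; ring.
- move=> dF line; apply: fubr => z.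
  apply: (fubini0l (intg_slice z cG G0)) => y /=.
  rewrite -[RHS](line (y, 0, z)); last by rewrite coE.
  apply: eq_integral => t _; congr (G _)%:E; apply: co_inj; apply/forall3.
  by rewrite !coD !coZ !co_basis !coE /=; split; ring.
- move=> dF line; apply: fubl => y.
  rewrite -[RHS](line (y, 0)); last by rewrite coE.
  apply: eq_integral => t _; congr (G _)%:E; apply: co_inj; apply/forall3.
  by rewrite !coD !coZ !co_basis !coE /=; split; ring.
Qed.

Lemma cont_locally_L1 (Omega : set (pt R)) (f : pt R -> R) :
  continuous f -> locally_L1 Omega f.
Proof.
move=> cf C cC _; have mC := meas_compact cC.
apply: measurable_bounded_integrable => //.
- by apply: bounded_fin => //; exact: compact_bounded.
- exact: cont_meas.
- have : compact (f @` C).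
    by apply: continuous_compact => //; exact: continuous_subspaceT.
  by move=> /compact_bounded [N [Nr hN]]; exists N; split => // y yN x xC; apply: hN => //; exists x.
Qed.

(** An open set is a countable union of boxes with compact closure in it. *)
Lemma locally_L1_meas (Omega : set (pt R)) (f : pt R -> R) : open Omega ->
  locally_L1 Omega f -> measurable_fun (Omega : set (mpt R)) f.
Proof.
move=> oO fL _ Y mY.
rewrite (open_bigcup_rbox oO) setI_bigcupl bigcup_mkcond.
apply: countable_bigcupT_measurable; first exact: countableP.
move=> q; case: ifPn => // qO.
have Iq : intg leb3 (crbox q) f.
  by apply: fL; [exact: cbox_compact|rewrite inE in qO].
have mq : measurable_fun (rbox q : set (mpt R)) f.
  apply: measurable_funS (intg_meas Iq); [exact: meas_cbox|exact: box_sub_cbox].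
by apply: mq => //; exact: meas_box.
Qed.

Section WeakDerivatives.
Variable Omega : set (pt R).
Hypothesis oO : open Omega.
Let mO : measurable (Omega : set (mpt R)) := meas_open oO.

(** Integration by parts: the derivative of a product of two test
    functions has zero integral. *)
Lemma test_weak_partial phi i : test_function Omega phi ->
  is_weak_partial Omega i phi (fun x => 'D_(basis_pt R i) phi x).
Proof.
move=> tp; have tdp := test_deriv i tp.
split; [exact/cont_locally_L1/(test_cont tp)|exact/cont_locally_L1/(test_cont tdp)|].
move=> psi ts; have tds := test_deriv i ts.
have L f : test_function Omega f -> locally_L1 Omega f.
  by move=> tf; apply: cont_locally_L1; exact: test_cont tf.
have I1 := intg_test oO (L _ tp) tds.
have I2 := intg_test oO (L _ tdp) ts.
apply/eqP; rewrite -addr_eq0; apply/eqP; rewrite -RintegralD//.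
have [sp cp pO] := tp; have [ss _ _] := ts.
have [M [M0 pM]] := bounded_sub_cbox (compact_bounded cp).
have out x : ~ box (fun=> - M) (fun=> M) x -> phi x = 0.
  by move=> xB; apply: tsupp_out => /pM.
have outd x : ~ box (fun=> - M) (fun=> M) x -> 'D_(basis_pt R i) phi x = 0.
  by move=> xB; apply: tsupp_deriv => /pM.
pose G x := phi x * 'D_(basis_pt R i) psi x + 'D_(basis_pt R i) phi x * psi x.
have G0 x : ~ Omega x -> G x = 0.
  move=> xO; rewrite /G; have [_ _ dO] := tdp.
  by rewrite (@tsupp_out R phi) ?(@tsupp_out R (fun x => 'D_(basis_pt R i) phi x)) ?mul0r ?addr0//;
    [move=> /dO|move=> /pO].
rewrite -[LHS](@Rint_out R setT Omega G)//.
apply: (@int_partial_eq0 (fun x => phi x * psi x) G i M) => //.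
- move=> x; apply: cvgD; apply: cvgM.
  + exact: test_cont tp x.
  + exact: test_cont tds x.
  + exact: test_cont tdp x.
  + exact: test_cont ts x.
- move=> x; have := is_deriveM (smooth_is_derive i x sp) (smooth_is_derive i x ss).
  rewrite /G.
  by rewrite [_ *: 'D_(basis_pt R i) phi x]mulrC.
- by move=> x /out ->; rewrite mul0r.
- by move=> x xB; rewrite /G out// outd// !mul0r addr0.
Qed.

Lemma Lnorm2E f : ('N[leb3]_2%:E [EFin \o f \_ Omega] =
  (\int[leb3]_(x in Omega) (f x ^+ 2)%:E) `^ 2^-1)%E.
Proof.
rewrite unlock /= [in RHS]integral_mkcond; congr (_ `^ _)%E.
apply: eq_integral => x _ /=; rewrite !patchE; case: ifPn => _ /=.
  by rewrite powR_mulrn// real_normK ?num_real.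
by rewrite normr0 powR0 ?pnatr_eq0.
Qed.

(** Membership in the Lebesgue space becomes square integrability on the
    domain, to which the real-valued estimates apply. *)
Lemma L2P f : L2 Omega f <-> sqi leb3 Omega f.
Proof.
rewrite /Lp /= inE /Lfun; split.
- move=> /andP[]; rewrite !inE /= /finite_norm Lnorm2E => mf fin.
  have mf' : measurable_fun (Omega : set (mpt R)) f.
    by apply/measurable_restrictT.
  split => //; apply/integrableP; split.
    by apply/measurable_EFinP; exact: measurable_funX.
  rewrite (_ : integral _ _ _ = \int[leb3]_(x in Omega) (f x ^+ 2)%:E)%E; last first.
    by apply: eq_integral => x _ /=; rewrite ger0_norm ?sqr_ge0.
  by apply: lty_poweRy fin; rewrite invr_neq0.
- move=> [mf f2]; apply/andP; split; rewrite inE /=.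
    by apply/(measurable_restrictT _ mO).
  rewrite /finite_norm Lnorm2E; apply: poweR_lty.
  have /integrableP[_] := f2; apply: le_lt_trans.
  by apply: le_trans (le_abse_integral _ _ _) => //;
    [exact: lee_abs|case/integrableP: f2].
Qed.

Lemma norm0E f : norm0 Omega f = nrm leb3 Omega f.
Proof.
rewrite /norm0 /Lp_norm Lnorm2E /nrm /Rintegral.
have I0 : (0 <= \int[leb3]_(x in Omega) (f x ^+ 2)%:E)%E.
  by apply: integral_ge0 => x _; rewrite lee_fin sqr_ge0.
case: (integral _ _ _) I0 => [r| |]//=.
- by rewrite lee_fin => r0; rewrite powR12_sqrt.
- by move=> _; rewrite invr_eq0 pnatr_eq0 /= sqrtr0.
Qed.
End WeakDerivatives.
End ClassicalDerivatives.

(** * First-order Sobolev functions vanishing on the boundary *)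

Section SobolevSpaces.
Variable R : realType.

(** The class of all linear combinations of two smooth functions is closed
    under partial derivatives, hence consists of smooth functions. *)
Lemma smooth_lin (f g : pt R -> R) (k : R) : smooth f -> smooth g ->
  smooth (fun x => k * f x + g x).
Proof.
move=> sf sg.
apply: (@smooth_class R [set h | exists f g, [/\ smooth f, smooth g & h = fun x => k * f x + g x]]).
- move=> _ [{sf}f [{sg}g [sf sg ->]]] x; apply: cvgD.
    by apply: cvgMr; have [c _] := sf [::]; exact: c.
  by have [c _] := sg [::]; exact: c.
- move=> _ i [{sf}f [{sg}g [sf sg ->]]].
  exists (fun x => k * 'D_(basis_pt R i) f x + 'D_(basis_pt R i) g x).
    by exists (fun x => 'D_(basis_pt R i) f x), (fun x => 'D_(basis_pt R i) g x); split; try exact: smooth_deriv.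
  move=> x; have dk := is_deriveZ k (smooth_is_derive i x sf).
  exact: is_deriveD dk (smooth_is_derive i x sg).
- by exists f, g.
Qed.

Lemma test_lin (Omega : set (pt R)) f g (k : R) :
  test_function Omega f -> test_function Omega g ->
  test_function Omega (fun x => k * f x + g x).
Proof.
move=> [sf cf fO] [sg cg gO].
have S : tsupp (fun x => k * f x + g x) `<=` tsupp f `|` tsupp g.
  have cl : closed (tsupp f `|` tsupp g) by apply: closedU; exact: closed_closure.
  rewrite [X in _ `<=` X](iffLR (closure_id _) cl).
  apply: closureS => x /eqP fgx; apply: contrapT => /not_orP[nf ng].
  by apply: fgx; rewrite (tsupp_out nf) (tsupp_out ng) mulr0 addr0.
split; first exact: smooth_lin.
- apply: subclosed_compact S; first exact: closed_closure.
  exact: compactU.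
- by apply: subset_trans S _ => x [/fO|/gO].
Qed.

Section Sobolev.
Variable Omega : set (pt R).
Hypothesis oO : open Omega.
Let mO : measurable (Omega : set (mpt R)) := meas_open oO.
Local Notation sqO := (sqi leb3 Omega).
Local Notation n0 := (nrm leb3 Omega).
Local Notation dw := (wpartial Omega).

Lemma H1_sqi f : H1 Omega f -> sqO f.
Proof. by move=> [/(L2P oO)]. Qed.

Lemma H1_wpartial f i : H1 Omega f -> is_weak_partial Omega i f (dw i f).
Proof. by move=> [_ /(_ i)[g _ /wpartialP]]. Qed.

Lemma H1_wpartial_sqi f i : H1 Omega f -> sqO (dw i f).
Proof.
move=> hf; have [_ /(_ i)[g /(L2P oO) g2 wg]] := hf.
have [_ dL _] := H1_wpartial i hf.
apply: sqi_ae g2 _ => //; first exact: (locally_L1_meas oO dL).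
apply: ae_eq_sym; exact: wpartial_ae.
Qed.

Lemma wpartial_lin f g i (k : R) : H1 Omega f -> H1 Omega g ->
  ae_eq leb3 Omega (dw i (fun x => k * f x + g x))
    (fun x => k * dw i f x + dw i g x).
Proof.
move=> hf hg; apply: (wpartial_ae oO).
by apply: weak_partial_lin => //; exact: H1_wpartial.
Qed.

Lemma H1_lin f g (k : R) : H1 Omega f -> H1 Omega g ->
  H1 Omega (fun x => k * f x + g x).
Proof.
move=> hf hg; split.
  by apply/(L2P oO); apply: (sqiD mO); [apply: (sqiZ mO)|]; exact: H1_sqi.
move=> i; exists (fun x => k * dw i f x + dw i g x).
  by apply/(L2P oO); apply: (sqiD mO); [apply: (sqiZ mO)|]; exact: H1_wpartial_sqi.
by apply: weak_partial_lin => //; exact: H1_wpartial.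
Qed.

Lemma test_sqi phi : test_function Omega phi -> sqO phi.
Proof.
move=> tp; split; first by apply: cont_meas => //; exact: test_cont tp.
by apply: (intg_test oO) => //; apply: cont_locally_L1; exact: test_cont tp.
Qed.

Lemma test_H1 phi : test_function Omega phi -> H1 Omega phi.
Proof.
move=> tp; split; first by apply/(L2P oO); exact: test_sqi.
move=> i; exists (fun x => 'D_(basis_pt R i) phi x).
  by apply/(L2P oO); apply: test_sqi; exact: test_deriv.
exact: test_weak_partial.
Qed.

Lemma norm1_sqr f : norm1 Omega f ^+ 2 = n0 f ^+ 2 + \sum_i n0 (dw i f) ^+ 2.
Proof.
rewrite /norm1 sqr_sqrtr; last first.
  by rewrite addr_ge0 ?sqr_ge0// sumr_ge0// => i _; rewrite sqr_ge0.
by rewrite norm0E; congr (_ + _); apply: eq_bigr => i _; rewrite norm0E.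
Qed.

Lemma norm1_ge0 f : 0 <= norm1 Omega f. Proof. exact: sqrtr_ge0. Qed.

Lemma n0_le_norm1 f : n0 f <= norm1 Omega f.
Proof.
rewrite -(@ler_pXn2r _ 2)// ?nnegrE ?norm1_ge0 ?nrm_ge0// norm1_sqr lerDl.
by rewrite sumr_ge0// => i _; rewrite sqr_ge0.
Qed.

Lemma n0_dw_le_norm1 f i : n0 (dw i f) <= norm1 Omega f.
Proof.
rewrite -(@ler_pXn2r _ 2)// ?nnegrE ?norm1_ge0 ?nrm_ge0// norm1_sqr (bigD1 i)//=.
rewrite addrCA lerDl addr_ge0 ?sqr_ge0//.
by rewrite sumr_ge0// => j _; rewrite sqr_ge0.
Qed.

Lemma norm1_le f (e : R) : n0 f <= e -> (forall i, n0 (dw i f) <= e) ->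
  norm1 Omega f <= 2 * e.
Proof.
move=> fe de; have e0 : 0 <= e := le_trans (nrm_ge0 _ _ _) fe.
rewrite -(@ler_pXn2r _ 2)// ?nnegrE ?norm1_ge0 ?mulr_ge0// norm1_sqr.
have le2 (a : R) : 0 <= a -> a <= e -> a ^+ 2 <= e ^+ 2.
  by move=> a0 ae; rewrite ler_pXn2r ?nnegrE.
apply: le_trans (lerD (le2 _ (nrm_ge0 _ _ _) fe) (ler_sum _ (fun i _ => le2 _ (nrm_ge0 _ _ _) (de i)))) _.
rewrite sumr_const card_ord exprMn -[e ^+ 2 *+ 3]mulr_natr; lra.
Qed.

(** A bound of the triangle inequality type, up to a factor 2 that is
    harmless for density arguments. *)
Lemma norm1_lin f g (k : R) : H1 Omega f -> H1 Omega g ->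
  norm1 Omega (fun x => k * f x + g x) <= 2 * (`|k| * norm1 Omega f + norm1 Omega g).
Proof.
move=> hf hg; apply: norm1_le => [|i].
  apply: le_trans (nrmD mO (sqiZ mO k (H1_sqi hf)) (H1_sqi hg)) _.
  rewrite nrmZ//; last exact: H1_sqi.
  by apply: lerD; [apply: ler_wpM2l => //|]; exact: n0_le_norm1.
have sf := H1_wpartial_sqi i hf; have sg := H1_wpartial_sqi i hg.
have [mfg _] := H1_wpartial_sqi i (H1_lin k hf hg).
have [m2 _] := sqiD mO (sqiZ mO k sf) sg.
rewrite (nrm_ae mO mfg m2 (wpartial_lin i k hf hg)).
apply: le_trans (nrmD mO (sqiZ mO k sf) sg) _.
rewrite nrmZ//.
by apply: lerD; [apply: ler_wpM2l => //|]; exact: n0_dw_le_norm1.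
Qed.

Lemma approx_bound (c d a b e : R) : 0 <= c -> 0 < d -> a <= d -> b <= d ->
  4 * ((c + 1) * d) = e -> 2 * (c * a + b) < e.
Proof. by move=> *; nra. Qed.

Lemma H10_lin f g (k : R) : H10 Omega f -> H10 Omega g ->
  H10 Omega (fun x => k * f x + g x).
Proof.
move=> [hf af] [hg ag]; split; first exact: H1_lin.
move=> e e0.
pose d := e / (4 * (`|k| + 1)).
have k1 : 0 < `|k| + 1 by rewrite ltr_wpDl.
have d0 : 0 < d by rewrite divr_gt0// mulr_gt0.
have [phi tp hp] := af _ d0; have [psi ts hs] := ag _ d0.
exists (fun x => k * phi x + psi x); first exact: test_lin.
have sub h eta : H1 Omega h -> test_function Omega eta -> H1 Omega (fun x => h x - eta x).
  move=> hh te; have := H1_lin (-1) (test_H1 te) hh.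
  by congr (H1 Omega _); apply/funext => x; rewrite mulN1r addrC.
have -> : (fun x => k * f x + g x - (k * phi x + psi x)) =
  (fun x => k * (f x - phi x) + (g x - psi x)).
  by apply/funext => x; ring.
apply: le_lt_trans (norm1_lin k (sub _ _ hf tp) (sub _ _ hg ts)) _.
have E : 4 * ((`|k| + 1) * d) = e by rewrite /d; field; rewrite gt_eqF.
exact: (approx_bound (normr_ge0 k) d0 (ltW hp) (ltW hs) E).
Qed.

Lemma H10_zero : H10 Omega (fun=> 0).
Proof.
have t0 : test_function Omega (fun=> 0).
  have e0 : [set x : pt R | (0 : R) != 0] = set0.
    by apply/seteqP; split => x //=; rewrite eqxx.
  split.
  - apply: flat_algebra_smooth; exact: Flat_cst.
  - by rewrite e0 closure0; exact: compact0.
  - by rewrite e0 closure0.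
have h0 := test_H1 t0; split => //.
move=> e e0; exists (fun=> 0) => //.
rewrite (_ : (fun=> 0 - 0) = (fun=> 0) :> (pt R -> R)); last first.
  by apply/funext => x; rewrite subrr.
have z : n0 (fun=> 0) = 0 := nrm0 leb3 mO.
apply: le_lt_trans e0; apply: (@le_trans _ _ (2 * 0)); last by rewrite mulr0.
apply: norm1_le; first by rewrite z.
move=> i; have [md _] := H1_wpartial_sqi i h0.
rewrite (nrm_ae mO md (@measurable_cst _ _ _ _ _ (0 : R))) ?z//.
have := wpartial_lin i (-1) h0 h0.
rewrite (_ : (fun x => -1 * 0 + 0) = (fun=> 0) :> (pt R -> R)); last first.
  by apply/funext => x; rewrite mulr0 addr0.
by apply: filterS => x /[apply] ->; rewrite mulN1r addNr.
Qed.

Lemma split_product (a b c : R) : a * b = a * (b + -1 * c) + a * c.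
Proof. ring. Qed.

Lemma eq_of_dist (p q : R) : (forall e, 0 < e -> `|p - q| <= e) -> p = q.
Proof.
move=> h; apply/eqP; rewrite -subr_eq0 -normr_eq0; apply/eqP/le_anti.
by rewrite normr_ge0 andbT; apply/ler_addgt0Pr => e /h; rewrite add0r.
Qed.

Lemma swap_bound (a a' b b' d e p q r r' x y : R) : 0 <= a -> 0 <= a' -> 0 < d ->
  `|p| <= a * b -> `|q| <= a' * b' -> b <= d -> b' <= d ->
  (a + a' + 1) * d = e -> x = p + r -> y = q + r' -> r = r' -> `|x - y| <= e.
Proof.
move=> a0 a0' d0 hp hq bd bd' <- -> -> <-.
rewrite (_ : p + r - (q + r) = p - q); last by ring.
by apply: le_trans (ler_normB _ _) _; nra.
Qed.

(** For [g] a test function both sides equal [- \int f d_i d_j g] by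
    definition of the weak derivatives of [f], as second derivatives
    commute; both sides are continuous in [g] for the H^1 norm, and test
    functions are dense. *)
Lemma wpartial_swap f g i j : H1 Omega f -> H10 Omega g ->
  \int[leb3]_(x in Omega) (dw i f x * dw j g x) =
  \int[leb3]_(x in Omega) (dw j f x * dw i g x).
Proof.
move=> hf [hg ag].
have si := H1_wpartial_sqi i hf; have sj := H1_wpartial_sqi j hf.
have gi := H1_wpartial_sqi i hg; have gj := H1_wpartial_sqi j hg.
have [_ _ wi] := H1_wpartial i hf; have [_ _ wj] := H1_wpartial j hf.
have test phi : test_function Omega phi ->
    \int[leb3]_(x in Omega) (dw i f x * 'D_(basis_pt R j) phi x) =
    \int[leb3]_(x in Omega) (dw j f x * 'D_(basis_pt R i) phi x).
  move=> tp; apply: oppr_inj.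
  have E1 := wi _ (test_deriv j tp).
  have E2 := wj _ (test_deriv i tp).
  apply: etrans (esym E1) (etrans _ E2).
  have [sp _ _] := tp.
  apply: eq_Rintegral => x _.
  exact: (congr1 (fun y => f x * y) (mixed_partials i j x sp)).
apply: eq_of_dist => e e0.
(* The approximation of g is taken so fine that both errors add up to e. *)
pose c := n0 (dw i f) + n0 (dw j f) + 1.
have c0 : 0 < c by rewrite ltr_wpDl// addr_ge0// nrm_ge0.
have [phi tp hp] := ag _ (divr_gt0 e0 c0).
have hd k : n0 (fun x => dw k g x + -1 * 'D_(basis_pt R k) phi x) <= e / c.
  apply: le_trans (ltW hp); apply: le_trans (n0_dw_le_norm1 _ k).
  have E : (fun x => g x - phi x) = (fun x => -1 * phi x + g x).
    by apply/funext => x; rewrite mulN1r addrC.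
  have hsub : H1 Omega (fun x => g x - phi x).
    by rewrite E; apply: H1_lin => //; exact: test_H1.
  rewrite le_eqVlt; apply/orP; left; apply/eqP; apply: nrm_ae => //.
  - apply: measurable_funD; first by case: (H1_wpartial_sqi k hg).
    by apply: measurable_funM => //; case: (test_sqi (test_deriv k tp)).
  - by case: (H1_wpartial_sqi k hsub).
  - apply: ae_eq_sym; rewrite E; apply: (wpartial_ae oO).
    rewrite (_ : (fun x => dw k g x + -1 * 'D_(basis_pt R k) phi x) =
      (fun x => -1 * 'D_(basis_pt R k) phi x + dw k g x)); last first.
      by apply/funext => x; rewrite addrC.
    exact: (weak_partial_lin oO (-1) (test_weak_partial oO k tp) (H1_wpartial k hg)).
have split_int k m : sqO (dw m f) ->
    \int[leb3]_(x in Omega) (dw m f x * dw k g x) =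
    \int[leb3]_(x in Omega) (dw m f x * (dw k g x + -1 * 'D_(basis_pt R k) phi x)) +
    \int[leb3]_(x in Omega) (dw m f x * 'D_(basis_pt R k) phi x).
  move=> sm; have st := test_sqi (test_deriv k tp).
  rewrite -RintegralD//; last 2 first.
  - apply: (sqi_mul mO) => //; apply: (sqiD mO); first exact: H1_wpartial_sqi.
    exact: (sqiZ mO).
  - exact: (sqi_mul mO).
  apply: eq_Rintegral => x _; exact: split_product.
have E1 := split_int j i si; have E2 := split_int i j sj; have E3 := test _ tp.
have st k : sqO (fun x => dw k g x + -1 * 'D_(basis_pt R k) phi x).
  apply: (sqiD mO); first exact: H1_wpartial_sqi.
  by apply: (sqiZ mO); apply: test_sqi; exact: test_deriv.
have b1 := cauchy_schwarz mO si (st j); have b2 := cauchy_schwarz mO sj (st i).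
have E : c * (e / c) = e by field; rewrite gt_eqF.
exact: (swap_bound (nrm_ge0 _ _ _) (nrm_ge0 _ _ _) (divr_gt0 e0 c0) b1 b2 (hd j) (hd i) E E1 E2 E3).
Qed.
End Sobolev.
End SobolevSpaces.

(** * Pointwise inequalities for vectors and matrices *)

Section Pointwise.
Variable R : realType.

Implicit Types (a b c : 'cV[R]_3) (G : 'M[R]_3).

Lemma sum3 (F : 'I_3 -> R) : \sum_i F i = F 0 + F 1 + F 2%:R.
Proof.
rewrite !big_ord_recl big_ord0 addr0 addrA.
by congr (_ + _ + _); congr F; apply/val_inj.
Qed.

Lemma ord3_add : ((0 : 'I_3) + 1 = 1) * ((0 : 'I_3) + 2%:R = 2%:R) *
  ((1 : 'I_3) + 1 = 2%:R) * ((1 : 'I_3) + 2%:R = 0) *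
  ((2%:R : 'I_3) + 1 = 0) * ((2%:R : 'I_3) + 2%:R = 1).
Proof. by do !split; apply/val_inj. Qed.

Lemma dotE a b : dot a b = a 0 0 * b 0 0 + a 1 0 * b 1 0 + a 2%:R 0 * b 2%:R 0.
Proof. exact: sum3. Qed.

Lemma dot_lin_l (k : R) a b c : dot (k *: a + b) c = k * dot a c + dot b c.
Proof. rewrite !dotE !mxE; ring. Qed.

Lemma dot_lin_r (k : R) a b c : dot c (k *: a + b) = k * dot c a + dot c b.
Proof. rewrite !dotE !mxE; ring. Qed.

Lemma dotC a b : dot a b = dot b a.
Proof. rewrite !dotE; ring. Qed.

Lemma dot_ge0 a : 0 <= dot a a.
Proof. by rewrite dotE -!expr2 !addr_ge0// sqr_ge0. Qed.

Lemma sqr_enorm a : enorm a ^+ 2 = dot a a.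
Proof. by rewrite sqr_sqrtr// dot_ge0. Qed.

Lemma enorm_ge0 a : 0 <= enorm a. Proof. exact: sqrtr_ge0. Qed.
Hint Resolve enorm_ge0 : core.

Lemma le_of_sqr (x y : R) : 0 <= y -> x ^+ 2 <= y ^+ 2 -> x <= y.
Proof.
move=> y0 h; apply: (le_trans (ler_norm x)).
by rewrite -(@ler_pXn2r _ 2)// ?nnegrE// real_normK ?num_real.
Qed.

(** Lagrange's identity, which gives both the Cauchy-Schwarz inequality
    and the bound of the cross product. *)
Lemma lagrange a b : dot a b ^+ 2 + dot (cross a b) (cross a b) = dot a a * dot b b.
Proof. rewrite !dotE !mxE !ord3_add; ring. Qed.

Lemma dot_le a b : `|dot a b| <= enorm a * enorm b.
Proof.
apply: le_of_sqr; first by rewrite mulr_ge0.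
by rewrite real_normK ?num_real// exprMn !sqr_enorm -lagrange lerDl dot_ge0.
Qed.

Lemma enorm_cross a b : enorm (cross a b) <= enorm a * enorm b.
Proof.
apply: le_of_sqr; first by rewrite mulr_ge0.
by rewrite exprMn !sqr_enorm -lagrange lerDr sqr_ge0.
Qed.

Lemma enorm_lin (k : R) a b : enorm (k *: a + b) <= `|k| * enorm a + enorm b.
Proof.
apply: le_of_sqr; first by rewrite addr_ge0 ?mulr_ge0.
rewrite sqr_enorm dot_lin_l !dot_lin_r (dotC b a).
have : k * dot a b <= `|k| * (enorm a * enorm b).
  by apply: (le_trans (ler_norm _)); rewrite normrM ler_wpM2l// dot_le.
have : (`|k| * enorm a) ^+ 2 = k * (k * dot a a).
  by rewrite exprMn sqr_enorm real_normK ?num_real// expr2 mulrA.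
rewrite sqrrD (sqr_enorm b) => ->; lra.
Qed.

Lemma enorm0 : enorm 0 = 0 :> R.
Proof. by rewrite /enorm dotE !mxE !mul0r !addr0 sqrtr0. Qed.

Lemma enorm_eq0 a : enorm a = 0 -> a = 0.
Proof.
move=> a0; have := sqr_enorm a; rewrite a0 expr0n /= dotE -!expr2 => /esym/eqP.
rewrite !paddr_eq0 ?addr_ge0 ?sqr_ge0// !sqrf_eq0 => /andP[/andP[/eqP h0 /eqP h1] /eqP h2].
by apply/colP; apply/forall3; rewrite !mxE.
Qed.

Lemma enormZ (k : R) a : enorm (k *: a) = `|k| * enorm a.
Proof.
rewrite /enorm (_ : dot (k *: a) (k *: a) = k ^+ 2 * dot a a).
  by rewrite sqrtrM ?sqr_ge0// sqrtr_sqr.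
by rewrite !dotE !mxE; ring.
Qed.

Lemma enorm_le_sum a : enorm a <= \sum_i `|a i 0|.
Proof.
rewrite sum3; apply: le_of_sqr; first by rewrite !addr_ge0.
rewrite sqr_enorm dotE -!expr2.
rewrite -(real_normK (num_real (a 0 0))) -(real_normK (num_real (a 1 0))).
rewrite -(real_normK (num_real (a 2%:R 0))).
have := normr_ge0 (a 0 0); have := normr_ge0 (a 1 0); have := normr_ge0 (a 2%:R 0); nra.
Qed.

(** The Frobenius norm, used for the gradient: it dominates the operator
    norm and its square is a sum of squares of weak derivatives. *)
Definition frob G : R := Num.sqrt (\sum_i \sum_j G i j ^+ 2).

Lemma frob_ge0 G : 0 <= frob G. Proof. exact: sqrtr_ge0. Qed.
Hint Resolve frob_ge0 : core.

Lemma sqr_frob G : frob G ^+ 2 = \sum_i \sum_j G i j ^+ 2.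
Proof.
by rewrite sqr_sqrtr// sumr_ge0// => i _; rewrite sumr_ge0// => j _; rewrite sqr_ge0.
Qed.

(** The curl as a function of the gradient matrix. *)
Definition curl_mx G : 'cV[R]_3 :=
  \col_(i < 3) (G (i + 2%:R) (i + 1) - G (i + 1) (i + 2%:R)).
Definition sym_mx G : 'M[R]_3 := 2^-1 *: (G + G^T).

Lemma curl_mx_lin (k : R) G G' : curl_mx (k *: G + G') = k *: curl_mx G + curl_mx G'.
Proof. by apply/colP => i; rewrite !mxE; ring. Qed.

Lemma sym_mx_lin (k : R) G G' : sym_mx (k *: G + G') = k *: sym_mx G + sym_mx G'.
Proof. by apply/matrixP => i j; rewrite !mxE; ring. Qed.

Lemma mxtraceE G : \tr G = G 0 0 + G 1 1 + G 2%:R 2%:R.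
Proof. exact: sum3. Qed.

Lemma frob_sym G : frob (sym_mx G) <= frob G.
Proof.
apply: le_of_sqr => //; rewrite !sqr_frob !sum3 !mxE.
have key (x y : R) : (2^-1 * (x + y)) ^+ 2 + (2^-1 * (y + x)) ^+ 2 <= x ^+ 2 + y ^+ 2.
  by have := sqr_ge0 (x - y); nra.
have diag (x : R) : (2^-1 * (x + x)) ^+ 2 = x ^+ 2 by field.
rewrite !diag; have := key (G 0 1) (G 1 0).
have := key (G 0 2%:R) (G 2%:R 0); have := key (G 1 2%:R) (G 2%:R 1); lra.
Qed.

Lemma enorm_mulmx G a : enorm (G *m a) <= frob G * enorm a.
Proof.
apply: le_of_sqr; first by rewrite mulr_ge0.
rewrite exprMn !sqr_enorm dotE sqr_frob !mxE !sum3 -!expr2.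
have key (x y z p q r : R) :
    (x * p + y * q + z * r) ^+ 2 <= (x ^+ 2 + y ^+ 2 + z ^+ 2) * (p ^+ 2 + q ^+ 2 + r ^+ 2).
  have := sqr_ge0 (x * q - y * p); have := sqr_ge0 (x * r - z * p).
  by have := sqr_ge0 (y * r - z * q); lra.
rewrite dotE -!expr2 !mulrDl !lerD//;
by have := key (G 0 0) (G 0 1) (G 0 2%:R) (a 0 0) (a 1 0) (a 2%:R 0);
 have := key (G 1 0) (G 1 1) (G 1 2%:R) (a 0 0) (a 1 0) (a 2%:R 0);
 have := key (G 2%:R 0) (G 2%:R 1) (G 2%:R 2%:R) (a 0 0) (a 1 0) (a 2%:R 0); lra.
Qed.

(** The three minors are null Lagrangians: their integrals vanish for
    fields that are zero on the boundary. *)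
Lemma frob_curl_tr G : frob G ^+ 2 = (dot (curl_mx G) (curl_mx G) + \tr G ^+ 2) +
  2 * ((G 0 1 * G 1 0 - G 0 0 * G 1 1) + (G 0 2%:R * G 2%:R 0 - G 0 0 * G 2%:R 2%:R) +
       (G 1 2%:R * G 2%:R 1 - G 1 1 * G 2%:R 2%:R)).
Proof. rewrite sqr_frob !sum3 mxtraceE dotE !mxE !ord3_add; ring. Qed.

Lemma enorm_curl_mx G : enorm (curl_mx G) <= 2 * frob G.
Proof.
apply: le_of_sqr; first by rewrite mulr_ge0.
rewrite exprMn sqr_enorm sqr_frob !sum3 dotE !mxE !ord3_add.
have key (x y : R) : (x - y) * (x - y) <= 2 * x ^+ 2 + 2 * y ^+ 2.
  by have := sqr_ge0 (x + y); lra.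
have := key (G 2%:R 1) (G 1 2%:R); have := key (G 0 2%:R) (G 2%:R 0).
have := key (G 1 0) (G 0 1).
have s i j := sqr_ge0 (G i j).
have := s 0 0; have := s 1 1; have := s 2%:R 2%:R; have := s 0 1; have := s 1 0.
have := s 0 2%:R; have := s 2%:R 0; have := s 1 2%:R; have := s 2%:R 1; lra.
Qed.

Lemma tr_le_frob G : `|\tr G| <= 2 * frob G.
Proof.
apply: le_of_sqr; first by rewrite mulr_ge0.
rewrite exprMn real_normK ?num_real// sqr_frob !sum3 mxtraceE.
have s i j := sqr_ge0 (G i j).
have := sqr_ge0 (G 0 0 - G 1 1); have := sqr_ge0 (G 0 0 - G 2%:R 2%:R).
have := sqr_ge0 (G 1 1 - G 2%:R 2%:R).
have := s 0 0; have := s 1 1; have := s 2%:R 2%:R; have := s 0 1; have := s 1 0.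
have := s 0 2%:R; have := s 2%:R 0; have := s 1 2%:R; have := s 2%:R 1; lra.
Qed.
End Pointwise.

(** * Saddle-point problems on finitely spanned spaces *)

Section LinearAlgebra.
Variable R : realType.

(** Function spaces are sets of functions rather than types, so that
    linearity is always relative to such a set. *)
Definition lin_closed (E : lmodType R) (S : set E) :=
  S 0 /\ forall k x y, S x -> S y -> S (k *: x + y).

Lemma lin_closed_prod (E F : lmodType R) (A : set E) (B : set F) :
  lin_closed A -> lin_closed B -> lin_closed [set s : E * F | A s.1 /\ B s.2].
Proof.
move=> [A0 Al] [B0 Bl]; split; first by split.
by move=> k [x q] [y r] [/= ? ?] [/= ? ?]; split; [exact: Al|exact: Bl].
Qed.

Definition linear_on (E : lmodType R) (S : set E) (f : E -> R) :=
  forall k x y, S x -> S y -> f (k *: x + y) = k * f x + f y.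

Lemma linear_on0 (E : lmodType R) (S : set E) (f : E -> R) :
  S 0 -> linear_on S f -> f 0 = 0.
Proof.
move=> S0 fl; have := fl (-1) 0 0 S0 S0.
by rewrite scaler0 addr0 mulN1r addNr.
Qed.

Lemma lin_closed_sum (E : lmodType R) (S : set E) (I : Type) (r : seq I)
    (w : I -> R) (v : I -> E) : lin_closed S -> (forall i, S (v i)) ->
  S (\sum_(i <- r) w i *: v i).
Proof.
move=> [S0 SL] Sv; elim: r => [|i r IH]; first by rewrite big_nil.
by rewrite big_cons; exact: SL.
Qed.

Lemma linear_on_sum (E : lmodType R) (S : set E) (f : E -> R) (I : Type)
    (r : seq I) (w : I -> R) (v : I -> E) : lin_closed S -> linear_on S f ->
  (forall i, S (v i)) ->
  f (\sum_(i <- r) w i *: v i) = \sum_(i <- r) w i * f (v i).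
Proof.
move=> Sl fl Sv; elim: r => [|i r IH].
  by rewrite !big_nil; case: Sl => S0 _; exact: linear_on0 fl.
by rewrite !big_cons fl// ?IH//; exact: lin_closed_sum.
Qed.

Section FiniteSpan.
Variables (E : lmodType R) (S : set E) (N : nat) (rep : E -> 'rV[R]_N -> Prop).
Hypothesis Sl : lin_closed S.
Hypothesis repl : forall k s t c d, S s -> S t -> rep s c -> rep t d ->
  rep (k *: s + t) (k *: c + d).
Hypothesis repS : forall s, S s -> exists c, rep s c.

Let reach (c : 'rV[R]_N) := exists2 s, S s & rep s c.

Let rep0 : rep 0 0.
Proof.
have [S0 _] := Sl; have [c rc] := repS S0.
have := repl (-1) S0 S0 rc rc.
by rewrite scaler0 addr0 scaleN1r addNr.
Qed.

Let rep_sum n (w : 'I_n -> R) (v : 'I_n -> E) (c : 'I_n -> 'rV[R]_N) :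
  (forall i, S (v i)) -> (forall i, rep (v i) (c i)) ->
  rep (\sum_i w i *: v i) (\sum_i w i *: c i).
Proof.
move=> Sv rv; elim: (index_enum _) => [|i r IH].
  by rewrite !big_nil; exact: rep0.
by rewrite !big_cons; apply: repl => //; exact: lin_closed_sum.
Qed.

Let reach_submx m (A : 'M[R]_(m, N)) (c : 'rV[R]_N) :
  (forall i, reach (row i A)) -> (c <= A)%MS -> reach c.
Proof.
move=> rA /submxP[x ->].
have [v hv] := choice (fun i => let: ex_intro2 s a b := rA i in
  ex_intro (fun s => S s /\ rep s (row i A)) s (conj a b)).
exists (\sum_i x 0 i *: v i).
  by apply: lin_closed_sum => // i; case: (hv i).
rewrite mulmx_sum_row; apply: rep_sum => i; by case: (hv i).
Qed.

(** A space whose elements are represented by [N] coordinates is spanned,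
    up to elements with the same coordinates, by finitely many of its own
    elements: lift the rows of a matrix of maximal rank among those with
    attained rows. The representation is a relation, for coordinates that
    only make sense up to null sets. *)
Lemma finite_span : exists n (v : 'I_n -> E), (forall i, S (v i)) /\
  forall s, S s -> exists w : 'I_n -> R, exists c,
    rep s c /\ rep (\sum_i w i *: v i) c.
Proof.
pose P r := `[< exists B : 'M[R]_N, \rank B = r /\ forall i, reach (row i B) >].
have P0 : P 0%N.
  apply/asboolP; exists 0; rewrite mxrank0; split => // i; rewrite row0.
  by exists 0; [case: Sl|exact: rep0].
have Pb r : P r -> (r <= N)%N.
  by move=> /asboolP[B [<- _]]; exact: rank_leq_row.
have [r /asboolP[B [rB hB]] rmax] := ex_maxnP (ex_intro _ 0%N P0) Pb.
have [v hv] := choice (fun i => let: ex_intro2 s a b := hB i in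
  ex_intro (fun s => S s /\ rep s (row i B)) s (conj a b)).
exists N, v; split => [i|s Ss]; first by case: (hv i).
have [c sc] := repS Ss.
(* Adding c to the rows of B cannot increase the maximal rank. *)
have BcB : (B + c <= B)%MS.
  rewrite -(mxrank_leqif_sup (addsmxSl B c)) eqn_leq mxrankS ?addsmxSl// rB.
  apply: rmax; apply/asboolP; exists (B + c)%MS; split => // i.
  apply: (@reach_submx _ (col_mx B c)); last by rewrite -addsmxE row_sub.
  move=> j; case: (splitP j) => [j' E'|j' E'].
    rewrite (_ : j = lshift 1 j'); last exact/val_inj.
    by rewrite rowKu.
  rewrite (_ : j = rshift N j'); last exact/val_inj.
  by rewrite rowKd ord1 row_id; exists s.
have /submxP[w cw] : (c <= B)%MS by apply: submx_trans BcB; exact: addsmxSr.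
exists (fun i => w 0 i), c; split=> //.
rewrite cw mulmx_sum_row; apply: rep_sum => i; by case: (hv i).
Qed.
End FiniteSpan.

(** Fredholm alternative in finite dimension: the right-hand side only has
    to vanish on the kernel of the transposed problem. The family spans
    only up to vectors that the form does not see. *)
Lemma finite_solvable (E : lmodType R) (S : set E) (m : E -> E -> R) (l : E -> R)
    (n : nat) (v : 'I_n -> E) : lin_closed S ->
  (forall t, S t -> linear_on S (m t)) -> (forall s, S s -> linear_on S (m ^~ s)) ->
  linear_on S l -> (forall i, S (v i)) ->
  (forall s, S s -> exists w : 'I_n -> R, let s' := \sum_i w i *: v i in
     [/\ forall t, S t -> m t s = m t s', forall t, S t -> m s t = m s' t & l s = l s']) ->
  (forall s, S s -> (forall t, S t -> m t s = 0) -> l s = 0) ->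
  exists2 t, S t & forall s, S s -> m t s = l s.
Proof.
move=> Sl mr ml ll Sv span nondeg.
pose G : 'M[R]_n := \matrix_(i, j) m (v i) (v j).
pose L : 'rV[R]_n := \row_j l (v j).
have Ssum (w : 'I_n -> R) : S (\sum_i w i *: v i) by exact: lin_closed_sum.
have /submxP[w Lw] : (L <= G)%MS.
  rewrite submxE; apply/eqP/rowP => j; rewrite [RHS]mxE.
  pose k i := cokermx G i j; pose s := \sum_i k i *: v i.
  have vs i : m (v i) s = 0.
    rewrite /s (linear_on_sum _ _ Sl (mr _ (Sv i)) Sv).
    have /matrixP/(_ i j) := mulmx_coker G; rewrite !mxE => E0.
    by rewrite -[RHS]E0; apply: eq_bigr => i' _; rewrite mxE mulrC.
  have ls0 : l s = 0.
    apply: nondeg => [|t St]; first exact: Ssum.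
    have [w [_ tw _]] := span t St.
    rewrite tw; last exact: Ssum.
    rewrite (linear_on_sum _ _ Sl (ml _ (Ssum k)) Sv).
    by rewrite big1// => i _; rewrite vs mulr0.
  rewrite mxE -[RHS]ls0 /s (linear_on_sum _ _ Sl ll Sv).
  by apply: eq_bigr => i _; rewrite mxE mulrC.
exists (\sum_i w 0 i *: v i) => // s Ss.
have [c [sr _ ls]] := span s Ss.
rewrite sr// ls (linear_on_sum _ _ Sl ll Sv) (linear_on_sum _ _ Sl (mr _ (Ssum _)) Sv).
apply: eq_bigr => j _; congr (_ * _).
have /rowP/(_ j) := Lw; rewrite !mxE => ->.
rewrite (linear_on_sum _ _ Sl (ml _ (Sv j)) Sv).
by apply: eq_bigr => i _; rewrite !mxE.
Qed.
End LinearAlgebra.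

Section SaddlePoint.
Variables (R : realType) (X Q : lmodType R).
Variables (SX : set X) (SQ : set Q) (a : X -> X -> R) (b : X -> Q -> R).
Variables (nX : X -> R) (nQ : Q -> R) (M al be : R).
Hypotheses (SXl : lin_closed SX) (SQl : lin_closed SQ).
Hypothesis nX0 : forall x, 0 <= nX x.
Hypothesis nQ0 : forall q, 0 <= nQ q.
Hypothesis nX_lin : forall k x y, SX x -> SX y -> nX (k *: x + y) <= `|k| * nX x + nX y.
Hypothesis nQ_lin : forall k x y, SQ x -> SQ y -> nQ (k *: x + y) <= `|k| * nQ x + nQ y.
Hypothesis a_l : forall y, SX y -> linear_on SX (a ^~ y).
Hypothesis a_r : forall x, SX x -> linear_on SX (a x).
Hypothesis b_l : forall q, SQ q -> linear_on SX (b ^~ q).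
Hypothesis b_r : forall x, SX x -> linear_on SQ (b x).
Hypotheses (M0 : 0 <= M) (al0 : 0 < al) (be0 : 0 < be).
Hypothesis a_bd : forall x y, SX x -> SX y -> `|a x y| <= M * nX x * nX y.
Hypothesis b_bd : forall x q, SX x -> SQ q -> `|b x q| <= M * nX x * nQ q.
Hypothesis a_coer : forall x, SX x -> al * nX x ^+ 2 <= a x x.

(** The inf-sup condition without quotients or suprema: a bound of the
    functional [b _ q] by [L] bounds [q] by [L / be]. *)
Definition inf_sup_on (VX : set X) (VQ : set Q) := forall q (L : R), VQ q -> 0 <= L ->
  (forall x, VX x -> `|b x q| <= L * nX x) -> be * nQ q <= L.

Let c : R := 1 + M / be + be^-1.
Let K : R := 2 * c / al + 1.
(** [K] bounds the primal variable, through [quadratic_bound], and the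
    second summand the multiplier. *)
Definition stab_const : R := K + (1 + M * K) / be.

Let c0 : 0 <= c.
Proof. by rewrite !addr_ge0// ?divr_ge0 ?invr_ge0// ltW. Qed.

Let K1 : 1 <= K.
Proof. by rewrite /K lerDr divr_ge0 ?(ltW al0)// mulr_ge0. Qed.

Lemma stab_const_gt0 : 0 < stab_const.
Proof.
rewrite /stab_const ltr_pwDl ?(lt_le_trans ltr01)//.
by rewrite divr_ge0 ?(ltW be0)// addr_ge0// mulr_ge0// (le_trans ler01).
Qed.

(** Solves the quadratic inequality produced by coercivity, without square
    roots. *)
Let quadratic_bound (n D : R) : 0 <= n -> 0 <= D ->
  al * n ^+ 2 <= c * D * n + c * D ^+ 2 -> n <= K * D.
Proof.
move=> n0 D0 h.
have [nD|nD] := leP n D; first by rewrite (le_trans nD)// ler_peMl.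
have n1 : 0 < n by apply: le_lt_trans nD.
have h1 : c * D * D <= c * D * n by rewrite ler_wpM2l ?mulr_ge0// ltW.
have : al * n <= 2 * c * D.
  by rewrite -(ler_pM2r n1); rewrite !expr2 in h; lra.
rewrite mulrC -ler_pdivlMr// => h2; apply: (le_trans h2).
rewrite (_ : 2 * c * D / al = 2 * c / al * D); last by ring.
by rewrite ler_wpM2r// /K lerDl.
Qed.

(** Brezzi's estimate for a form that is coercive on the whole space:
    testing with the solution bounds the primal variable, the inf-sup
    condition bounds the multiplier. *)
Lemma saddle_stability (VX : set X) (VQ : set Q) x p (F G : R) :
  VX `<=` SX -> VQ `<=` SQ -> inf_sup_on VX VQ -> VX x -> VQ p -> 0 <= F -> 0 <= G ->
  (forall y, VX y -> `|a x y + b y p| <= F * nX y) ->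
  (forall q, VQ q -> `|b x q| <= G * nQ q) ->
  nX x + nQ p <= stab_const * (F + G).
Proof.
move=> VS VT is_ Vx Vp F0 G0 hF hG.
have hp : be * nQ p <= F + M * nX x.
  apply: is_ => // [|y Vy]; first by rewrite addr_ge0// mulr_ge0.
  have := hF y Vy; have := a_bd (VS _ Vx) (VS _ Vy).
  have := ler_normB (a x y + b y p) (a x y); rewrite addrAC subrr add0r.
  by rewrite mulrDl; lra.
have hp' : nQ p <= (F + M * nX x) / be by rewrite ler_pdivlMr// mulrC.
set n := nX x in hp hp' *; set D := F + G.
have n0 : 0 <= n by exact: nX0.
have FD : F <= D by rewrite lerDl.
have GD : G <= D by rewrite lerDr.
have D0 : 0 <= D by rewrite addr_ge0.
have hn : n <= K * D.
  apply: quadratic_bound => //.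
  have := a_coer (VS _ Vx); have := hF x Vx; have := hG p Vp.
  have := ler_norm (a x x + b x p); have := ler_norm (- b x p); rewrite normrN.
  rewrite -/n => h1 h2 h3 h4 h5.
  have e1 : G * nQ p <= D * ((D + M * n) / be).
    apply: ler_pM => //; apply: (le_trans hp').
    by rewrite ler_wpM2r ?invr_ge0 ?(ltW be0)// lerD2r.
  have e2 : F * n <= D * n by rewrite ler_wpM2r.
  have e3 : D * ((D + M * n) / be) = D ^+ 2 / be + M / be * D * n by field; rewrite gt_eqF.
  have e4 : 0 <= be^-1 * D * n by rewrite !mulr_ge0// invr_ge0 ltW.
  have e5 : 0 <= (1 + M / be) * D ^+ 2.
    by rewrite mulr_ge0 ?sqr_ge0// addr_ge0// divr_ge0// ltW.
  by rewrite /c; lra.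
have hq : nQ p <= (1 + M * K) / be * D.
  apply: (le_trans hp'); rewrite mulrAC ler_wpM2r ?invr_ge0 ?(ltW be0)//.
  rewrite mulrDl mul1r lerD// -mulrA ler_wpM2l//.
by rewrite /stab_const; lra.
Qed.

(** The difference to a discrete competitor solves the discrete problem
    with data controlled by the approximation error; conclude by stability
    and the triangle inequality. *)
Lemma saddle_quasi_optimal (VX : set X) (VQ : set Q) x p xh ph y q (l : X -> R) :
  VX `<=` SX -> VQ `<=` SQ -> lin_closed VX -> lin_closed VQ -> inf_sup_on VX VQ ->
  SX x -> SQ p -> VX xh -> VQ ph -> VX y -> VQ q ->
  (forall z, VX z -> a x z + b z p = l z) -> (forall r, VQ r -> b x r = 0) ->
  (forall z, VX z -> a xh z + b z ph = l z) -> (forall r, VQ r -> b xh r = 0) ->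
  nX (x - xh) + nQ (p - ph) <=
    (1 + stab_const * (2 * M)) * (nX (x - y) + nQ (p - q)).
Proof.
move=> VS VT VXl VQl is_ Sx Sp Vxh Vph Vy Vq e1 e2 e3 e4.
have subE (E : lmodType R) (s t : E) : s - t = -1 *: t + s by rewrite scaleN1r addrC.
have [Sxh Sph] := (VS _ Vxh, VT _ Vph).
have [Sy Sq] := (VS _ Vy, VT _ Vq).
have [_ SXc] := SXl; have [_ SQc] := SQl.
have Vz : VX (xh - y) by rewrite subE; case: VXl => _; apply.
have Vr : VQ (ph - q) by rewrite subE; case: VQl => _; apply.
have Sxy : SX (x - y) by rewrite subE; exact: SXc.
have Spq : SQ (p - q) by rewrite subE; exact: SQc.
set E := nX (x - y) + nQ (p - q).
have E0 : 0 <= E by rewrite addr_ge0.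
have aB s t z : SX s -> SX t -> SX z -> a (s - t) z = a s z - a t z.
  by move=> Ss St Sz; rewrite subE (a_l Sz)// mulN1r addrC.
have bB s t z : SX z -> SQ s -> SQ t -> b z (s - t) = b z s - b z t.
  by move=> Sz Ss St; rewrite subE (b_r Sz)// mulN1r addrC.
have bBl s t z : SX s -> SX t -> SQ z -> b (s - t) z = b s z - b t z.
  by move=> Ss St Sz; rewrite subE (b_l Sz)// mulN1r addrC.
have st : nX (xh - y) + nQ (ph - q) <= stab_const * (M * E + M * E).
  apply: (saddle_stability VS VT is_ Vz Vr); rewrite ?mulr_ge0//.
  - move=> z Vz'; have Sz := VS _ Vz'.
    have -> : a (xh - y) z + b z (ph - q) = a (x - y) z + b z (p - q).
      by rewrite !aB// !bB//; have := e1 z Vz'; have := e3 z Vz'; lra.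
    apply: (le_trans (ler_normD _ _)).
    have h1 := a_bd Sxy Sz; have h2 := b_bd Sz Spq.
    by rewrite /E; lra.
  - move=> r Vr'; have Sr := VT _ Vr'.
    have -> : b (xh - y) r = b (x - y) r by rewrite !bBl// e2// e4.
    apply: (le_trans (b_bd Sxy Sr)); rewrite -!mulrA ler_wpM2l// ler_wpM2r//.
    by rewrite /E lerDl.
have t1 : nX (x - xh) <= nX (xh - y) + nX (x - y).
  have -> : x - xh = -1 *: (xh - y) + (x - y).
    by rewrite scaleN1r opprB [RHS]addrC addrA subrK.
  by apply: le_trans (nX_lin _ (VS _ Vz) Sxy) _; rewrite normrN1 mul1r.
have t2 : nQ (p - ph) <= nQ (ph - q) + nQ (p - q).
  have -> : p - ph = -1 *: (ph - q) + (p - q).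
    by rewrite scaleN1r opprB [RHS]addrC addrA subrK.
  by apply: le_trans (nQ_lin _ (VT _ Vr) Spq) _; rewrite normrN1 mul1r.
have -> : (1 + stab_const * (2 * M)) * E = E + stab_const * (M * E + M * E) by ring.
by rewrite /E in st *; lra.
Qed.

(** Both equations of the saddle-point problem at once, so that the
    transposed problem exchanges [s] and [t]. *)
Definition saddle_form (s t : X * Q) : R := a s.1 t.1 + b t.1 s.2 + b s.1 t.2.

(** Existence on a space spanned, up to elements of zero norm, by finitely
    many vectors: the transposed problem has the same structure, so that
    its kernel consists of elements of zero norm, on which the load
    vanishes. *)
Lemma saddle_solvable (VX : set X) (VQ : set Q) (l : X -> R) (F : R)
    (n : nat) (v : 'I_n -> X * Q) :
  VX `<=` SX -> VQ `<=` SQ -> lin_closed VX -> lin_closed VQ -> inf_sup_on VX VQ ->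
  linear_on SX l -> 0 <= F -> (forall y, SX y -> `|l y| <= F * nX y) ->
  (forall i, VX (v i).1 /\ VQ (v i).2) ->
  (forall x q, VX x -> VQ q -> exists w : 'I_n -> R,
     let s := \sum_i w i *: v i in nX (x - s.1) = 0 /\ nQ (q - s.2) = 0) ->
  exists x p, [/\ VX x, VQ p, forall y, VX y -> a x y + b y p = l y &
    forall q, VQ q -> b x q = 0].
Proof.
move=> VS VT VXl VQl is_ ll F0 l_bd Vv span.
have [VX0 _] := VXl; have [VQ0 _] := VQl.
have subE (E : lmodType R) (s t : E) : s - t = -1 *: t + s by rewrite scaleN1r addrC.
pose S : set (X * Q) := [set s | VX s.1 /\ VQ s.2].
have Sl : lin_closed S by exact: lin_closed_prod.
have m_r t : S t -> linear_on S (saddle_form t).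
  move=> [/VS t1 /VT t2] k x y [/VS x1 /VT x2] [/VS y1 /VT y2].
  by rewrite /saddle_form /= a_r// b_l// b_r//; ring.
have m_l t : S t -> linear_on S (saddle_form ^~ t).
  move=> [/VS t1 /VT t2] k x y [/VS x1 /VT x2] [/VS y1 /VT y2].
  by rewrite /saddle_form /= a_l// b_l// b_r//; ring.
have l_S : linear_on S (fun s => l s.1).
  by move=> k x y [/VS x1 _] [/VS y1 _]; rewrite /= ll.
have null0 s : S s -> nX s.1 = 0 -> nQ s.2 = 0 ->
    [/\ forall t, S t -> saddle_form t s = 0, forall t, S t -> saddle_form s t = 0 & l s.1 = 0].
  move=> [/VS s1 /VT s2] z1 z2.
  have z (r : R) : `|r| <= 0 -> r = 0 by rewrite normr_le0 => /eqP.
  split.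
  - move=> t [/VS t1 /VT t2]; rewrite /saddle_form.
    have := a_bd t1 s1; have := b_bd s1 t2; have := b_bd t1 s2.
    by rewrite z1 z2 !mulr0 mul0r => /z -> /z -> /z ->; rewrite !addr0.
  - move=> t [/VS t1 /VT t2]; rewrite /saddle_form.
    have := a_bd s1 t1; have := b_bd s1 t2; have := b_bd t1 s2.
    by rewrite z1 z2 !mulr0 !mul0r => /z -> /z -> /z ->; rewrite !addr0.
  - by have := l_bd _ s1; rewrite z1 mulr0 => /z.
have [] := @finite_solvable R _ S saddle_form (fun s => l s.1) n v Sl m_r m_l l_S.
- by move=> i; have := Vv i.
- move=> s Ss; have [Ss1 Ss2] := Ss; have [w /= [z1 z2]] := span _ _ Ss1 Ss2.
  exists w; set s' := \sum_i _ in z1 z2 *.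
  have Ss' : S s' by apply: lin_closed_sum => // i; have := Vv i.
  have Sd : S (s - s') by rewrite subE; case: Sl => _; apply.
  have [d1 d2 d3] := null0 _ Sd z1 z2.
  have sE : s = 1 *: (s - s') + s' by rewrite scale1r subrK.
  split.
  + by move=> t St; rewrite {1}sE m_r// d1// mulr0 add0r.
  + by move=> t St; rewrite {1}sE m_l// d2// mulr0 add0r.
  + by rewrite {1}sE l_S// d3 mulr0 add0r.
- move=> s Ss h; have [s1 s2] := Ss; have [S1 S2] := (VS _ s1, VT _ s2).
  have b0 r : VQ r -> b s.1 r = 0.
    move=> Vr; have := h (0, r) (conj VX0 Vr); rewrite /saddle_form /=.
    rewrite (linear_on0 (VS _ VX0) (a_l S1)) (linear_on0 (VS _ VX0) (b_l S2)).
    by rewrite add0r addr0.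
  (* Testing with (s.1, 0), coercivity kills the primal part. *)
  have z1 : nX s.1 = 0.
    have := h (s.1, 0) (conj s1 VQ0); rewrite /saddle_form /= !b0// !addr0 => e.
    have := a_coer S1; rewrite e pmulr_rle0// => e2.
    by apply/eqP; rewrite -sqrf_eq0 eq_le e2 sqr_ge0.
  have z2 : nQ s.2 = 0.
    apply: le_anti; rewrite nQ0 andbT -(ler_pM2l be0) mulr0; apply: is_ => // y Vy.
    have := h (y, 0) (conj Vy VQ0); rewrite /saddle_form /= (linear_on0 (VT _ VQ0) (b_r S1)) addr0.
    have := a_bd (VS _ Vy) S1; rewrite z1 mulr0 normr_le0 => /eqP ->.
    by rewrite add0r => ->; rewrite normr0 mul0r.
  by have [] := null0 s Ss z1 z2.
move=> t [t1 t2] ht; have [T1 T2] := (VS _ t1, VT _ t2).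
exists t.1, t.2; split => // [y Vy|q Vq].
  have := ht (y, 0) (conj Vy VQ0); rewrite /saddle_form /=.
  by rewrite (linear_on0 (VT _ VQ0) (b_r T1)) addr0.
have := ht (0, q) (conj VX0 Vq); rewrite /saddle_form /=.
rewrite (linear_on0 (VS _ VX0) (a_r T1)) (linear_on0 (VS _ VX0) (b_l T2)).
by rewrite (linear_on0 (VS _ VX0) ll) !add0r.
Qed.
End SaddlePoint.

(** * Measurable fields of vectors and matrices *)

Section VectorFields.
Variable R : realType.

Section Fields.
Variable Omega : set (pt R).
Hypothesis oO : open Omega.
Let mO : measurable (Omega : set (mpt R)) := meas_open oO.
Local Notation mfun := (measurable_fun (Omega : set (mpt R))).
Local Notation sqO := (sqi leb3 Omega).
Local Notation n0 := (nrm leb3 Omega).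

Definition mfield m n (V : pt R -> 'M[R]_(m, n)) := forall i j, mfun (fun x => V x i j).

Lemma meas_dot (v w : pt R -> 'cV[R]_3) : mfield v -> mfield w -> mfun (fun x => dot (v x) (w x)).
Proof.
by move=> mv mw; apply: measurable_sum => i; apply: measurable_funM; [exact: mv|exact: mw].
Qed.

Lemma meas_sqrt (f : pt R -> R) : mfun f -> mfun (fun x => Num.sqrt (f x)).
Proof.
move=> mf; apply: (measurableT_comp _ mf).
by apply: continuous_measurable_fun; exact: sqrt_continuous.
Qed.

Lemma meas_enorm (v : pt R -> 'cV[R]_3) : mfield v -> mfun (fun x => enorm (v x)).
Proof. by move=> mv; apply: meas_sqrt; exact: meas_dot. Qed.

Lemma meas_frob (G : pt R -> 'M[R]_3) : mfield G -> mfun (fun x => frob (G x)).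
Proof.
move=> mG; apply: meas_sqrt; apply: measurable_sum => i; apply: measurable_sum => j.
by apply: measurable_funX; exact: mG.
Qed.

Lemma meas_mulmx m n p (A : pt R -> 'M[R]_(m, n)) (B : pt R -> 'M[R]_(n, p)) :
  mfield A -> mfield B -> mfield (fun x => A x *m B x).
Proof.
move=> mA mB i j; under eq_fun do rewrite mxE.
by apply: measurable_sum => l; apply: measurable_funM; [exact: mA|exact: mB].
Qed.

Lemma meas_det n (A : pt R -> 'M[R]_n) : mfield A -> mfun (fun x => \det (A x)).
Proof.
move=> mA; apply: measurable_sum => s; apply: measurable_funM => //.
by apply: measurable_prod => i _; exact: mA.
Qed.

Lemma meas_inv (f : pt R -> R) : mfun f -> mfun (fun x => (f x)^-1).
Proof.
move=> mf.
have -> : (fun x => (f x)^-1) = (fun x => f x * (f x ^+ 2) `^ (-1)).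
  apply/funext => x; rewrite powR_inv1 ?sqr_ge0//.
  have [->|f0] := eqVneq (f x) 0; first by rewrite invr0 mul0r.
  by rewrite expr2 invfM mulVKf.
apply: measurable_funM => //.
apply: (measurableT_comp (measurable_powR _)); exact: measurable_funX.
Qed.

(** The inverse of a matrix is its cofactor formula where the determinant
    does not vanish, and the matrix itself elsewhere; the single formula
    below covers both cases. *)
Lemma meas_invmx n (A : pt R -> 'M[R]_n) : mfield A -> mfield (fun x => invmx (A x)).
Proof.
move=> mA i j; have md := meas_det mA.
have -> : (fun x => invmx (A x) i j) = (fun x => (\det (A x))^-1 * cofactor (A x) j i +
   (1 + -1 * (\det (A x) * (\det (A x))^-1)) * A x i j).
  apply/funext => x; rewrite /invmx unitmxE unitfE.
  have [->|d0] := eqVneq (\det (A x)) 0 => /=.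
    by rewrite invr0 mul0r add0r mul0r mulr0 addr0 mul1r.
  by rewrite !mxE mulfV// mulr1 addrN mul0r addr0.
apply: measurable_funD; apply: measurable_funM.
- exact: meas_inv.
- apply: measurable_funM => //; apply: meas_det => k l.
  by under eq_fun do rewrite !mxE; exact: mA.
- apply: measurable_funD => //; apply: measurable_funM => //.
  by apply: measurable_funM => //; exact: meas_inv.
- exact: mA.
Qed.

Lemma sqi_enorm (v : pt R -> 'cV[R]_3) :
  (forall i, sqO (fun x => v x i 0)) -> sqO (fun x => enorm (v x)).
Proof.
move=> hv; split; first by apply: meas_enorm => i j; rewrite ord1; case: (hv i).
have -> : (fun x => enorm (v x) ^+ 2) = (fun x => (v x 0 0 ^+ 2 + v x 1 0 ^+ 2) + v x 2%:R 0 ^+ 2).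
  by apply/funext => x; rewrite sqr_enorm dotE.
by do !apply: (intgD mO); [case: (hv 0)|case: (hv 1)|case: (hv 2%:R)].
Qed.

Lemma norm0vE v : norm0v Omega v = n0 (fun x => enorm (v x)).
Proof. exact: norm0E. Qed.

(** The field is only required to agree almost everywhere with a
    combination, as happens for weak derivatives. *)
Lemma norm0v_lin (k : R) (v w z : pt R -> 'cV[R]_3) :
  (forall i, sqO (fun x => v x i 0)) -> (forall i, sqO (fun x => w x i 0)) ->
  mfield z -> ae_eq leb3 Omega z (fun x => k *: v x + w x) ->
  norm0v Omega z <= `|k| * norm0v Omega v + norm0v Omega w.
Proof.
move=> hv hw mz zE; rewrite !norm0vE.
have sv := sqi_enorm hv; have sw := sqi_enorm hw.
have sS := sqiD mO (sqiZ mO `|k| sv) sw.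
rewrite -{1}(normr_id k) -(nrmZ mO)//.
apply: le_trans (nrmD mO (sqiZ mO `|k| sv) sw).
apply: (nrm_le mO) => //; first exact: meas_enorm.
by move: zE; apply: filterS => x /[apply] ->; rewrite ger0_norm ?enorm_ge0// enorm_lin.
Qed.
End Fields.
End VectorFields.

(** * The velocity-vorticity space and the div-curl identity *)

Section States.
Variable R : realType.

Local Notation vfield := (pt R -> 'cV[R]_3).
Local Notation state := (vfield * vfield)%type.
Local Notation jet := ('cV[R]_3 * 'cV[R]_3 * 'M[R]_3)%type.

(** All the integrands are bilinear in the values of the velocity, the
    vorticity and the velocity gradient; such a triple is called a jet,
    and this is its norm. *)
Definition jn (j : jet) : R := enorm j.1.1 + enorm j.1.2 + frob j.2.

(** Pointwise reasoning under an almost-everywhere quantifier over the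
    space. *)
Lemma ae1 (P S : pt R -> Prop) :
  {ae leb3, forall x : mpt R, P x} -> (forall x, P x -> S x) -> {ae leb3, forall x : mpt R, S x}.
Proof.
move=> hp h; have F := ae_filter_ringOfSetsType (@leb3 R).
by apply: filterS hp => x p; exact: h p.
Qed.

Lemma ae2 (P Q S : pt R -> Prop) :
  {ae leb3, forall x : mpt R, P x} -> {ae leb3, forall x : mpt R, Q x} ->
  (forall x, P x -> Q x -> S x) -> {ae leb3, forall x : mpt R, S x}.
Proof.
move=> hp hq h; have F := ae_filter_ringOfSetsType (@leb3 R).
by apply: filterS2 hp hq => x p q; exact: h p q.
Qed.

Lemma ae3 (P Q U S : pt R -> Prop) :
  {ae leb3, forall x : mpt R, P x} -> {ae leb3, forall x : mpt R, Q x} ->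
  {ae leb3, forall x : mpt R, U x} ->
  (forall x, P x -> Q x -> U x -> S x) -> {ae leb3, forall x : mpt R, S x}.
Proof.
move=> hp hq hu h; have F := ae_filter_ringOfSetsType (@leb3 R).
by apply: filterS3 hp hq hu => x p q u; exact: h p q u.
Qed.

Section Forms.
Variable Omega : set (pt R).
Hypothesis oO : open Omega.
Let mO : measurable (Omega : set (mpt R)) := meas_open oO.
Local Notation sqO := (sqi leb3 Omega).
Local Notation n0 := (nrm leb3 Omega).

Definition states : set state := [set X | H10v Omega X.1 /\ L2v Omega X.2].

(** A sum rather than a square root of squares: it is equivalent to the
    norm of the theorem and satisfies the triangle inequality at once. *)
Definition state_norm (X : state) : R :=
  norm0v Omega X.1 + norm0v Omega (wcurl Omega X.1) + norm0 Omega (wdiv Omega X.1)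
  + norm0v Omega X.2.

Definition state_jet (X : state) (x : pt R) : jet := (X.1 x, X.2 x, wgradv Omega X.1 x).

Lemma norm0v_ge0 v : 0 <= norm0v Omega v.
Proof. by rewrite norm0vE nrm_ge0. Qed.

Lemma norm0_ge0 q : 0 <= norm0 Omega q.
Proof. by rewrite norm0E nrm_ge0. Qed.

Lemma state_norm_ge0 X : 0 <= state_norm X.
Proof. by rewrite !addr_ge0 ?norm0v_ge0 ?norm0_ge0. Qed.

Lemma ae_all (I : finType) (P : I -> pt R -> Prop) :
  (forall i, {ae leb3, forall x : mpt R, P i x}) -> {ae leb3, forall x : mpt R, forall i, P i x}.
Proof. exact: filter_forall. Qed.

Lemma H10_H1 f : H10 Omega f -> H1 Omega f. Proof. by case. Qed.

Lemma L2v_sqi v : L2v Omega v -> forall i, sqO (fun x => v x i 0).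
Proof. by move=> h i; apply/(L2P oO); exact: h. Qed.

Lemma mfield_L2v v : L2v Omega v -> mfield Omega v.
Proof. by move=> h i j; rewrite ord1; case: (L2v_sqi h i). Qed.

Lemma H10v_L2v u : H10v Omega u -> L2v Omega u.
Proof. by move=> h i; have [[]] := h i. Qed.

Lemma comp_lin (k : R) (u v : vfield) i :
  (fun x => (k *: u + v) x i 0) = (fun x => k * u x i 0 + v x i 0).
Proof. by apply/funext => x; rewrite !mxE. Qed.

Lemma H10v_lin_closed : lin_closed (H10v Omega).
Proof.
split.
  move=> i; rewrite (_ : (fun x => _) = (fun=> 0)); first exact: H10_zero.
  by apply/funext => x; rewrite mxE.
by move=> k u v hu hv i; rewrite comp_lin; exact: H10_lin.
Qed.

Lemma L2v_lin_closed : lin_closed (L2v Omega).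
Proof.
split.
  move=> i; rewrite (_ : (fun x => _) = (fun=> 0)); last by apply/funext => x; rewrite mxE.
  by apply/(L2P oO); exact: sqi0.
move=> k u v hu hv i; rewrite comp_lin; apply/(L2P oO).
by apply: (sqiD mO); [apply: (sqiZ mO)|]; exact: L2v_sqi.
Qed.

Lemma states_lin_closed : lin_closed states.
Proof. exact: lin_closed_prod H10v_lin_closed L2v_lin_closed. Qed.

Lemma wgradv_lin (k : R) (u v : vfield) : H10v Omega u -> H10v Omega v ->
  ae_eq leb3 Omega (wgradv Omega (k *: u + v))
    (fun x => k *: wgradv Omega u x + wgradv Omega v x).
Proof.
move=> hu hv.
have h (ij : 'I_3 * 'I_3) : {ae leb3, forall x : mpt R, Omega x ->
    wgradv Omega (k *: u + v) x ij.1 ij.2 =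
    (k *: wgradv Omega u x + wgradv Omega v x) ij.1 ij.2}.
  have := wpartial_lin oO ij.2 k (H10_H1 (hu ij.1)) (H10_H1 (hv ij.1)).
  by apply: filterS => x /[apply]; rewrite !mxE comp_lin.
have := ae_all h; apply: filterS => x hx xO.
by apply/matrixP => i j; exact: (hx (i, j)).
Qed.

Lemma wgradv_sqi u i j : H10v Omega u -> sqO (fun x => wgradv Omega u x i j).
Proof.
move=> hu; rewrite (_ : (fun x => _) = wpartial Omega j (fun y => u y i 0)).
  by apply: (H1_wpartial_sqi oO); exact: H10_H1.
by apply/funext => x; rewrite mxE.
Qed.

Lemma mfield_wgradv u : H10v Omega u -> mfield Omega (wgradv Omega u).
Proof. by move=> hu i j; case: (wgradv_sqi i j hu). Qed.

Lemma wcurlE u x : wcurl Omega u x = curl_mx (wgradv Omega u x). Proof. by []. Qed.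

Lemma sqi_frob (G : pt R -> 'M[R]_3) : (forall i j, sqO (fun x => G x i j)) ->
  sqO (fun x => frob (G x)).
Proof.
move=> hG; split; first by apply: meas_frob => i j; case: (hG i j).
have -> : (fun x => frob (G x) ^+ 2) =
  (fun x => (((G x 0 0 ^+ 2 + G x 0 1 ^+ 2) + G x 0 2%:R ^+ 2) +
   ((G x 1 0 ^+ 2 + G x 1 1 ^+ 2) + G x 1 2%:R ^+ 2)) +
   ((G x 2%:R 0 ^+ 2 + G x 2%:R 1 ^+ 2) + G x 2%:R 2%:R ^+ 2)).
  by apply/funext => x; rewrite sqr_frob !sum3.
have I i j : intg leb3 Omega (fun x => G x i j ^+ 2) by case: (hG i j).
by apply: (intgD mO); [apply: (intgD mO)|]; apply: (intgD mO); try exact: I; apply: (intgD mO).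
Qed.

Lemma frob_wgradv_sqi u : H10v Omega u -> sqO (fun x => frob (wgradv Omega u x)).
Proof. by move=> hu; apply: sqi_frob => i j; exact: wgradv_sqi. Qed.

Lemma wcurl_sqi u i : H10v Omega u -> sqO (fun x => wcurl Omega u x i 0).
Proof.
move=> hu; have g k l := wgradv_sqi k l hu.
rewrite (_ : (fun x => _) = (fun x => -1 * wgradv Omega u x (i + 1) (i + 2%:R) +
   wgradv Omega u x (i + 2%:R) (i + 1))).
  by apply: (sqiD mO) => //; exact: (sqiZ mO).
by apply/funext => x; rewrite [LHS]mxE mulN1r addrC.
Qed.

Lemma wdiv_sqi u : H10v Omega u -> sqO (wdiv Omega u).
Proof.
move=> hu; have g k l := wgradv_sqi k l hu.
rewrite (_ : wdiv Omega u = (fun x => (wgradv Omega u x 0 0 + wgradv Omega u x 1 1) +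
   wgradv Omega u x 2%:R 2%:R)).
  by apply: (sqiD mO) => //; exact: (sqiD mO).
by apply/funext => x; rewrite /wdiv mxtraceE.
Qed.

(** A minor of the gradient integrates to zero because the directions of
    the two derivatives can be exchanged. *)
Lemma minor_eq0 u i j : H10v Omega u ->
  \int[leb3]_(x in Omega) (wgradv Omega u x i j * wgradv Omega u x j i
     - wgradv Omega u x i i * wgradv Omega u x j j) = 0.
Proof.
move=> hu; have g k l := wgradv_sqi k l hu.
rewrite RintegralB//; try exact: (sqi_mul mO).
have E k l : (fun x => wgradv Omega u x k l) = wpartial Omega l (fun y => u y k 0).
  by apply/funext => x; rewrite mxE.
have := wpartial_swap oO j i (H10_H1 (hu i)) (hu j).
by rewrite -!E => ->; rewrite subrr.
Qed.

(** Integrate the pointwise identity [frob_curl_tr]: the integrals of the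
    minors vanish. *)
Lemma sqr_nrm_frob u : H10v Omega u ->
  n0 (fun x => frob (wgradv Omega u x)) ^+ 2 =
  norm0v Omega (wcurl Omega u) ^+ 2 + norm0 Omega (wdiv Omega u) ^+ 2.
Proof.
move=> hu; have g k l := wgradv_sqi k l hu.
rewrite norm0vE norm0E !sqr_nrm.
pose m i j x := wgradv Omega u x i j * wgradv Omega u x j i
     - wgradv Omega u x i i * wgradv Omega u x j j.
have Im i j : intg leb3 Omega (m i j).
  rewrite /m (_ : (fun x => _) = (fun x => wgradv Omega u x i j * wgradv Omega u x j i +
    -1 * (wgradv Omega u x i i * wgradv Omega u x j j))).
    by apply: (intgD mO); [|apply: (intgZ mO)]; exact: (sqi_mul mO).
  by apply/funext => x; rewrite mulN1r.
have [_ Ic] := sqi_enorm oO (fun i => wcurl_sqi i hu).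
have [_ Id] := wdiv_sqi hu.
transitivity (\int[leb3]_(x in Omega) ((enorm (wcurl Omega u x) ^+ 2 + wdiv Omega u x ^+ 2) +
   2 * ((m 0 1 x + m 0 2%:R x) + m 1 2%:R x))).
  by apply: eq_Rintegral => x _; rewrite frob_curl_tr sqr_enorm.
have I2 := intgD mO (Im 0 1) (Im 0 2%:R); have I3 := intgD mO I2 (Im 1 2%:R).
have E1 := RintegralD mO (intgD mO Ic Id) (intgZ mO 2 I3).
have E2 := RintegralD mO Ic Id; have E3 := RintegralZl 2 mO I3.
have E4 := RintegralD mO I2 (Im 1 2%:R); have E5 := RintegralD mO (Im 0 1) (Im 0 2%:R).
apply: (etrans E1).
by rewrite E2 E3 E4 E5 /m !minor_eq0// !addr0 mulr0 addr0.
Qed.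

Lemma nrm_frob_le u : H10v Omega u -> n0 (fun x => frob (wgradv Omega u x)) <=
  norm0v Omega (wcurl Omega u) + norm0 Omega (wdiv Omega u).
Proof.
move=> hu; have a0 := norm0v_ge0 (wcurl Omega u); have b0 := norm0_ge0 (wdiv Omega u).
apply: le_of_sqr; first by rewrite addr_ge0.
by rewrite sqr_nrm_frob// sqrrD addrAC lerDl mulrn_wge0// mulr_ge0.
Qed.
End Forms.
End States.

(** * Bilinear forms given by first-order integrands *)

Section Forms.
Variable R : realType.

Local Notation vfield := (pt R -> 'cV[R]_3).
Local Notation state := (vfield * vfield)%type.
Local Notation jet := ('cV[R]_3 * 'cV[R]_3 * 'M[R]_3)%type.

Section BilinearForms.
Variable Omega : set (pt R).
Hypothesis oO : open Omega.
Let mO : measurable (Omega : set (mpt R)) := meas_open oO.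
Local Notation mfun := (measurable_fun (Omega : set (mpt R))).
Local Notation sqO := (sqi leb3 Omega).
Local Notation n0 := (nrm leb3 Omega).
Local Notation SX := (states Omega).
Local Notation jetO := (state_jet Omega).
Local Notation normO := (state_norm Omega).

Lemma state_jet_lin (k : R) X Y : SX X -> SX Y ->
  ae_eq leb3 Omega (jetO (k *: X + Y)) (fun x => k *: jetO X x + jetO Y x).
Proof.
move: X Y => [u w] [v t] [/= hu _] [/= hv _]; have := wgradv_lin oO k hu hv.
by apply: filterS => x /[apply] h; rewrite /state_jet /= h.
Qed.

Definition mjet (j : pt R -> jet) :=
  [/\ mfield Omega (fun x => (j x).1.1), mfield Omega (fun x => (j x).1.2) &
      mfield Omega (fun x => (j x).2)].

Lemma state_jet_meas X : SX X -> mjet (jetO X).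
Proof.
move=> [h1 h2]; split.
- exact: (mfield_L2v oO (H10v_L2v h1)).
- exact: (mfield_L2v oO h2).
- exact: (mfield_wgradv oO h1).
Qed.

Lemma nrm_state_jet X : SX X ->
  sqO (fun x => jn (jetO X x)) /\ n0 (fun x => jn (jetO X x)) <= normO X.
Proof.
move=> [h1 h2].
have s1 := sqi_enorm oO (L2v_sqi oO (H10v_L2v h1)).
have s2 := sqi_enorm oO (L2v_sqi oO h2).
have s3 := frob_wgradv_sqi oO h1.
have s12 := sqiD mO s1 s2.
split; first exact: (sqiD mO s12 s3).
apply: (le_trans (nrmD mO s12 s3)).
have := nrmD mO s1 s2; rewrite -!norm0vE => h12.
apply: (le_trans (lerD h12 (nrm_frob_le oO h1))).
by rewrite /state_norm; lra.
Qed.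

(** A bounded linear dependence on the jet, with coefficients that are
    measurable functions of the point. Both vector factors of each
    integrand of the form [A] are of this kind, so that linearity,
    integrability and boundedness are proved once for all terms. *)
Record linear_coef (L : pt R -> jet -> 'cV[R]_3) (C : R) : Prop := LinearCoef {
  lc_lin : forall x k j j', L x (k *: j + j') = k *: L x j + L x j';
  lc_ge0 : 0 <= C;
  lc_bd : {ae leb3, forall x, Omega x -> forall j, enorm (L x j) <= C * jn j};
  lc_meas : forall j, mjet j -> mfield Omega (fun x => L x (j x)) }.

Definition term (c : pt R -> R) (L1 L2 : pt R -> jet -> 'cV[R]_3) (X Y : state) : R :=
  \int[leb3]_(x in Omega) (c x * dot (L1 x (jetO X x)) (L2 x (jetO Y x))).

Definition bounded_bilinear (T : state -> state -> R) (C : R) :=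
  [/\ 0 <= C,
      forall Y, SX Y -> linear_on SX (T ^~ Y),
      forall X, SX X -> linear_on SX (T X) &
      forall X Y, SX X -> SX Y -> `|T X Y| <= C * normO X * normO Y].

Section OneTerm.
Variables (c : pt R -> R) (L1 L2 : pt R -> jet -> 'cV[R]_3) (C0 C1 C2 : R).
Hypothesis mc : mfun c.
Hypothesis cb : {ae leb3, forall x, Omega x -> `|c x| <= C0}.
Hypotheses (l1 : linear_coef L1 C1) (l2 : linear_coef L2 C2).

Let integrand X Y x := c x * dot (L1 x (jetO X x)) (L2 x (jetO Y x)).

Let integrand_meas X Y : SX X -> SX Y -> mfun (integrand X Y).
Proof.
move=> hX hY; apply: measurable_funM => //; apply: meas_dot.
  by apply: (lc_meas l1); exact: state_jet_meas.
by apply: (lc_meas l2); exact: state_jet_meas.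
Qed.

Let mulE (x y z t s : R) : x * (y * t * (z * s)) = x * y * z * (t * s).
Proof. by ring. Qed.

(** Pointwise the integrand is at most a constant times the product of the
    norms of the two jets, and the L^2 norm of the jet is at most the norm
    of the state by the div-curl identity. *)
Lemma term_bound X Y : SX X -> SX Y ->
  intg leb3 Omega (integrand X Y) /\
  `|term c L1 L2 X Y| <= (`|C0| * C1 * C2) * normO X * normO Y.
Proof.
move=> hX hY.
have [sX nX] := nrm_state_jet hX; have [sY nY] := nrm_state_jet hY.
have c1 := lc_ge0 l1; have c2 := lc_ge0 l2.
have bd : {ae leb3, forall x : mpt R, Omega x ->
    `|integrand X Y x| <= (`|C0| * C1 * C2) * (jn (jetO X x) * jn (jetO Y x))}.
  apply: (ae3 (lc_bd l1) (lc_bd l2) cb) => x h1 h2 h0 xO.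
  have e1 := h1 xO (jetO X x); have e2 := h2 xO (jetO Y x).
  rewrite /integrand normrM.
  have e0 : `|c x| <= `|C0| by apply: le_trans (h0 xO) (ler_norm _).
  have e3 := dot_le (L1 x (jetO X x)) (L2 x (jetO Y x)).
  apply: (le_trans (ler_pM (normr_ge0 _) (normr_ge0 _) e0 (le_trans e3
    (ler_pM (enorm_ge0 _) (enorm_ge0 _) e1 e2)))).
  by rewrite mulE.
have [Ii bi] := int_dominated mO (integrand_meas hX hY) sX sY bd.
split => //; apply: (le_trans bi).
have C0' : 0 <= `|C0| * C1 * C2 by rewrite !mulr_ge0.
rewrite ger0_norm// -[leRHS]mulrA ler_wpM2l//.
by apply: ler_pM => //; exact: nrm_ge0.
Qed.

Lemma term_bilinear : bounded_bilinear (term c L1 L2) (`|C0| * C1 * C2).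
Proof.
have SC := states_lin_closed oO; have [_ SL] := SC.
split.
- by rewrite !mulr_ge0// ?(lc_ge0 l1) ?(lc_ge0 l2).
- move=> Y hY k X X' hX hX'.
  have [I1 _] := term_bound hX hY; have [I2 _] := term_bound hX' hY.
  have E : ae_eq leb3 Omega (integrand (k *: X + X') Y)
      (fun x => k * integrand X Y x + integrand X' Y x).
    have := state_jet_lin k hX hX'; apply: filterS => x /[apply] h.
    by rewrite /integrand h (lc_lin l1) dot_lin_l; ring.
  have m1 := integrand_meas (SL k _ _ hX hX') hY.
  have m2 := intg_meas (intgD mO (intgZ mO k I1) I2).
  apply: (etrans (Rint_ae mO m1 m2 E)).
  apply: (etrans (RintegralD mO (intgZ mO k I1) I2)).
  by congr (_ + _); exact: RintegralZl.
- move=> Y hY k X X' hX hX'.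
  have [I1 _] := term_bound hY hX; have [I2 _] := term_bound hY hX'.
  have E : ae_eq leb3 Omega (integrand Y (k *: X + X'))
      (fun x => k * integrand Y X x + integrand Y X' x).
    have := state_jet_lin k hX hX'; apply: filterS => x /[apply] h.
    by rewrite /integrand h (lc_lin l2) dot_lin_r; ring.
  have m1 := integrand_meas hY (SL k _ _ hX hX').
  have m2 := intg_meas (intgD mO (intgZ mO k I1) I2).
  apply: (etrans (Rint_ae mO m1 m2 E)).
  apply: (etrans (RintegralD mO (intgZ mO k I1) I2)).
  by congr (_ + _); exact: RintegralZl.
- by move=> X Y hX hY; have [] := term_bound hX hY.
Qed.
End OneTerm.

Lemma bb_add T T' C C' : bounded_bilinear T C -> bounded_bilinear T' C' ->
  bounded_bilinear (fun X Y => T X Y + T' X Y) (C + C').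
Proof.
move=> [c0 l r b] [c0' l' r' b']; split; first exact: addr_ge0.
- by move=> Y hY k X X' hX hX'; rewrite l// l'//; ring.
- by move=> Y hY k X X' hX hX'; rewrite r// r'//; ring.
- move=> X Y hX hY; apply: (le_trans (ler_normD _ _)).
  by rewrite !mulrDl lerD// ?b ?b'.
Qed.

Lemma bb_scale (k : R) T C : bounded_bilinear T C ->
  bounded_bilinear (fun X Y => k * T X Y) (`|k| * C).
Proof.
move=> [c0 l r b]; split; first exact: mulr_ge0.
- by move=> Y hY k' X X' hX hX'; rewrite l//; ring.
- by move=> Y hY k' X X' hX hX'; rewrite r//; ring.
- by move=> X Y hX hY; rewrite normrM -!mulrA ler_wpM2l// mulrA b.
Qed.

Lemma bb_flip T C : bounded_bilinear T C -> bounded_bilinear (fun X Y => T Y X) C.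
Proof.
move=> [c0 l r b]; split => //.
by move=> X Y hX hY; rewrite mulrAC b.
Qed.

Lemma jn_ge1 (j : jet) : enorm j.1.1 <= jn j.
Proof. by rewrite /jn -addrA lerDl addr_ge0 ?enorm_ge0 ?frob_ge0. Qed.
Lemma jn_ge2 (j : jet) : enorm j.1.2 <= jn j.
Proof. by rewrite /jn addrAC lerDr addr_ge0 ?enorm_ge0 ?frob_ge0. Qed.
Lemma jn_ge3 (j : jet) : frob j.2 <= jn j.
Proof. by rewrite /jn lerDr addr_ge0 ?enorm_ge0. Qed.

Definition Lvel (x : pt R) (j : jet) : 'cV[R]_3 := j.1.1.
Definition Lvor (x : pt R) (j : jet) : 'cV[R]_3 := j.1.2.
Definition Lcurl (x : pt R) (j : jet) : 'cV[R]_3 := curl_mx j.2.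
(* The divergence is put in a vector so that its square is a dot product,
   as in the other terms. *)
Definition Ldiv (x : pt R) (j : jet) : 'cV[R]_3 := \tr j.2 *: delta_mx 0 0.
Definition Lres (K : pt R -> 'M[R]_3) (x : pt R) (j : jet) : 'cV[R]_3 := invmx (K x) *m j.1.1.
Definition Lstrain (g : vfield) (x : pt R) (j : jet) : 'cV[R]_3 := sym_mx j.2 *m g x.
Definition Lcross (g : vfield) (x : pt R) (j : jet) : 'cV[R]_3 := cross (g x) j.1.1.

Lemma lc_vel : linear_coef Lvel 1.
Proof.
split => //; first by apply: aeW => x _ j; rewrite mul1r jn_ge1.
by move=> j [].
Qed.

Lemma lc_vor : linear_coef Lvor 1.
Proof.
split => //; first by apply: aeW => x _ j; rewrite mul1r jn_ge2.
by move=> j [].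
Qed.

Lemma lc_curl : linear_coef Lcurl 2.
Proof.
split => //; first by move=> x k j j'; exact: curl_mx_lin.
  apply: aeW => x _ j; apply: (le_trans (enorm_curl_mx _)).
  by rewrite ler_wpM2l// jn_ge3.
move=> j [_ _ h] i l; rewrite (_ : (fun x => _) =
  (fun x => (j x).2 (i + 2%:R) (i + 1) + -1 * (j x).2 (i + 1) (i + 2%:R))).
  by apply: measurable_funD => //; apply: measurable_funM => //; exact: h.
by apply/funext => x; rewrite mxE mulN1r.
Qed.

Lemma lc_div : linear_coef Ldiv 2.
Proof.
split => //.
- move=> x k j j'; rewrite /Ldiv /= linearP /=.
  by apply/matrixP => i l; rewrite !mxE; ring.
- apply: aeW => x _ j; rewrite /Ldiv enormZ (_ : enorm (delta_mx 0 0) = 1).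
    by rewrite mulr1; apply: (le_trans (tr_le_frob _)); rewrite ler_wpM2l// jn_ge3.
  by rewrite /enorm dotE !mxE /= !mul0r !addr0 mulr1 sqrtr1.
- move=> j [_ _ h] i l; under eq_fun do rewrite mxE.
  by apply: measurable_funM => //; apply: measurable_sum => m; exact: h.
Qed.

Lemma lc_strain g (C : R) : mfield Omega g ->
  {ae leb3, forall x, Omega x -> enorm (g x) <= C} -> 0 <= C ->
  linear_coef (Lstrain g) C.
Proof.
move=> mg hg C0; split => //.
- by move=> x k j j'; rewrite /Lstrain sym_mx_lin mulmxDl scalemxAl.
- apply: (ae1 hg) => x + xO j => /(_ xO) h; apply: (le_trans (enorm_mulmx _ _)).
  rewrite mulrC; apply: ler_pM; rewrite ?enorm_ge0 ?frob_ge0//.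
  by apply: (le_trans (frob_sym _)); exact: jn_ge3.
- move=> j [_ _ h]; apply: meas_mulmx => // i l.
  under eq_fun do rewrite !mxE; apply: measurable_funM => //.
  by apply: measurable_funD; exact: h.
Qed.

Lemma lc_cross g (C : R) : mfield Omega g ->
  {ae leb3, forall x, Omega x -> enorm (g x) <= C} -> 0 <= C ->
  linear_coef (Lcross g) C.
Proof.
move=> mg hg C0; split => //.
- by move=> x k j j'; apply/matrixP => i l; rewrite !mxE; ring.
- apply: (ae1 hg) => x + xO j => /(_ xO) h; apply: (le_trans (enorm_cross _ _)).
  by apply: ler_pM; rewrite ?enorm_ge0 ?jn_ge1.
- move=> j [h _ _] i l; under eq_fun do rewrite mxE.
  by apply: measurable_funB; apply: measurable_funM; [exact: mg|exact: h|exact: mg|exact: h].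
Qed.

Lemma lc_res (K : pt R -> 'M[R]_3) (C : R) : mfield Omega K ->
  {ae leb3, forall x, Omega x -> forall w : 'cV[R]_3, enorm (invmx (K x) *m w) <= C * enorm w} ->
  0 <= C -> linear_coef (Lres K) C.
Proof.
move=> mK hK C0; split => //.
- by move=> x k j j'; rewrite /Lres mulmxDr scalemxAr.
- apply: (ae1 hK) => x + xO j => /(_ xO) h; apply: (le_trans (h _)).
  by rewrite ler_wpM2l// jn_ge1.
- move=> j [h _ _]; apply: meas_mulmx => //; exact: meas_invmx.
Qed.
End BilinearForms.
End Forms.

(** * Boundedness and coercivity of the velocity-vorticity form *)

Section FormA.
Variable R : realType.

Local Notation vfield := (pt R -> 'cV[R]_3).
Local Notation state := (vfield * vfield)%type.

Lemma dot_sym_mulmx (N : 'M[R]_3) (a b : 'cV[R]_3) : N^T = N ->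
  dot a (N *m b) = dot b (N *m a).
Proof.
move=> /matrixP NT; have s i j : N i j = N j i by have := NT j i; rewrite mxE.
rewrite !dotE !mxE !sum3 (s 1 0) (s 2%:R 0) (s 2%:R 1); ring.
Qed.

(** A symmetric matrix is bounded by any bound of its quadratic form:
    apply the lower bound of the form to [- s *: w + N *m w]. *)
Lemma enorm_sym_mulmx (N : 'M[R]_3) (s : R) (w : 'cV[R]_3) : N^T = N -> 0 < s ->
  (forall w : 'cV[R]_3, 0 <= dot w (N *m w) <= s * enorm w ^+ 2) ->
  enorm (N *m w) <= s * enorm w.
Proof.
move=> NT s0 h; set z := N *m w.
apply: le_of_sqr; first by rewrite mulr_ge0 ?enorm_ge0// ltW.
have /andP[q0 _] := h (- s *: w + z).
have /andP[_ qw] := h w; have /andP[_ qz] := h z.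
have e1 : dot w (N *m z) = enorm z ^+ 2 by rewrite dot_sym_mulmx// sqr_enorm.
have e2 : dot z (N *m w) = enorm z ^+ 2 by rewrite sqr_enorm.
have E : dot (- s *: w + z) (N *m (- s *: w + z)) =
    s ^+ 2 * dot w (N *m w) - 2 * s * enorm z ^+ 2 + dot z (N *m z).
  rewrite mulmxDr -scalemxAr dot_lin_l !dot_lin_r e1 e2; ring.
rewrite exprMn -(ler_pM2l s0); move: q0; rewrite E.
have : s ^+ 2 * dot w (N *m w) <= s ^+ 2 * (s * enorm w ^+ 2).
  by rewrite ler_wpM2l// sqr_ge0.
lra.
Qed.

Section Bounds.
Variable Omega : set (pt R).
Hypothesis oO : open Omega.
Let mO : measurable (Omega : set (mpt R)) := meas_open oO.
Local Notation mfun := (measurable_fun (Omega : set (mpt R))).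

Lemma Lp_meas p (f : pt R -> R) : Lp Omega p f -> mfun f.
Proof.
rewrite /Lp /= inE /Lfun => /andP[]; rewrite !inE /= => mf _.
by apply/measurable_restrictT.
Qed.

Lemma Linfty_bound (f : pt R -> R) : Linfty Omega f ->
  exists M : R, {ae leb3, forall x : mpt R, Omega x -> `|f x| <= M}.
Proof.
rewrite /Lp /= inE /Lfun => /andP[_]; rewrite !inE /= /finite_norm unlock /=.
case: ifPn => [mu0 fin|mu0 _].
  set s := ess_sup _ _ in fin.
  have h := ess_sup_ge (@leb3 R) (abse \o (EFin \o f \_ Omega)); rewrite -/s in h.
  exists (fine s); apply: (ae1 h) => x /= + xO.
  rewrite patchE mem_set//= => hx.
  rewrite -lee_fin fineK// fin_real// fin andbT.
  by apply: lt_le_trans hx; rewrite ltNyr.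
exists 0; have e : leb3 (setT : set (mpt R)) = 0%E.
  by apply/eqP; rewrite eq_le measure_ge0 andbT leNgt.
exists setT; split => //.
Qed.

(** The hypothesis excludes that the real-valued norm is the default value
    given to an infinite one. *)
Lemma Linfty_norm_bound (f : pt R -> R) (M : R) :
  {ae leb3, forall x : mpt R, Omega x -> `|f x| <= M} ->
  0 <= Lp_norm Omega +oo%E f /\
  {ae leb3, forall x : mpt R, Omega x -> `|f x| <= Lp_norm Omega +oo%E f}.
Proof.
move=> fM; rewrite /Lp_norm unlock /=; case: ifPn => [mu0|mu0].
  set s := ess_sup _ _.
  have h := ess_sup_ge (@leb3 R) (abse \o (EFin \o f \_ Omega)); rewrite -/s in h.
  have s0 : (0 <= s)%E by apply: ess_sup_gee => //; apply: nearW => x /=.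
  have sM : (s <= (`|M|)%:E)%E.
    apply/ess_supP; apply: (ae1 fM) => x hx /=.
    rewrite lee_fin patchE; case: ifPn => [|_]; last by rewrite normr0.
    by rewrite inE => /hx /le_trans; apply; exact: ler_norm.
  split; first exact: fine_ge0.
  apply: (ae1 h) => x /= + xO; rewrite patchE mem_set//= => hx.
  rewrite -lee_fin fineK// ge0_fin_numE//.
  by apply: le_lt_trans sM _; rewrite ltry.
split => //; have e : leb3 (setT : set (mpt R)) = 0%E.
  by apply/eqP; rewrite eq_le measure_ge0 andbT leNgt.
exists setT; split => //.
Qed.
End Bounds.

Section Coefficients.
Variables (Omega : set (pt R)) (nu : pt R -> R) (nu0 nu1 : R).
Variables (K : pt R -> 'M[R]_3) (smin smax kappa1 kappa2 : R).
Hypothesis oO : open Omega.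
Hypothesis hnu : viscosity Omega nu0 nu1 nu.
Hypothesis hK : permeability Omega smin smax K.
Let mO : measurable (Omega : set (mpt R)) := meas_open oO.
Local Notation mfun := (measurable_fun (Omega : set (mpt R))).
Local Notation n0 := (nrm leb3 Omega).
Local Notation jetO := (state_jet Omega).
Local Notation gsup := (grad_sup Omega nu).

Lemma nu_meas : mfun nu.
Proof. by case: hnu => _ [/(Lp_meas oO)]. Qed.

Lemma nu_le : {ae leb3, forall x : mpt R, Omega x -> `|nu x| <= nu1}.
Proof.
case: hnu => n0 _ h; apply: (ae1 h) => x + xO => /(_ xO)/andP[h1 h2].
by rewrite ger0_norm// (le_trans (ltW n0)).
Qed.

Lemma grad_meas : mfield Omega (wgrad Omega nu).
Proof.
case: hnu => _ [_ h] _ i j; under eq_fun do rewrite mxE.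
have [g _ /wpartialP[_ gL _]] := h i.
exact: (locally_L1_meas oO gL).
Qed.

(** The derivatives of the viscosity are first bounded by some constant,
    so that the essential supremum of the gradient is finite and is a
    bound. *)
Lemma grad_bound : 0 <= gsup /\
  {ae leb3, forall x : mpt R, Omega x -> enorm (wgrad Omega nu x) <= gsup}.
Proof.
case: hnu => _ [_ h] _.
have hM i : exists M : R, {ae leb3, forall x : mpt R, Omega x -> `|wpartial Omega i nu x| <= M}.
  have [g /Linfty_bound [M gM] wg] := h i; exists M.
  by apply: (ae2 gM (wpartial_ae oO wg)) => x + + xO => /(_ xO) h1 /(_ xO) ->.
have [M MP] := choice hM.
have bd : {ae leb3, forall x : mpt R, Omega x ->
    `|enorm (wgrad Omega nu x)| <= \sum_i M i}.
  apply: (ae1 (ae_all MP)) => x hx xO; rewrite ger0_norm ?enorm_ge0//.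
  apply: (le_trans (enorm_le_sum _)); apply: ler_sum => i _.
  by rewrite mxE; exact: hx.
have [g0 hg] := Linfty_norm_bound bd; split => //.
by apply: (ae1 hg) => x + xO => /(_ xO); rewrite ger0_norm ?enorm_ge0.
Qed.

Lemma K_meas : mfield Omega K.
Proof. by case: hK => h _ _ _ _ i j; exact: (Lp_meas oO (h i j)). Qed.

Lemma smin_gt0 : 0 < smin. Proof. by case: hK => _ _ _ []. Qed.
Lemma smax_gt0 : 0 < smax. Proof. by case: hK => _ _ _ []. Qed.
Lemma nu0_gt0 : 0 < nu0. Proof. by case: hnu. Qed.

(** The inverse permeability is symmetric, so that the bounds of its
    quadratic form bound its operator norm. *)
Lemma res_bound : {ae leb3, forall x : mpt R, Omega x ->
  forall w : 'cV[R]_3, enorm (invmx (K x) *m w) <= smax * enorm w}.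
Proof.
case: hK => _ sK _ _ qK; apply: (ae2 sK qK) => x + + xO w => /(_ xO) h1 /(_ xO) h2.
apply: enorm_sym_mulmx; first by rewrite trmx_inv h1.
  exact: smax_gt0.
move=> z; have /andP[h3 ->] := h2 z; rewrite andbT; apply: le_trans h3.
by rewrite mulr_ge0 ?sqr_ge0// ltW// smin_gt0.
Qed.

Local Notation tm := (term Omega).
Local Notation g := (wgrad Omega nu).

(** The bilinear form in the order of its definition; the two terms in
    [nu] times vorticity times curl are exchanges of one another and
    cancel on the diagonal. *)
Definition sum_of_terms (X Y : state) : R :=
  tm nu (Lres K) (@Lvel R) X Y + tm nu (@Lvor R) (@Lvor R) X Y
  + (tm nu (@Lvor R) (@Lcurl R) X Y + -1 * tm nu (@Lvor R) (@Lcurl R) Y X)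
  + kappa1 * nu0 * tm (cst 1) (@Lcurl R) (@Lcurl R) X Y
  + kappa2 * tm (cst 1) (@Ldiv R) (@Ldiv R) X Y
  + - (kappa1 * nu0) * tm (cst 1) (@Lvor R) (@Lcurl R) X Y
  + -2 * tm (cst 1) (Lstrain g) (@Lvel R) X Y
  + tm (cst 1) (@Lvor R) (Lcross g) X Y.

Lemma dot_div (s t : R) : dot (s *: delta_mx 0 0) (t *: delta_mx 0 0) = s * t.
Proof. by rewrite dotE !mxE /= !mulr0 !mulr1 !addr0. Qed.

Lemma formA_terms X Y :
  formA Omega nu nu0 K kappa1 kappa2 X.1 X.2 Y.1 Y.2 = sum_of_terms X Y.
Proof.
have e1 L1 L2 Z W : tm (cst 1) L1 L2 Z W =
    \int[leb3]_(x in Omega) dot (L1 x (jetO Z x)) (L2 x (jetO W x)).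
  by apply: eq_Rintegral => x _; rewrite /= mul1r.
have e2 Z W : tm (cst 1) (@Ldiv R) (@Ldiv R) Z W =
    \int[leb3]_(x in Omega) (wdiv Omega Z.1 x * wdiv Omega W.1 x).
  by rewrite e1; apply: eq_Rintegral => x _; rewrite dot_div.
rewrite /sum_of_terms e2 !e1 /formA /term.
by rewrite mulN1r !mulNr !addrA.
Qed.

Lemma formA_bounded : exists2 M : R, 0 <= M &
  bounded_bilinear Omega
    (fun X Y => formA Omega nu nu0 K kappa1 kappa2 X.1 X.2 Y.1 Y.2) M.
Proof.
have [g0 gb] := grad_bound.
have m1 : mfun (cst (1 : R)) by exact: measurable_cst.
have b1 : {ae leb3, forall x : mpt R, Omega x -> `|cst (1 : R) x| <= 1}.
  by apply: aeW => x _ /=; rewrite normr1.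
have lr := lc_res K_meas res_bound (ltW smax_gt0).
have ls := lc_strain grad_meas gb g0.
have lx := lc_cross grad_meas gb g0.
have lu := lc_vel Omega; have lw := lc_vor Omega; have lc := lc_curl Omega.
have ld := lc_div Omega.
have nm := nu_meas; have nb := nu_le.
have T1 := term_bilinear oO nm nb lr lu.
have T2 := term_bilinear oO nm nb lw lw.
have T3 := term_bilinear oO nm nb lw lc.
have T4 := bb_scale (-1) (bb_flip T3).
have T5 := bb_scale (kappa1 * nu0) (term_bilinear oO m1 b1 lc lc).
have T6 := bb_scale kappa2 (term_bilinear oO m1 b1 ld ld).
have T7 := bb_scale (- (kappa1 * nu0)) (term_bilinear oO m1 b1 lw lc).
have T8 := bb_scale (-2) (term_bilinear oO m1 b1 ls lu).
have T9 := term_bilinear oO m1 b1 lw lx.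
have B := bb_add (bb_add (bb_add (bb_add (bb_add (bb_add (bb_add T1 T2) (bb_add T3 T4)) T5) T6) T7) T8) T9.
eexists; last first.
  rewrite (_ : (fun X Y => _) = sum_of_terms); first exact: B.
  by apply/funext => X; apply/funext => Y; rewrite formA_terms.
by case: B.
Qed.
End Coefficients.

Lemma le_of_eq (x y : R) : x = y -> x <= y. Proof. by move=> ->. Qed.

Section CoerciveNumeric.
Variables (nu0 smin k1 k2 gs : R).
Hypotheses (n0 : 0 < nu0) (s0 : 0 < smin).
Hypothesis hg : 4 * gs ^+ 2 / (smin * nu0 ^+ 2) < 1 / 4.
Hypothesis h1 : 1 / 2 < k1 < 3 / 2.
Hypothesis h2 : nu0 / 4 < k2.

(** The four coefficients left in front of the squared norms of velocity,
    vorticity, curl and divergence after Young's inequality; the division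
    by 4 compares the sum of the squares to the square of the sum. *)
Definition coercivity_const : R :=
  Num.min (Num.min (nu0 * smin * (9 / 16)) (nu0 / 12))
          (Num.min (nu0 * (7 / 40)) (k2 - nu0 / 4)) / 4.

Lemma coercivity_const_gt0 : 0 < coercivity_const.
Proof.
by rewrite divr_gt0// !lt_min !divr_gt0 ?mulr_gt0 ?divr_gt0// subr_gt0.
Qed.

Let hg' : 16 * gs ^+ 2 <= smin * nu0 ^+ 2.
Proof.
have : 0 < smin * nu0 ^+ 2 by rewrite mulr_gt0// exprn_gt0.
by move=> p0; move: hg; rewrite ltr_pdivrMr// => /ltW; lra.
Qed.

(** Young's inequality on the three terms of indefinite sign. Of the
    coefficient [nu0 * smin] of [U ^ 2], 1/4 and 3/16 are spent; of the
    coefficient [nu0] of [W ^ 2], 5/6 and 1/12; the gradient costs [nu0 /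
    4] in both [c ^ 2] and [d ^ 2]. What remains of [c ^ 2] is [nu0 * (k1
    - 1/4 - 3/10 * k1 ^ 2)], which is at least 7/40 of [nu0] between the
    two ends of the range of [k1]. *)
Lemma coercive_numeric (U W c d N t1 t2 t7 t8 t9 : R) :
  0 <= U -> 0 <= W -> 0 <= c -> 0 <= d -> 0 <= N -> N ^+ 2 = c ^+ 2 + d ^+ 2 ->
  nu0 * smin * U ^+ 2 <= t1 -> nu0 * W ^+ 2 <= t2 ->
  `|t7| <= W * c -> `|t8| <= gs * (N * U) -> `|t9| <= gs * (W * U) ->
  coercivity_const * (U + c + d + W) ^+ 2 <=
    t1 + t2 + k1 * nu0 * c ^+ 2 + k2 * d ^+ 2 - k1 * nu0 * t7 - 2 * t8 + t9.
Proof.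
move=> U0 W0 c0 d0 N0 NE ht1 ht2; rewrite !ler_norml.
move=> /andP[_ h7] /andP[_ h8] /andP[h9 _].
(* gU completes the squares behind e1 and e2. *)
have gU : 16 * gs ^+ 2 * U ^+ 2 <= smin * nu0 ^+ 2 * U ^+ 2.
  by rewrite ler_wpM2r ?sqr_ge0.
have e1 : 2 * (gs * (N * U)) <= nu0 / 4 * N ^+ 2 + nu0 * smin / 4 * U ^+ 2.
  rewrite -(ler_pM2l n0).
  have := sqr_ge0 (nu0 / 2 * N - 2 * gs * U); lra.
have e2 : gs * (W * U) <= nu0 / 12 * W ^+ 2 + nu0 * smin * (3 / 16) * U ^+ 2.
  rewrite -(ler_pM2l n0).
  have := sqr_ge0 (nu0 / 2 * W - 3 * gs * U); lra.
have /andP[k1l k1u] := h1.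
have k0 : 0 <= k1 * nu0 by rewrite mulr_ge0 ?(ltW n0)//; lra.
have e3 : k1 * nu0 * t7 <= nu0 * (5 / 6 * W ^+ 2 + 3 / 10 * k1 ^+ 2 * c ^+ 2).
  apply: le_trans (ler_wpM2l k0 h7) _.
  rewrite (_ : k1 * nu0 * (W * c) = nu0 * (k1 * (W * c))); last by ring.
  rewrite ler_pM2l//.
  have := sqr_ge0 (W - 3 / 5 * k1 * c); lra.
have e4 : nu0 * (7 / 40) * c ^+ 2 <= nu0 * (k1 - 1 / 4 - 3 / 10 * k1 ^+ 2) * c ^+ 2.
  rewrite ler_wpM2r ?sqr_ge0// ler_pM2l//.
  (* Concave in k1, hence least at the ends of its range. *)
  have : 0 <= (k1 - 1 / 2) * (3 / 2 - k1) by rewrite mulr_ge0// subr_ge0 ltW.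
  by lra.
rewrite /coercivity_const; set al := Num.min _ _.
have [a1 a2 a3 a4] : [/\ al <= nu0 * smin * (9 / 16), al <= nu0 / 12,
    al <= nu0 * (7 / 40) & al <= k2 - nu0 / 4].
  by rewrite /al !ge_min !lexx !orbT.
have al0 : 0 <= al.
  have := coercivity_const_gt0; rewrite /coercivity_const -/al.
  by rewrite pmulr_lgt0 ?invr_gt0// => /ltW.
have q1 := ler_wpM2r (sqr_ge0 U) a1.
have q2 := ler_wpM2r (sqr_ge0 W) a2.
have q3 := ler_wpM2r (sqr_ge0 c) a3.
have q4 := ler_wpM2r (sqr_ge0 d) a4.
have sq : (U + c + d + W) ^+ 2 <= 4 * (U ^+ 2 + c ^+ 2 + d ^+ 2 + W ^+ 2).
  have := sqr_ge0 (U - c); have := sqr_ge0 (U - d); have := sqr_ge0 (U - W).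
  have := sqr_ge0 (c - d); have := sqr_ge0 (c - W); have := sqr_ge0 (d - W); lra.
have q5 := ler_wpM2l al0 sq.
rewrite NE in e1; lra.
Qed.
End CoerciveNumeric.

Section Coercivity.
Variables (Omega : set (pt R)) (nu : pt R -> R) (nu0 nu1 : R).
Variables (K : pt R -> 'M[R]_3) (smin smax kappa1 kappa2 : R).
Hypothesis oO : open Omega.
Hypothesis hnu : viscosity Omega nu0 nu1 nu.
Hypothesis hK : permeability Omega smin smax K.
Hypothesis hgrad : 4 * grad_sup Omega nu ^+ 2 / (smin * nu0 ^+ 2) < 1 / 4.
Hypothesis hkappa1 : 1 / 2 < kappa1 < 3 / 2.
Hypothesis hkappa2 : nu0 / 4 < kappa2.
Let mO : measurable (Omega : set (mpt R)) := meas_open oO.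
Local Notation tm := (term Omega).
Local Notation n0 := (nrm leb3 Omega).

(** Each term of the form is bounded by, or equal to, the quantity that
    [coercive_numeric] expects. *)
Lemma formA_coercive X : states Omega X ->
  coercivity_const nu0 smin kappa2 * state_norm Omega X ^+ 2 <=
  formA Omega nu nu0 K kappa1 kappa2 X.1 X.2 X.1 X.2.
Proof.
move=> hX; have [hu hw] := hX.
have su := sqi_enorm oO (L2v_sqi oO (H10v_L2v hu)).
have sw := sqi_enorm oO (L2v_sqi oO hw).
have sc := sqi_enorm oO (fun i => wcurl_sqi oO i hu).
have sd := wdiv_sqi oO hu.
have sN := frob_wgradv_sqi oO hu.
have [g0 gb] := grad_bound oO hnu.
have lr := lc_res (K_meas oO hK) (res_bound hK) (ltW (smax_gt0 hK)).
have ls := lc_strain (grad_meas oO hnu) gb g0.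
have lx := lc_cross (grad_meas oO hnu) gb g0.
have lu := lc_vel Omega; have lw := lc_vor Omega; have lc := lc_curl Omega.
have m1 : measurable_fun (Omega : set (mpt R)) (cst (1 : R)) by exact: measurable_cst.
have b1 : {ae leb3, forall x : mpt R, Omega x -> `|cst (1 : R) x| <= 1}.
  by apply: aeW => x _ /=; rewrite normr1.
have nm := nu_meas oO hnu; have nb := nu_le hnu.
have [_ _ nuP] := hnu; have [_ _ _ _ qK] := hK.
have np := nu0_gt0 hnu.
have I1 := (term_bound oO nm nb lr lu hX hX).1.
have I2 := (term_bound oO nm nb lw lw hX hX).1.
have I7 := (term_bound oO m1 b1 lw lc hX hX).1.
have I8 := (term_bound oO m1 b1 ls lu hX hX).1.
have I9 := (term_bound oO m1 b1 lw lx hX hX).1.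
have T1 : nu0 * smin * norm0v Omega X.1 ^+ 2 <= tm nu (Lres K) (@Lvel R) X X.
  rewrite norm0vE sqr_nrm; have E := RintegralZl (nu0 * smin) mO su.2.
  apply: le_trans (le_of_eq (esym E)) _.
  apply: (Rint_le mO (intgZ mO _ su.2) I1).
  apply: (ae2 nuP qK) => x + + xO => /(_ xO)/andP[h1 _] /(_ xO) /(_ (X.1 x))/andP[h2 _].
  rewrite /Lres /Lvel /= dotC -mulrA; apply: ler_pM => //; first exact: ltW.
  by rewrite mulr_ge0 ?sqr_ge0// ltW// (smin_gt0 hK).
have T2 : nu0 * norm0v Omega X.2 ^+ 2 <= tm nu (@Lvor R) (@Lvor R) X X.
  rewrite norm0vE sqr_nrm; have E := RintegralZl nu0 mO sw.2.
  apply: le_trans (le_of_eq (esym E)) _.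
  apply: (Rint_le mO (intgZ mO _ sw.2) I2).
  apply: (ae1 nuP) => x + xO => /(_ xO)/andP[h1 _].
  by rewrite /Lvor /= sqr_enorm; apply: ler_wpM2r h1; exact: dot_ge0.
have T5 : tm (cst 1) (@Lcurl R) (@Lcurl R) X X = norm0v Omega (wcurl Omega X.1) ^+ 2.
  rewrite norm0vE sqr_nrm; apply: eq_Rintegral => x _.
  by rewrite sqr_enorm /= mul1r.
have T6 : tm (cst 1) (@Ldiv R) (@Ldiv R) X X = norm0 Omega (wdiv Omega X.1) ^+ 2.
  rewrite norm0E sqr_nrm; apply: eq_Rintegral => x _.
  by rewrite /= mul1r dot_div expr2.
have T7 : `|tm (cst 1) (@Lvor R) (@Lcurl R) X X| <=
    norm0v Omega X.2 * norm0v Omega (wcurl Omega X.1).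
  have [|_] := @int_dominated _ _ _ leb3 Omega mO _ _ _ 1 (intg_meas I7) sw sc.
    apply: aeW => x _; rewrite /= !mul1r; exact: dot_le.
  by rewrite normr1 mul1r -!norm0vE.
have T8 : `|tm (cst 1) (Lstrain (wgrad Omega nu)) (@Lvel R) X X| <=
    grad_sup Omega nu * (n0 (fun x => frob (wgradv Omega X.1 x)) * norm0v Omega X.1).
  have [|_] := @int_dominated _ _ _ leb3 Omega mO _ _ _ (grad_sup Omega nu) (intg_meas I8) sN su.
    apply: (ae1 gb) => x + xO => /(_ xO) h; rewrite /= !mul1r.
    apply: (le_trans (dot_le _ _)); rewrite mulrA; apply: ler_pM; rewrite ?enorm_ge0//.
    apply: (le_trans (enorm_mulmx _ _)); rewrite mulrC.
    by apply: ler_pM; rewrite ?enorm_ge0 ?frob_ge0// frob_sym.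
  by rewrite (ger0_norm g0) -norm0vE.
have T9 : `|tm (cst 1) (@Lvor R) (Lcross (wgrad Omega nu)) X X| <=
    grad_sup Omega nu * (norm0v Omega X.2 * norm0v Omega X.1).
  have [|_] := @int_dominated _ _ _ leb3 Omega mO _ _ _ (grad_sup Omega nu) (intg_meas I9) sw su.
    apply: (ae1 gb) => x + xO => /(_ xO) h; rewrite /= !mul1r.
    apply: (le_trans (dot_le _ _)); rewrite mulrCA; apply: ler_pM; rewrite ?enorm_ge0//.
    by apply: (le_trans (enorm_cross _ _)); rewrite ler_wpM2r ?enorm_ge0.
  by rewrite (ger0_norm g0) -!norm0vE.
have num := coercive_numeric np (smin_gt0 hK) hgrad hkappa1 hkappa2
  (norm0v_ge0 Omega X.1) (norm0v_ge0 Omega X.2) (norm0v_ge0 Omega _) (norm0_ge0 Omega _)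
  (nrm_ge0 _ _ _) (sqr_nrm_frob oO hu) T1 T2 T7 T8 T9.
rewrite formA_terms; apply: (le_trans num).
rewrite /sum_of_terms T5 T6 mulN1r subrr addr0 !mulNr.
by rewrite lexx.
Qed.
End Coercivity.
End FormA.

(** * The divergence pairing, the load, and comparison of norms *)

Section OtherForms.
Variable R : realType.

Local Notation vfield := (pt R -> 'cV[R]_3).
Local Notation state := (vfield * vfield)%type.

Lemma add4_le (k a1 a2 a3 a4 b1 b2 b3 b4 x1 x2 x3 x4 : R) :
  x1 <= k * a1 + b1 -> x2 <= k * a2 + b2 -> x3 <= k * a3 + b3 -> x4 <= k * a4 + b4 ->
  x1 + x2 + x3 + x4 <= k * (a1 + a2 + a3 + a4) + (b1 + b2 + b3 + b4).
Proof. by move=> *; lra. Qed.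

Lemma le4_3 (a b c d : R) : 0 <= c -> 0 <= a -> 0 <= b -> 0 <= d -> c <= a + b + c + d.
Proof. by move=> *; lra. Qed.

Lemma le4_1 (a b c d : R) : 0 <= a -> 0 <= b -> 0 <= c -> 0 <= d -> a <= a + b + c + d.
Proof. by move=> *; lra. Qed.

Lemma le3_mul (a b c d t : R) : a <= t -> b <= t -> c <= t -> a + b + c + d <= 3 * t + d.
Proof. by move=> *; lra. Qed.

Lemma sumsq_le (a b c d : R) : 0 <= a -> 0 <= b -> 0 <= c -> 0 <= d ->
  a ^+ 2 + b ^+ 2 + c ^+ 2 + d ^+ 2 <= (a + b + c + d) ^+ 2.
Proof. by move=> *; nra. Qed.

Section Couplings.
Variable Omega : set (pt R).
Hypothesis oO : open Omega.
Let mO : measurable (Omega : set (mpt R)) := meas_open oO.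
Local Notation n0 := (nrm leb3 Omega).
Local Notation SX := (states Omega).
Local Notation normO := (state_norm Omega).

Lemma wdiv_lin (k : R) (u v : vfield) : H10v Omega u -> H10v Omega v ->
  ae_eq leb3 Omega (wdiv Omega (k *: u + v)) (fun x => k * wdiv Omega u x + wdiv Omega v x).
Proof.
move=> hu hv; apply: (ae1 (wgradv_lin oO k hu hv)) => x + xO => /(_ xO) h.
by rewrite /wdiv h linearP.
Qed.

Lemma wcurl_lin (k : R) (u v : vfield) : H10v Omega u -> H10v Omega v ->
  ae_eq leb3 Omega (wcurl Omega (k *: u + v)) (fun x => k *: wcurl Omega u x + wcurl Omega v x).
Proof.
move=> hu hv; apply: (ae1 (wgradv_lin oO k hu hv)) => x + xO => /(_ xO) h.
by rewrite !wcurlE h curl_mx_lin.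
Qed.

Lemma mfield_wcurl u : H10v Omega u -> mfield Omega (wcurl Omega u).
Proof. by move=> hu i j; rewrite ord1; case: (wcurl_sqi oO i hu). Qed.

Lemma state_norm_lin (k : R) X Y : SX X -> SX Y ->
  normO (k *: X + Y) <= `|k| * normO X + normO Y.
Proof.
move: X Y => [u w] [v t] [/= hu hw] [/= hv ht].
have [_ hl] := H10v_lin_closed oO; have [_ ll] := L2v_lin_closed oO.
have huv := hl k u v hu hv; have hwt := ll k w t hw ht.
have fieldE (p q : vfield) : ae_eq leb3 Omega (k *: p + q) (fun x => k *: p x + q x).
  by apply: aeW.
have n1 := norm0v_lin oO (L2v_sqi oO (H10v_L2v hu)) (L2v_sqi oO (H10v_L2v hv))
  (mfield_L2v oO (H10v_L2v huv)) (fieldE u v).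
have n2 := norm0v_lin oO (fun i => wcurl_sqi oO i hu) (fun i => wcurl_sqi oO i hv)
  (mfield_wcurl huv) (wcurl_lin k hu hv).
have n4 := norm0v_lin oO (L2v_sqi oO hw) (L2v_sqi oO ht)
  (mfield_L2v oO hwt) (fieldE w t).
have n3 : norm0 Omega (wdiv Omega (k *: u + v)) <=
    `|k| * norm0 Omega (wdiv Omega u) + norm0 Omega (wdiv Omega v).
  have su := wdiv_sqi oO hu; have sv := wdiv_sqi oO hv.
  have sk := sqiZ mO k su; have sS := sqiD mO sk sv.
  have E3 := nrm_ae mO (wdiv_sqi oO huv).1 sS.1 (wdiv_lin k hu hv).
  have T3 := nrmD mO sk sv; rewrite (nrmZ mO k su) in T3.
  by rewrite !norm0E; exact: le_trans (le_of_eq E3) T3.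
exact: add4_le n1 n2 n3 n4.
Qed.

Lemma L2_lin_closed : lin_closed (L2 Omega).
Proof.
split; first by apply/(L2P oO); exact: sqi0.
move=> k p q hp hq; apply/(L2P oO).
by apply: (sqiD mO); [apply: (sqiZ mO)|]; apply/(L2P oO).
Qed.

Lemma norm0_lin (k : R) p q : L2 Omega p -> L2 Omega q ->
  norm0 Omega (k *: p + q) <= `|k| * norm0 Omega p + norm0 Omega q.
Proof.
move=> /(L2P oO) hp /(L2P oO) hq; have T := nrmD mO (sqiZ mO k hp) hq; rewrite (nrmZ mO k hp) in T.
by rewrite !norm0E.
Qed.

Definition pairing (X : state) (q : pt R -> R) : R := Defs.formB Omega X.1 q.

Lemma pairing_intg X q : SX X -> L2 Omega q ->
  intg leb3 Omega (fun x => q x * wdiv Omega X.1 x).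
Proof.
by move=> [hu _] /(L2P oO) hq; apply: (sqi_mul mO hq); exact: wdiv_sqi.
Qed.

(** The norm of the divergence is one of the summands of the norm of the
    state. *)
Lemma pairing_bound X q : SX X -> L2 Omega q ->
  `|pairing X q| <= normO X * norm0 Omega q.
Proof.
move=> [hu _] /(L2P oO) hq; rewrite /pairing /Defs.formB normrN.
apply: (le_trans (cauchy_schwarz mO hq (wdiv_sqi oO hu))).
rewrite mulrC norm0E ler_wpM2r ?nrm_ge0//.
apply: (le_trans (le_of_eq (esym (norm0E _ _)))).
exact: (le4_3 (norm0_ge0 Omega (wdiv Omega X.1)) (norm0v_ge0 Omega X.1)
  (norm0v_ge0 Omega (wcurl Omega X.1)) (norm0v_ge0 Omega X.2)).
Qed.

Lemma pairing_lin_l q : L2 Omega q -> linear_on SX (pairing ^~ q).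
Proof.
move=> hq k X Y hX hY.
have [_ SL] := states_lin_closed oO; have hXY := SL k _ _ hX hY.
have I1 := pairing_intg hX hq; have I2 := pairing_intg hY hq.
have E : ae_eq leb3 Omega (fun x => q x * wdiv Omega (k *: X + Y).1 x)
    (fun x => k * (q x * wdiv Omega X.1 x) + q x * wdiv Omega Y.1 x).
  apply: (ae1 (wdiv_lin k hX.1 hY.1)) => x + xO => /(_ xO) h.
  by rewrite -[(k *: X + Y).1]/(k *: X.1 + Y.1) h; ring.
have E1 := Rint_ae mO (intg_meas (pairing_intg hXY hq)) (intg_meas (intgD mO (intgZ mO k I1) I2)) E.
have E2 := RintegralD mO (intgZ mO k I1) I2; have E3 := RintegralZl k mO I1.
apply: etrans (congr1 -%R (etrans E1 (etrans E2 (congr1 (+%R^~ _) E3)))) _.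
by rewrite /= opprD -mulrN.
Qed.

Lemma pairing_lin_r X : SX X -> linear_on (L2 Omega) (pairing X).
Proof.
move=> hX k p q hp hq.
have I1 := pairing_intg hX hp; have I2 := pairing_intg hX hq.
have E2 := RintegralD mO (intgZ mO k I1) I2; have E3 := RintegralZl k mO I1.
have E1 : \int[leb3]_(x in Omega) ((k *: p + q) x * wdiv Omega X.1 x) =
   \int[leb3]_(x in Omega) (k * (p x * wdiv Omega X.1 x) + q x * wdiv Omega X.1 x).
  by apply: eq_Rintegral => x _; rewrite mulrA -mulrDl.
apply: etrans (congr1 -%R (etrans E1 (etrans E2 (congr1 (+%R^~ _) E3)))) _.
by rewrite /= opprD -mulrN.
Qed.

Lemma formG_intg f X : L2v Omega f -> SX X ->
  intg leb3 Omega (fun x => dot (f x) (X.1 x)) /\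
  `|formG Omega f X.1| <= norm0v Omega f * normO X.
Proof.
move=> hf [hu _].
have mf := mfield_L2v oO hf; have mu := mfield_L2v oO (H10v_L2v hu).
have sf := sqi_enorm oO (L2v_sqi oO hf).
have su := sqi_enorm oO (L2v_sqi oO (H10v_L2v hu)).
have [|I b] := @int_dominated _ _ _ leb3 Omega mO _ _ _ 1 (meas_dot mf mu) sf su.
  by apply: aeW => x _; rewrite mul1r; exact: dot_le.
split => //; apply: (le_trans b); rewrite normr1 mul1r -!norm0vE.
rewrite ler_wpM2l ?norm0v_ge0//.
exact: (le4_1 (norm0v_ge0 Omega X.1) (norm0v_ge0 Omega (wcurl Omega X.1))
  (norm0_ge0 Omega (wdiv Omega X.1)) (norm0v_ge0 Omega X.2)).
Qed.

Lemma formG_lin f : L2v Omega f -> linear_on SX (fun X => formG Omega f X.1).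
Proof.
move=> hf k X Y hX hY.
have [I1 _] := formG_intg hf hX; have [I2 _] := formG_intg hf hY.
have E2 := RintegralD mO (intgZ mO k I1) I2; have E3 := RintegralZl k mO I1.
have E1 : formG Omega f (k *: X + Y).1 =
   \int[leb3]_(x in Omega) (k * dot (f x) (X.1 x) + dot (f x) (Y.1 x)).
  by apply: eq_Rintegral => x _; rewrite -dot_lin_r.
by apply: (etrans E1); apply: (etrans E2); congr (_ + _).
Qed.

(** Weak derivatives do not see null sets: the defining integrals only
    depend on the class of the function. *)
Lemma wpartial_null f i : H1 Omega f -> ae_eq leb3 Omega f (cst 0) ->
  ae_eq leb3 Omega (wpartial Omega i f) (cst 0).
Proof.
move=> hf f0; have [_ dL wf] := H1_wpartial i hf.
apply: (fundamental_lemma oO dL) => phi tp.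
have tdp := test_deriv i tp.
have mf := (H1_sqi oO hf).1; have md := (test_sqi oO tdp).1.
apply: oppr_inj; rewrite -(wf _ tp) oppr0.
have E : \int[leb3]_(x in Omega) (f x * 'D_(basis_pt R i) phi x) =
    \int[leb3]_(x in Omega) (cst (0 : R) x).
  apply: (Rint_ae mO) => //; first exact: measurable_funM.
  by apply: (ae1 f0) => x + xO => /(_ xO) ->; rewrite mul0r.
by apply: (etrans E); rewrite Rintegral_cst// mul0r.
Qed.

Lemma state_norm_null X : SX X -> ae_eq leb3 Omega X.1 (cst 0) ->
  ae_eq leb3 Omega X.2 (cst 0) -> normO X = 0.
Proof.
move=> [hu hw] u0 w0.
have nv v : mfield Omega v -> ae_eq leb3 Omega v (cst 0) -> norm0v Omega v = 0.
  move=> mv v0; rewrite norm0vE -[RHS](nrm0 leb3 mO); apply: (nrm_ae mO) => //.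
    exact: meas_enorm.
  by apply: (ae1 v0) => x + xO => /(_ xO) ->; exact: enorm0.
have G0 : ae_eq leb3 Omega (wgradv Omega X.1) (cst 0).
  have h (ij : 'I_3 * 'I_3) : {ae leb3, forall x : mpt R, Omega x -> wgradv Omega X.1 x ij.1 ij.2 = 0}.
    have u0i : ae_eq leb3 Omega (fun x => X.1 x ij.1 0) (cst 0).
      by apply: (ae1 u0) => x + xO => /(_ xO) ->; rewrite mxE.
    have := wpartial_null ij.2 (H10_H1 (hu ij.1)) u0i.
    by move=> h; apply: (ae1 h) => x + xO => /(_ xO); rewrite mxE.
  apply: (ae1 (ae_all h)) => x hx xO; apply/matrixP => i j.
  by rewrite (hx (i, j) xO) mxE.
have c0 : ae_eq leb3 Omega (wcurl Omega X.1) (cst 0).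
  apply: (ae1 G0) => x + xO => /(_ xO) h; rewrite wcurlE h.
  by apply/colP => i; rewrite !mxE subrr.
have d0 : norm0 Omega (wdiv Omega X.1) = 0.
  rewrite norm0E -[RHS](nrm0 leb3 mO); apply: (nrm_ae mO) => //.
    exact: (wdiv_sqi oO hu).1.
  by apply: (ae1 G0) => x + xO => /(_ xO) h; rewrite /wdiv h mxtrace0.
rewrite /state_norm d0 (nv _ (mfield_L2v oO (H10v_L2v hu)) u0) (nv _ (mfield_L2v oO hw) w0).
by rewrite (nv _ (mfield_wcurl hu) c0) !addr0.
Qed.

Lemma norm0v_eq0 v : L2v Omega v -> norm0v Omega v = 0 -> ae_eq leb3 Omega v (cst 0).
Proof.
move=> hv; rewrite norm0vE => v0.
have := nrm_eq0 mO (sqi_enorm oO (L2v_sqi oO hv)) v0.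
by move=> h; apply: (ae1 h) => x + xO => /(_ xO)/enorm_eq0.
Qed.

Lemma pair_norm_le u w : pair_norm Omega u w <= normO (u, w).
Proof.
have a := norm0v_ge0 Omega u; have b := norm0v_ge0 Omega (wcurl Omega u).
have c := norm0_ge0 Omega (wdiv Omega u); have d := norm0v_ge0 Omega w.
apply: le_of_sqr; first exact: state_norm_ge0.
have tE : tnorm1 Omega u ^+ 2 = norm0v Omega u ^+ 2 + norm0v Omega (wcurl Omega u) ^+ 2
    + norm0 Omega (wdiv Omega u) ^+ 2.
  by rewrite sqr_sqrtr// !addr_ge0// sqr_ge0.
have pE : pair_norm Omega u w ^+ 2 = tnorm1 Omega u ^+ 2 + norm0v Omega w ^+ 2.
  by rewrite sqr_sqrtr// addr_ge0// sqr_ge0.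
rewrite pE tE; exact: sumsq_le.
Qed.

Lemma state_norm_le_tnorm1 u w : normO (u, w) <= 3 * tnorm1 Omega u + norm0v Omega w.
Proof.
have a := norm0v_ge0 Omega u; have b := norm0v_ge0 Omega (wcurl Omega u).
have c := norm0_ge0 Omega (wdiv Omega u).
have t0 : 0 <= tnorm1 Omega u by exact: sqrtr_ge0.
have tE : tnorm1 Omega u ^+ 2 = norm0v Omega u ^+ 2 + norm0v Omega (wcurl Omega u) ^+ 2
    + norm0 Omega (wdiv Omega u) ^+ 2.
  by rewrite sqr_sqrtr// !addr_ge0// sqr_ge0.
have sq := @sqr_ge0 R.
have h1 : norm0v Omega u <= tnorm1 Omega u.
  by apply: le_of_sqr => //; rewrite tE -addrA lerDl addr_ge0.
have h2 : norm0v Omega (wcurl Omega u) <= tnorm1 Omega u.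
  by apply: le_of_sqr => //; rewrite tE addrAC lerDr addr_ge0.
have h3 : norm0 Omega (wdiv Omega u) <= tnorm1 Omega u.
  by apply: le_of_sqr => //; rewrite tE lerDr addr_ge0.
exact: le3_mul.
Qed.

(** Relates the component-wise H^1 norm, in which the inf-sup condition is
    stated, to the norm of the gradient matrix. *)
Lemma sqr_norm1v u : H10v Omega u -> norm1v Omega u ^+ 2 =
  norm0v Omega u ^+ 2 + n0 (fun x => frob (wgradv Omega u x)) ^+ 2.
Proof.
move=> hu; have g k l := wgradv_sqi oO k l hu.
have su i := L2v_sqi oO (H10v_L2v hu) i.
rewrite /norm1v sqr_sqrtr; last by rewrite sumr_ge0// => i _; rewrite sqr_ge0.
have Iu : n0 (fun x => enorm (u x)) ^+ 2 = \sum_i n0 (fun x => u x i 0) ^+ 2.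
  rewrite sum3 !sqr_nrm.
  have J i := (su i).2.
  have E1 := RintegralD mO (intgD mO (J 0) (J 1)) (J 2%:R).
  have E2 := RintegralD mO (J 0) (J 1).
  rewrite -E2 -E1; apply: eq_Rintegral => x _.
  by rewrite sqr_enorm dotE -!expr2.
have Ig : n0 (fun x => frob (wgradv Omega u x)) ^+ 2 =
    \sum_i \sum_j n0 (fun x => wgradv Omega u x i j) ^+ 2.
  rewrite !sum3 !sqr_nrm.
  have J i j := (g i j).2.
  have A i := intgD mO (J i 0) (J i 1).
  have B i := intgD mO (A i) (J i 2%:R).
  have F1 i := RintegralD mO (A i) (J i 2%:R).
  have F2 i := RintegralD mO (J i 0) (J i 1).
  rewrite -!F2 -!F1.
  have H1 := RintegralD mO (B 0) (B 1).
  have H2 := RintegralD mO (intgD mO (B 0) (B 1)) (B 2%:R).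
  rewrite -H1 -H2; apply: eq_Rintegral => x _.
  by rewrite sqr_frob !sum3.
rewrite norm0vE Iu Ig -big_split /=; apply: eq_bigr => i _.
rewrite norm1_sqr; congr (_ + _); apply: eq_bigr => j _; congr (n0 _ ^+ 2).
by apply/funext => x; rewrite mxE.
Qed.

Lemma state_norm_le_norm1v u : H10v Omega u -> normO (u, 0) <= 3 * norm1v Omega u.
Proof.
move=> hu.
have a := norm0v_ge0 Omega u; have b := norm0v_ge0 Omega (wcurl Omega u).
have c := norm0_ge0 Omega (wdiv Omega u).
have t0 : 0 <= norm1v Omega u by exact: sqrtr_ge0.
have tE := sqr_norm1v hu; rewrite (sqr_nrm_frob oO hu) addrA in tE.
have sq := @sqr_ge0 R.
have h1 : norm0v Omega u <= norm1v Omega u.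
  by apply: le_of_sqr => //; rewrite tE -addrA lerDl addr_ge0.
have h2 : norm0v Omega (wcurl Omega u) <= norm1v Omega u.
  by apply: le_of_sqr => //; rewrite tE addrAC lerDr addr_ge0.
have h3 : norm0 Omega (wdiv Omega u) <= norm1v Omega u.
  by apply: le_of_sqr => //; rewrite tE lerDr addr_ge0.
have h4 : norm0v Omega 0 = 0.
  rewrite norm0vE -[RHS](nrm0 leb3 mO); congr n0.
  by apply/funext => x; rewrite enorm0.
rewrite /state_norm /= h4 -[leRHS]addr0; exact: le3_mul.
Qed.
End Couplings.
End OtherForms.

(** * Finite element spaces *)

Section FiniteElementSpaces.
Variable R : realType.

Local Notation vfield := (pt R -> 'cV[R]_3).
Local Notation state := (vfield * vfield)%type.

Section PiecewisePoly.
Variable M : {fset {fset pt R}}.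

Lemma piecewise_poly_lin m (k : R) f g : piecewise_poly M m f -> piecewise_poly M m g ->
  piecewise_poly M m (fun x => k * f x + g x).
Proof.
move=> hf hg T TM; have [P sP hP] := hf T TM; have [Q sQ hQ] := hg T TM.
exists (k *: P + Q).
  apply: (leq_trans (mpoly.msizeD_le _ _)); rewrite geq_max sQ andbT.
  exact: (leq_trans (mpoly.msizeZ_le _ _)).
apply: (ae2 hP hQ) => x h1 h2 xT.
by rewrite mpoly.mevalD mpoly.mevalZ h1// h2.
Qed.

Lemma piecewise_poly0 m : piecewise_poly M m (fun=> 0).
Proof.
move=> T TM; exists 0; first by rewrite mpoly.msize0.
by apply: aeW => x _; rewrite mpoly.meval0.
Qed.

(** The bound [D] is left free, so that one finite set of monomials serves
    for velocities, vorticities and pressures, whose degrees differ. *)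
Lemma piecewise_poly_coef (D m : nat) f (T : M) : (m < D)%N -> piecewise_poly M m f ->
  exists c : mpoly.bmultinom 3 D -> R, {ae leb3, forall x : mpt R, hull (val T) x ->
    f x = \sum_a c a * mpoly.mmap1 (fun i => vec x i 0) a}.
Proof.
move=> mD hf; have [P sP hP] := hf (val T) (valP T).
exists (fun a => mpoly.mcoeff a P); apply: (ae1 hP) => x h xT.
by rewrite h// /mpoly.meval (mpoly.mmapE (R:=R) (n:=3) D)//; exact: leq_trans sP mD.
Qed.
End PiecewisePoly.

Section FiniteElements.
Variables (Omega : set (pt R)) (M : {fset {fset pt R}}) (k l : nat).
Hypothesis oO : open Omega.
Hypothesis bO : bounded_set Omega.
Hypothesis cM : conforming_mesh Omega M.
Let mO : measurable (Omega : set (mpt R)) := meas_open oO.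
Local Notation SX := (states Omega).
Local Notation normO := (state_norm Omega).
Local Notation HhM := (Hh Omega M k).
Local Notation ZhM := (Zh Omega M l).
Local Notation QhM := (Qh Omega M k).

Lemma Hh_lin_closed : lin_closed HhM.
Proof.
have [h0 hl] := H10v_lin_closed oO; split.
  split => //; split => i; first exact: H10_H1 (h0 i).
  rewrite (_ : (fun x => _) = (fun=> 0)); first exact: piecewise_poly0.
  by apply/funext => x; rewrite mxE.
move=> t u v [[_ pu] hu] [[_ pv] hv].
have huv := hl t u v hu hv; split => //; split => i; first exact: H10_H1 (huv i).
by rewrite comp_lin; exact: piecewise_poly_lin.
Qed.

Lemma Zh_lin_closed : lin_closed ZhM.
Proof.
have [l0 ll] := L2v_lin_closed oO; split.
  split => // i; rewrite (_ : (fun x => _) = (fun=> 0)); first exact: piecewise_poly0.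
  by apply/funext => x; rewrite mxE.
move=> t u v [hu pu] [hv pv]; split; first exact: ll.
by move=> i; rewrite comp_lin; exact: piecewise_poly_lin.
Qed.

Lemma L2_intg q : L2 Omega q -> intg leb3 Omega q.
Proof.
move=> /(L2P oO) hq.
have s1 : sqi leb3 Omega (cst (1 : R)).
  split; first exact: measurable_cst.
  apply: measurable_bounded_integrable => //; first exact: bounded_fin.
    exact: (measurable_cst (1 ^+ 2 : R)).
  by exists 1; split => // y y1 x _; rewrite /= expr1n normr1 ltW.
have := sqi_mul mO hq s1.
by rewrite (_ : (fun x => q x * cst 1 x) = q)//; apply/funext => x; rewrite mulr1.
Qed.

Lemma L20_lin_closed : lin_closed (L20 Omega).
Proof.
have [h0 hl] := L2_lin_closed oO; split.
  by split; [exact: h0|rewrite Rintegral_cst// mul0r].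
move=> t p q [hp ip] [hq iq]; split; first exact: (hl t p q hp hq).
have I1 := L2_intg hp; have I2 := L2_intg hq.
have E := RintegralD mO (intgZ mO t I1) I2; have E2 := RintegralZl t mO I1.
by apply: (etrans E); rewrite E2 ip iq mulr0 addr0.
Qed.

Lemma Qh_lin_closed : lin_closed QhM.
Proof.
have [h0 hl] := L20_lin_closed; split.
  split => //; split; last exact: piecewise_poly0.
  exact: H10_H1 (H10_zero oO).
move=> t p q [[hp pp] p0] [[hq pq] q0]; split; last exact: hl.
split; first exact: H1_lin.
exact: piecewise_poly_lin.
Qed.

Definition Xh : set state := [set X | HhM X.1 /\ ZhM X.2].

Lemma Xh_lin_closed : lin_closed Xh.
Proof. exact: lin_closed_prod Hh_lin_closed Zh_lin_closed. Qed.

Lemma Xh_sub : Xh `<=` SX.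
Proof. by move=> X [[_ h] [z _]]. Qed.

Lemma Qh_sub : QhM `<=` L2 Omega.
Proof. by move=> q [_ []]. Qed.

(** Velocity, vorticity and pressure are treated alike, as seven scalar
    components. *)
Definition component (i : 'I_3 + 'I_3 + unit) (s : state * (pt R -> R)) : pt R -> R :=
  match i with
  | inl (inl i) => fun x => s.1.1 x i 0
  | inl (inr i) => fun x => s.1.2 x i 0
  | inr tt => s.2
  end.

Let D := (k.+2 + l.+1)%N.
Notation index := (('I_3 + 'I_3 + unit) * M * mpoly.bmultinom 3 D)%type.

(** The coefficients of every component on every tetrahedron. This is a
    relation, as the polynomials are prescribed almost everywhere only. *)
Definition coordinates (s : state * (pt R -> R)) (c : 'rV[R]_#|{: index}|) : Prop :=
  forall i (T : M), {ae leb3, forall x : mpt R, hull (val T) x ->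
    component i s x = \sum_a c 0 (enum_rank (i, T, a)) *
       mpoly.mmap1 (fun j => vec x j 0) a}.

Definition Sh : set (state * (pt R -> R)) := [set s | Xh s.1 /\ QhM s.2].

Lemma Sh_lin_closed : lin_closed Sh.
Proof. exact: lin_closed_prod Xh_lin_closed Qh_lin_closed. Qed.

Lemma component_lin i (t : R) s s' :
  component i (t *: s + s') = (fun x => t * component i s x + component i s' x).
Proof.
apply/funext => x; case: i => [[i|i]|[]] /=; rewrite ?mxE//.
Qed.

Lemma coordinates_lin (t : R) s s' c c' : coordinates s c -> coordinates s' c' ->
  coordinates (t *: s + s') (t *: c + c').
Proof.
move=> h h' i T; apply: (ae2 (h i T) (h' i T)) => x e e' xT.
rewrite component_lin e// e'// mulr_sumr -big_split /=; apply: eq_bigr => a _.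
by rewrite !mxE mulrDl mulrA.
Qed.

Lemma coordinates_ex s : Sh s -> exists c, coordinates s c.
Proof.
move=> [[[[_ pu] _] [_ pw]] [[_ pq] _]].
have h (iT : ('I_3 + 'I_3 + unit) * M) : exists c : mpoly.bmultinom 3 D -> R,
    {ae leb3, forall x : mpt R, hull (val iT.2) x ->
      component iT.1 s x = \sum_a c a * mpoly.mmap1 (fun j => vec x j 0) a}.
  case: iT => [[[i|i]|[]] T] /=.
  - apply: piecewise_poly_coef (pu i); exact: leq_addr.
  - apply: piecewise_poly_coef (pw i); exact: leq_addl.
  - apply: piecewise_poly_coef pq; exact: ltnW (leq_addr _ _).
have [c hc] := choice h.
exists (\row_r let '(i, T, a) := enum_val r in c (i, T) a) => i T.
apply: (ae1 (hc (i, T))) => x e xT; rewrite e//; apply: eq_bigr => a _.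
by rewrite mxE enum_rankK.
Qed.

(** The tetrahedra cover the domain, so that equal coefficients give
    components that are equal almost everywhere. *)
Lemma coordinates_inj s s' c : Sh s -> Sh s' -> coordinates s c -> coordinates s' c ->
  normO (s.1 - s'.1) = 0 /\ norm0 Omega (s.2 - s'.2) = 0.
Proof.
move=> [Xs Qs] [Xs' Qs'] h h'.
have comp0 i : {ae leb3, forall x : mpt R, Omega x -> component i s x = component i s' x}.
  have hT : {ae leb3, forall x : mpt R, forall T : M, hull (val T) x -> component i s x = component i s' x}.
    by apply: ae_all => T; apply: (ae2 (h i T) (h' i T)) => x e e' xT; rewrite e// e'.
  apply: (ae1 hT) => x hx xO.
  have [_ cov _] := cM.
  have : closure Omega x by exact: subset_closure.
  by rewrite -cov => -[T TM xT]; exact: (hx (FSetSub TM)).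
have subE (E : lmodType R) (p q : E) : p - q = -1 *: q + p by rewrite scaleN1r addrC.
have vec0 (u v : vfield) : (forall i, {ae leb3, forall x : mpt R, Omega x -> u x i 0 = v x i 0}) ->
    ae_eq leb3 Omega (u - v) (cst 0).
  move=> huv; apply: (ae1 (ae_all huv)) => x e xO; apply/colP => i.
  by rewrite !mxE e// subrr.
split.
  apply: (state_norm_null oO).
  - by rewrite subE; have [_ hl] := states_lin_closed oO; apply: hl; exact: Xh_sub.
  - by apply: vec0 => i; exact: (comp0 (inl (inl i))).
  - by apply: vec0 => i; exact: (comp0 (inl (inr i))).
have hq : L2 Omega (s.2 - s'.2).
  by rewrite subE; have [_ hl] := L2_lin_closed oO; apply: hl; exact: Qh_sub.
rewrite norm0E -[RHS](nrm0 leb3 mO); apply: (nrm_ae mO) => //.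
  by have /(L2P oO)[] := hq.
apply: (ae1 (comp0 (inr tt))) => x + xO => /(_ xO) /= e.
by rewrite -[LHS]/(s.2 x - s'.2 x) e subrr.
Qed.

Lemma finite_element_span : exists n (v : 'I_n -> state * (pt R -> R)),
  (forall i, Sh (v i)) /\ forall X q, Xh X -> QhM q ->
  exists w : 'I_n -> R, let s := \sum_i w i *: v i in
    normO (X - s.1) = 0 /\ norm0 Omega (q - s.2) = 0.
Proof.
have [n [v [Sv span]]] := finite_span Sh_lin_closed
  (fun t s s' c c' _ _ => @coordinates_lin t s s' c c') coordinates_ex.
exists n, v; split => // X q hX hq.
have [w [c [c1 c2]]] := span (X, q) (conj hX hq).
exists w => /=; apply: (@coordinates_inj (X, q) _ c) => //.
by apply: lin_closed_sum => //; exact: Sh_lin_closed.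
Qed.

(** The supremum is over velocities only; the zero vorticity completes
    them to states, and the norm of such a state is at most 3 times the
    H^1 norm. *)
Lemma inf_sup_transfer (beta : R) : 0 < beta -> discrete_inf_sup Omega HhM QhM beta ->
  inf_sup_on (pairing Omega) normO (norm0 Omega) (beta / 3) Xh QhM.
Proof.
move=> b0 is_ q L Vq L0 hL.
have [z0 _] := Zh_lin_closed.
have bnd v : HhM v -> (\int[leb3]_(x in Omega) (q x * wdiv Omega v x)) / norm1v Omega v <= 3 * L.
  move=> hv; have n0 : 0 <= norm1v Omega v by exact: sqrtr_ge0.
  have h1 := hL (v, 0) (conj hv z0); have h2 := state_norm_le_norm1v oO hv.2.
  have h3 : \int[leb3]_(x in Omega) (q x * wdiv Omega v x) <= L * normO (v, 0).
    by apply: le_trans h1; rewrite /pairing /Defs.formB normrN; exact: ler_norm.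
  have h4 := le_trans h3 (ler_wpM2l L0 h2).
  move: n0; rewrite le_eqVlt => /predU1P[<-|n0]; first by rewrite invr0 mulr0 mulr_ge0.
  by rewrite ler_pdivrMr// (le_trans h4)// mulrCA mulrA.
have h : ((beta * norm0 Omega q)%:E <= (3 * L)%:E)%E.
  apply: (le_trans (is_ q Vq)); apply: ge_ereal_sup => _ [v [hv _] <-].
  by rewrite lee_fin; exact: bnd.
by move: h; rewrite lee_fin mulrAC ler_pdivrMr// [L * 3]mulrC.
Qed.
End FiniteElements.
End FiniteElementSpaces.

(** * The Galerkin method *)

Section Galerkin.
Variable R : realType.

Local Notation vfield := (pt R -> 'cV[R]_3).
Local Notation state := (vfield * vfield)%type.

Section Discretization.
Variables (Omega : set (pt R)) (nu : pt R -> R) (nu0 nu1 : R).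
Variables (K : pt R -> 'M[R]_3) (smin smax kappa1 kappa2 : R).
Hypothesis oO : open Omega.
Hypothesis bO : bounded_set Omega.
Hypothesis hnu : viscosity Omega nu0 nu1 nu.
Hypothesis hK : permeability Omega smin smax K.
Hypothesis hgrad : 4 * grad_sup Omega nu ^+ 2 / (smin * nu0 ^+ 2) < 1 / 4.
Hypothesis hkappa1 : 1 / 2 < kappa1 < 3 / 2.
Hypothesis hkappa2 : nu0 / 4 < kappa2.
Let a (X Y : state) := formA Omega nu nu0 K kappa1 kappa2 X.1 X.2 Y.1 Y.2.
Variable M : R.
Hypothesis hM : bounded_bilinear Omega a M.
Let mO : measurable (Omega : set (mpt R)) := meas_open oO.
Local Notation SX := (states Omega).
Local Notation normO := (state_norm Omega).

Variables (mesh : {fset {fset pt R}}) (k l : nat) (beta : R).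
Hypothesis cM : conforming_mesh Omega mesh.
Hypothesis beta0 : 0 < beta.
Local Notation Vh := (Hh Omega mesh k).
Local Notation Wh := (Zh Omega mesh l).
Local Notation Ph := (Qh Omega mesh k).
Hypothesis infsup : discrete_inf_sup Omega Vh Ph beta.
Local Notation disc f :=
  (solves Omega nu nu0 K kappa1 kappa2 f Vh Wh Ph).

Let alpha := coercivity_const nu0 smin kappa2.
Let alpha0 : 0 < alpha.
Proof.
by apply: coercivity_const_gt0 => //; [have [] := hnu|have [_ _ _ []] := hK].
Qed.

(** The bound of the form is increased by 1 in order to bound the
    divergence pairing as well. *)
Definition galerkin_const := stab_const (M + 1) alpha (beta / 3).

Let M0 : 0 <= M. Proof. by have [] := hM. Qed.
Let M10 : 0 <= M + 1. Proof. by rewrite addr_ge0. Qed.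
Let be0 : 0 < beta / 3. Proof. by rewrite divr_gt0. Qed.
Let SXl : lin_closed SX := states_lin_closed oO.
Let SQl : lin_closed (L2 Omega) := L2_lin_closed oO.
Let nX0 (X : state) : 0 <= normO X := state_norm_ge0 Omega X.
Let nQ0 (q : pt R -> R) : 0 <= norm0 Omega q := norm0_ge0 Omega q.
Let a_l (Y : state) : SX Y -> linear_on SX (a ^~ Y).
Proof. by have [_ h _ _] := hM; exact: h. Qed.
Let a_r (X : state) : SX X -> linear_on SX (a X).
Proof. by have [_ _ h _] := hM; exact: h. Qed.
Let le1 (x y z : R) : 0 <= y -> x <= z * y -> x <= (z + 1) * y.
Proof. by move=> y0 h; rewrite mulrDl mul1r (le_trans h)// lerDl. Qed.
Let a_bd (X Y : state) : SX X -> SX Y -> `|a X Y| <= (M + 1) * normO X * normO Y.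
Proof.
move=> hX hY; have [_ _ _ h] := hM.
by rewrite -mulrA; apply: le1; [rewrite mulr_ge0|rewrite mulrA; exact: h].
Qed.
Let b_bd (X : state) (q : pt R -> R) : SX X -> L2 Omega q ->
  `|pairing Omega X q| <= (M + 1) * normO X * norm0 Omega q.
Proof.
move=> hX hq; apply: (le_trans (pairing_bound oO hX hq)); rewrite -mulrA.
by rewrite ler_peMl ?mulr_ge0// lerDr.
Qed.
Let a_coer (X : state) : SX X -> alpha * normO X ^+ 2 <= a X X.
Proof. exact: (formA_coercive oO hnu hK hgrad hkappa1 hkappa2). Qed.
Let is_ := inf_sup_transfer (l := l) oO beta0 infsup.
Let Xhl := Xh_lin_closed mesh k l oO.
Let Qhl := Qh_lin_closed mesh k oO bO.
Let Xhs : Xh Omega mesh k l `<=` SX := @Xh_sub _ _ _ _ _.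
Let Qhs : Ph `<=` L2 Omega := @Qh_sub _ _ _ _.

Lemma galerkin_const_gt0 : 0 < galerkin_const.
Proof. exact: stab_const_gt0. Qed.

Lemma galerkin_stable f u w p : L2v Omega f -> disc f u w p ->
  normO (u, w) + norm0 Omega p <= galerkin_const * norm0v Omega f.
Proof.
move=> hf [hu hw hp e1 e2].
rewrite -[norm0v Omega f]addr0.
apply: (saddle_stability nX0 nQ0 M10 alpha0 be0 a_bd a_coer Xhs Qhs is_) => //.
- exact: norm0v_ge0.
- move=> Y hY; have -> : a (u, w) Y + pairing Omega Y p = formG Omega f Y.1.
    by apply: e1; [exact: hY.1|exact: hY.2].
  by have [_] := formG_intg oO hf (Xhs hY).
- by move=> q hq; rewrite mul0r /pairing e2// normr0.
Qed.

Lemma galerkin_exists f : L2v Omega f -> exists u w p, disc f u w p.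
Proof.
move=> hf; have [n [v [Sv span]]] := finite_element_span k l oO bO cM.
have [|x [p [Vx Vp e1 e2]]] := @saddle_solvable _ _ _ _ _ _ _ _ _ _ _ _
  nQ0 a_l a_r (pairing_lin_l oO) (pairing_lin_r oO)
  alpha0 be0 a_bd b_bd a_coer _ _ (fun X => formG Omega f X.1) (norm0v Omega f) n v
  Xhs Qhs Xhl Qhl is_ (formG_lin oO hf) (norm0v_ge0 Omega f) _ Sv span.
  by move=> Y hY; have [] := formG_intg oO hf hY.
exists x.1, x.2, p; case: Vx => Vx1 Vx2; split => //.
by move=> v' t hv ht; apply: (e1 (v', t)).
Qed.

Let ae_eq_sub (V : lmodType R) (u v : pt R -> V) :
  ae_eq leb3 Omega (-1 *: u + v) (cst 0) -> ae_eq leb3 Omega v u.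
Proof.
move=> h; apply: (ae1 h) => x + xO => /(_ xO) e; apply/eqP.
by rewrite -subr_eq0 addrC -scaleN1r; apply/eqP.
Qed.

(** The difference of two solutions solves the problem with zero load,
    hence has zero norm by stability. *)
Lemma galerkin_unique f u w p u' w' p' : L2v Omega f ->
  disc f u w p -> disc f u' w' p' ->
  [/\ ae_eq leb3 Omega u' u, ae_eq leb3 Omega w' w & ae_eq leb3 Omega p' p].
Proof.
move=> hf [hu hw hp e1 e2] [hu' hw' hp' e1' e2'].
have hX : Xh Omega mesh k l (u, w) by exact: conj hu hw.
have hX' : Xh Omega mesh k l (u', w') by exact: conj hu' hw'.
have hD := Xhl.2 (-1) _ _ hX hX'; have hd := Qhl.2 (-1) _ _ hp hp'.
have S := saddle_stability nX0 nQ0 M10 alpha0 be0 a_bd a_coer Xhs Qhs is_ hD hd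
  (lexx 0) (lexx 0).
have {S}/= S : normO (-1 *: (u, w) + (u', w')) + norm0 Omega (-1 *: p + p') <=
    galerkin_const * (0 + 0).
  apply: S => [Y hY|q hq].
    rewrite (a_l (Xhs hY) _ (Xhs hX) (Xhs hX')) (pairing_lin_r oO (Xhs hY) _ (Qhs hp) (Qhs hp')).
    have E1 : a (u, w) Y + pairing Omega Y p = formG Omega f Y.1 := e1 _ _ hY.1 hY.2.
    have E1' : a (u', w') Y + pairing Omega Y p' = formG Omega f Y.1 := e1' _ _ hY.1 hY.2.
    by rewrite addrACA -mulrDr E1 E1' mulN1r addNr normr0 mul0r.
  rewrite (pairing_lin_l oO (Qhs hq) _ (Xhs hX) (Xhs hX')).
  by rewrite /pairing e2// e2'// mulr0 addr0 normr0 mul0r.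
rewrite addr0 mulr0 in S.
have n0 : normO (-1 *: (u, w) + (u', w')) = 0.
  by apply/eqP; rewrite eq_le nX0 andbT (le_trans _ S)// lerDl.
have q0 : norm0 Omega (-1 *: p + p') = 0.
  by apply/eqP; rewrite eq_le nQ0 andbT (le_trans _ S)// lerDr.
have [sD1 sD2] := Xhs hD.
split; apply: ae_eq_sub.
- apply: (norm0v_eq0 oO); first exact: (H10v_L2v sD1).
  apply/eqP; rewrite eq_le norm0v_ge0 andbT -n0.
  exact: (le4_1 (norm0v_ge0 _ _) (norm0v_ge0 _ _) (norm0_ge0 _ _) (norm0v_ge0 _ _)).
- apply: (norm0v_eq0 oO); first exact: sD2.
  apply/eqP; rewrite eq_le norm0v_ge0 andbT -n0 /state_norm.
  by rewrite lerDr !addr_ge0 ?norm0v_ge0 ?norm0_ge0.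
- have /(L2P oO) sd := Qhs hd.
  by apply: (nrm_eq0 mO sd); rewrite -norm0E.
Qed.

(** Quasi-optimality holds for every competitor, hence for the infimum;
    the factor 3 comes from the comparison of the two norms of the
    velocity. *)
Lemma galerkin_error f u w p uh wh ph :
  solves Omega nu nu0 K kappa1 kappa2 f (H10v Omega) (L2v Omega) (L20 Omega) u w p ->
  disc f uh wh ph ->
  pair_norm Omega (fun x => u x - uh x) (fun x => w x - wh x)
    + norm0 Omega (fun x => p x - ph x) <=
  3 * (1 + galerkin_const * (2 * (M + 1))) * best_approx Omega Vh Wh Ph u w p.
Proof.
move=> [hu hw hp e1 e2] [hu' hw' hp' e1' e2'].
have C0 : 0 < 3 * (1 + galerkin_const * (2 * (M + 1))).
  rewrite mulr_gt0// ltr_pwDl// mulr_ge0 ?(ltW galerkin_const_gt0)// mulr_ge0//.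
rewrite mulrC -ler_pdivrMr//; apply: lb_le_inf.
  have [[x0 z0] _] := Xhl; have [q0 _] := Qhl.
  by exists (tnorm1 Omega (fun x => u x - (0 : vfield) x)
    + norm0v Omega (fun x => w x - (0 : vfield) x)
    + norm0 Omega (fun x => p x - (0 : pt R -> R) x)), 0, 0, 0.
move=> d [v [t [q [hv ht hq ->]]]]; rewrite ler_pdivrMr//.
have := @saddle_quasi_optimal _ _ _ _ _ _ _ _ _ _ _ _ SXl SQl nX0 nQ0
  (state_norm_lin oO) (norm0_lin oO) a_l (pairing_lin_l oO) (pairing_lin_r oO)
  M10 alpha0 be0 a_bd b_bd a_coer _ _ (u, w) p (uh, wh) ph (v, t) q
  (fun X => formG Omega f X.1)
  Xhs Qhs Xhl Qhl is_ (conj hu hw) hp.1 (conj hu' hw') hp' (conj hv ht) hq.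
move=> /(_ _ _ _ _)/wrap[||||h].
- by move=> Y hY; have [? ?] := Xhs hY; apply: e1.
- by move=> r [_ hr]; apply: e2.
- by move=> Y [? ?]; apply: e1'.
- by move=> r hr; apply: e2'.
have h1 := pair_norm_le Omega (fun x => u x - uh x) (fun x => w x - wh x).
have h2 := state_norm_le_tnorm1 Omega (fun x => u x - v x) (fun x => w x - t x).
have A0 : 0 <= 1 + galerkin_const * (2 * (M + 1)).
  by rewrite addr_ge0// mulr_ge0 ?(ltW galerkin_const_gt0)// mulr_ge0.
have n3 : norm0v Omega (fun x => w x - t x) <= 3 * norm0v Omega (fun x => w x - t x).
  by rewrite ler_peMl ?norm0v_ge0// ler1n.
have n4 : norm0 Omega (fun x => p x - q x) <= 3 * norm0 Omega (fun x => p x - q x).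
  by rewrite ler_peMl ?norm0_ge0// ler1n.
apply: (le_trans (lerD h1 (lexx _))); apply: (le_trans h).
have mulE (x y z : R) : x * (y * z) = z * (y * x) by ring.
rewrite [X in _ <= X]mulE; apply: (ler_wpM2l A0).
rewrite !mulrDr; apply: lerD n4; apply: (le_trans h2); exact: lerD.
Qed.
End Discretization.
End Galerkin.

Theorem theorem3p1 (R : realType) (Omega : set (pt R))
  (nu : pt R -> R) (nu0 nu1 : R)
  (K : pt R -> 'M[R]_3) (smin smax : R) (kappa1 kappa2 : R)
  (hs : set R) (mesh : R -> {fset {fset pt R}}) (k l : nat) (beta : R)
  (hOmega : bounded_lipschitz_domain Omega)
  (hnu : viscosity Omega nu0 nu1 nu)
  (hK : permeability Omega smin smax K)
  (hgrad : 4 * grad_sup Omega nu ^+ 2 / (smin * nu0 ^+ 2) < 1 / 4)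
  (hkappa1 : 1 / 2 < kappa1 < 3 / 2)
  (hkappa2 : nu0 / 4 < kappa2)
  (hmesh : shape_regular_family Omega hs mesh)
  (hk : (1 <= k)%N)
  (hbeta : 0 < beta)
  (hinfsup : forall h, hs h ->
     discrete_inf_sup Omega (Hh Omega (mesh h) k) (Qh Omega (mesh h) k) beta) :
  let solves_cont f := solves Omega nu nu0 K kappa1 kappa2 f
    (H10v Omega) (L2v Omega) (L20 Omega) in
  let solves_disc f h := solves Omega nu nu0 K kappa1 kappa2 f
    (Hh Omega (mesh h) k) (Zh Omega (mesh h) l) (Qh Omega (mesh h) k) in
  (forall f h, L2v Omega f -> hs h ->
     exists uh omegah ph,
       solves_disc f h uh omegah ph /\
       forall uh' omegah' ph', solves_disc f h uh' omegah' ph' ->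
         [/\ ae_eq leb3 Omega uh' uh, ae_eq leb3 Omega omegah' omegah &
             ae_eq leb3 Omega ph' ph]) /\
  exists C1 C2 : R, [/\ 0 < C1, 0 < C2 &
    forall f h, L2v Omega f -> hs h ->
    forall uh omegah ph, solves_disc f h uh omegah ph ->
      pair_norm Omega uh omegah + norm0 Omega ph <= C1 * norm0v Omega f /\
      forall u omega p, solves_cont f u omega p ->
        pair_norm Omega (fun x => u x - uh x) (fun x => omega x - omegah x)
        + norm0 Omega (fun x => p x - ph x)
        <= C2 * best_approx Omega (Hh Omega (mesh h) k) (Zh Omega (mesh h) l)
                  (Qh Omega (mesh h) k) u omega p].
Proof.
move=> sc sd; have [oO _ _ bO _] := hOmega.
have [M _ hM] := formA_bounded kappa1 kappa2 oO hnu hK.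
have cM h : hs h -> conforming_mesh Omega (mesh h) by move=> /(hmesh.1 h)[].
split.
  move=> f h hf hh.
  have [u [w [p hs']]] := galerkin_exists oO bO hnu hK hgrad hkappa1 hkappa2 hM l
    (cM h hh) hbeta (hinfsup h hh) hf.
  exists u, w, p; split => // u' w' p' hs''.
  exact: (galerkin_unique oO bO hnu hK hgrad hkappa1 hkappa2 hM hbeta (hinfsup h hh) hf hs' hs'').
have g0 := galerkin_const_gt0 hnu hK hkappa2 hM hbeta.
have [M0 _ _ _] := hM.
exists (galerkin_const nu0 smin kappa2 M beta),
  (3 * (1 + galerkin_const nu0 smin kappa2 M beta * (2 * (M + 1)))).
split => //.
  by rewrite mulr_gt0// ltr_pwDl// mulr_ge0 ?(ltW g0)// mulr_ge0// addr_ge0.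
move=> f h hf hh u w p hs'; split.
  apply: le_trans (galerkin_stable oO hnu hK hgrad hkappa1 hkappa2 hM hbeta (hinfsup h hh) hf hs').
  by apply: lerD => //; exact: pair_norm_le.
move=> u0 w0 p0 hc.
exact: (galerkin_error oO bO hnu hK hgrad hkappa1 hkappa2 hM hbeta (hinfsup h hh) hc hs').
Qed.
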